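(* Let $X$ be any one of the following types: $[3^7]$, $[3^5,4^1]$, $[3^4,4^2]$, $[3^3,4^1,3^1,4^1]$, $[3^5,5^1]$, $[3^4,7^1]$, $[3^4,8^1]$, $[3^4,9^1]$, $[3^4,10^1]$, $[3^2,5^1,3^1,5^1]$, $[3^3,4^1,6^1]$, $[3^2,4^1,3^1,6^1]$, $[3^1,4^1,3^1,4^2]$, $[3^1,4^4]$, $[3^1,7^1,3^1,7^1]$, $[3^1,4^1,7^1,4^1]$, $[3^1,4^1,8^1,4^1]$, $[4^3,5^1]$, $[3^1,4^1,9^1,4^1]$, $[3^1,4^1,10^1,4^1]$, $[3^1,5^3]$, $[3^1,6^1,4^1,6^1]$, $[4^1,6^1,18^1]$, $[4^3,6^1]$, $[5^1,4^1,5^1,4^1]$, $[4^1,6^1,14^1]$, $[4^1,6^1,16^1]$, $[4^1,6^1,20^1]$, $[4^1,8^1,10^1]$, $[4^1,8^1,12^1]$, $[6^2,7^1]$, $[8^1,6^2]$, $[9^1,6^2]$, $[10^1,6^2]$, $[5^1,8^2]$, $[6^1,8^2]$, $[4^1,10^2]$, $[3^1,14^2]$, $[7^3]$. Then for every $m=2,3,4,\dots$ there exists a semi-equivelar map $\mathcal{K}^m$ of type $X$ (an $m$-covering map of a semi-equivelar map $\mathcal{K}$ of type $X$ on a surface of Euler characteristic $-2$) on a surface with Euler characteristic $\chi=-2m$, and $\mathrm{Aut}(\mathcal{K}^m)\cong\mathbb{D}_m$ (the dihedral group of order $2m$) or $\mathrm{Aut}(\mathcal{K}^m)\cong\mathbb{Z}_m$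 (the cyclic group of order $m$).
   Context: A surface is a connected closed 2-manifold (orientable or not). A map is a connected 2-dimensional cell complex on a surface (equivalently, a cellular embedding of a connected graph). All maps are polyhedral: a non-empty intersection of two distinct faces is either a vertex or an edge. Face-cycle, type: the faces containing a vertex $u$ form a cycle (the face-cycle at $u$) of the form $(F_{1,1}-\cdots-F_{1,n_1})-\cdots-(F_{k,1}-\cdots-F_{k,n_k})-F_{1,1}$, where $F_{i,\ell}$ is a $p_i$-gon for $1\le \ell\le n_i$, $1\le i\le k$, $p_r\ne p_{r+1}$ for $1\le r\le k-1$ and $p_k\ne p_1$ (if $k>1$). A map is semi-equivelar of type $[p_1^{n_1},\dots,p_k^{n_k}]$ ($p_i\ge 3$, $n_i\ge1$) if the face-cycle at every vertex has this form with the same cyclic sequence; types are considered up to cyclic rotation and reversal. $\mathrm{Aut}(\mathcal{K})$ is the group, under composition, of automorphisms of $\mathcal{K}$: bijections of the vertex set that map cells (edges, faces) to cells and preserve incidence, in both directions. Cycles: a cycle in a map is contractible if it bounds a 2-disk; genus-separating if it does not bound a 2-disk but separates the surface; non-trivial if it neither bounds a 2-disk nor is genus-separating. $\ell$-covering map $\mathcal{K}^{\ell}$: let $C$ be a non-trivial cycle of length $k$ in $\mathcal{K}$ which divides the face-cycles of its vertices, i.e. for every sub-path $u-v-w$ of length two of $C$, the path $u-v-w$ is a chord of the disk formed by the faces at $v$ (it splits the face-cycle of $v$ into faces on the two sides of $C$). Cut $\mathcal{K}$ along $C$ to get a map $\mathcal{M}$ with two boundary cycles $A(p_1,\dots,p_k)$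 and $B(q_1,\dots,q_k)$, where $p_i$ and $q_i$ come from the same vertex of $C$. Take $\ell$ copies $\mathcal{M}_1,\dots,\mathcal{M}_\ell$ of $\mathcal{M}$ with boundary cycles $A_i(p^i_1,\dots,p^i_k)$ and $B_i(q^i_1,\dots,q^i_k)$, and identify $B_i$ with $A_{i+1}$ via $q^i_j\mapsto p^{i+1}_j$ for $1\le i\le \ell$ (indices $i$ modulo $\ell$). The resulting map is called an $\ell$-covering map $\mathcal{K}^\ell$ of $\mathcal{K}$. *)

(* Defs.v *)
From HB Require Import structures.
From mathcomp Require Import all_boot all_order all_algebra all_fingroup.
From mathcomp Require Import all_solvable.

Set Implicit Arguments.
Unset Strict Implicit.
Unset Printing Implicit Defensive.

Import Order.TTheory GRing.Theory Num.Theory.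

(* An edge is given by its two endpoints and a face by its set of vertices.
   For a polyhedral map this loses nothing: if two distinct faces meet in at
   most one vertex or one edge, then the graph is simple, distinct faces have
   distinct vertex sets, and every edge with both endpoints on a face lies on
   the boundary of that face. *)
Record cell_complex : Type := CellComplex {
  vertex :> finType;
  edges : {set {set vertex}};
  faces : {set {set vertex}}
}.

Section Maps.
Variable K : cell_complex.
Implicit Types (u v w : K) (e f g : {set K}) (c : seq K) (s : seq {set K}).

Definition adj : rel K := [rel u v | [set u; v] \in edges K].

Definition is_polygon f : Prop :=
  exists c, [/\ 3 <= size c, uniq c, f = [set v in c]
    & {in f &, forall u v, adj u v = (v == next c u) || (v == prev c u)}].

(* [s], read cyclically, lists the faces at [v], consecutive faces sharing an
   edge at [v]. *)
Definition face_cycle v s : Prop :=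
  [/\ 3 <= size s, uniq s,
      forall f, (f \in s) = (f \in faces K) && (v \in f)
    & path.cycle (fun f g => [exists e in edges K,
        [&& v \in e, e \subset f & e \subset g]]) s].

(* Polyhedral maps on connected closed surfaces. Since every edge is on exactly
   two faces, the cyclic order of the faces at a vertex makes its star a disk. *)
Definition is_map : Prop :=
  [/\ [/\ 0 < #|K| & forall u v, connect adj u v],
      [/\ forall e, e \in edges K -> #|e| = 2
        & forall e, e \in edges K -> #|[set f in faces K | e \subset f]| = 2],
      forall f, f \in faces K -> is_polygon f,
      forall v, exists s, face_cycle v s
    & forall f g, f \in faces K -> g \in faces K -> f != g ->
        [\/ f :&: g = set0, #|f :&: g| = 1 | f :&: g \in edges K]].

Definition euler_char : int := (#|K|%:Z - #|edges K|%:Z + #|faces K|%:Z)%R.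

(* The type [p_1^{n_1}, ..., p_k^{n_k}] is the sequence of pairs (p_i, n_i). *)
Definition valid_type (X : seq (nat * nat)) : bool :=
  [&& X != [::], all (fun x => (3 <= x.1) && (1 <= x.2)) X
    & (1 < size X) ==> path.cycle (fun p q => p != q) (unzip1 X)].

Definition face_sizes (X : seq (nat * nat)) : seq nat :=
  flatten [seq nseq x.2 x.1 | x <- X].

(* A face-cycle may be read from any starting face and in either direction, so
   types are taken up to rotation and reversal. *)
Definition semi_equivelar (X : seq (nat * nat)) : Prop :=
  [/\ is_map, valid_type X
    & forall v, exists s,
        face_cycle v s /\ [seq #|f| | f : {set K} <- s] = face_sizes X].

Definition is_aut (a : {perm K}) : bool :=
  ([set a @: e | e : {set K} in edges K] == edges K) &&
  ([set a @: f | f : {set K} in faces K] == faces K).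

Lemma is_aut_group_set : group_set [set a | is_aut a].
Proof.
have imM (a b : {perm K}) (S : {set {set K}}) :
    [set (a * b)%g @: e | e : {set K} in S] =
    [set b @: e | e : {set K} in [set a @: e | e : {set K} in S]].
  rewrite -imset_comp; apply: eq_imset => e /=.
  by rewrite -imset_comp; apply: eq_imset => x /=; rewrite permM.
have im1 (S : {set {set K}}) : [set (1%g : {perm K}) @: e | e : {set K} in S] = S.
  rewrite -[RHS]imset_id; apply: eq_imset => e /=.
  by rewrite -[RHS]imset_id; apply: eq_imset => x /=; rewrite perm1.
apply/group_setP; split; first by rewrite inE /is_aut !im1 !eqxx.
move=> a b; rewrite !inE /is_aut !imM => /andP[/eqP-> /eqP->].
by [].
Qed.

Definition Aut_map : {group {perm K}} := Group is_aut_group_set.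

Definition is_cycle c : bool := [&& 3 <= size c, uniq c & path.cycle adj c].

Definition cycle_edges c : {set {set K}} := [set [set v; next c v] | v in c].

(* Connectedness of the union of the faces in [D] after removal of the edges in
   [R], moving between faces only across edges. *)
Definition faces_connected (D R : {set {set K}}) : Prop :=
  {in D &, forall f g, connect [rel f g | [&& f \in D, g \in D
     & [exists e in edges K :\: R, (e \subset f) && (e \subset g)]]] f g}.

Definition boundary_edges (D : {set {set K}}) : {set {set K}} :=
  [set e in edges K | #|[set f in D | e \subset f]| == 1].

Definition edges_of (D : {set {set K}}) : {set {set K}} :=
  [set e in edges K | [exists f in D, e \subset f]].

(* The union of the faces in [D] is a compact surface whose boundary is the
   single cycle [c] (at each vertex of [c] the faces in [D] form one arc of the
   face-cycle); it is a disk iff it is connected with Euler characteristic 1. *)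
Definition bounds_disk c : Prop :=
  exists D : {set {set K}},
    [/\ D \subset faces K, boundary_edges D = cycle_edges c,
        faces_connected D set0
      & (#|cover D|%:Z - #|edges_of D|%:Z + #|D|%:Z)%R = 1%R].

Definition separates c : Prop := ~ faces_connected (faces K) (cycle_edges c).

Definition genus_separating c : Prop := ~ bounds_disk c /\ separates c.

Definition nontrivial_cycle c : Prop :=
  [/\ is_cycle c, ~ bounds_disk c & ~ genus_separating c].

(* The path [u - v - w] splits the face-cycle [s1 ++ s2] of [v] into [s1] and
   [s2]; both are nonempty because of the default value [set0]. *)
Definition chord u v w s1 s2 : Prop :=
  [/\ face_cycle v (s1 ++ s2),
      [set u; v] \subset head set0 s1 :&: last set0 s2
    & [set v; w] \subset last set0 s1 :&: head set0 s2].

Definition divides_face_cycles c : Prop :=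
  forall v, v \in c -> exists s1 s2, chord (prev c v) v (next c v) s1 s2.

(* [side f v] tells on which side of [c] the corner at [v] of the face [f] lies
   ([false] for A, [true] for B). It is constant on the two parts into which [c]
   splits the face-cycle of [v], and on each face along each edge of [c]. Such
   a labelling exists iff cutting along [c] yields two boundary cycles, each a
   copy of [c]. The values for [v \notin c] are irrelevant. *)
Definition side_labelling c (side : {set K} -> K -> bool) : Prop :=
  (forall v, v \in c -> exists s1 s2,
     [/\ chord (prev c v) v (next c v) s1 s2,
         all (fun f => ~~ side f v) s1 & all (fun f => side f v) s2]) /\
  (forall f v, f \in faces K -> v \in c -> v \in f -> next c v \in f ->
     side f v = side f (next c v)).

(* [inl v] for [v \in c] is the vertex of the boundary cycle A coming from [v],
   and [inr v] that of the boundary cycle B. *)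
Definition cut_vertex c : finType := (K + seq_sub c)%type.

Definition corner c (side : {set K} -> K -> bool) f v : cut_vertex c :=
  if side f v then
    if insub v is Some w then inr w else inl v
  else inl v.

Definition cut_map c (side : {set K} -> K -> bool) : cell_complex :=
  @CellComplex (cut_vertex c)
    [set corner c side f @: e
       | f : {set K} in faces K, e : {set K} in edges K & e \subset f]
    [set corner c side f @: f | f : {set K} in faces K].

(* The quotient of the disjoint union of [m] copies of the cut map identifying
   the vertex of B coming from [v] in copy [i] with the vertex of A coming from
   [v] in copy [i + 1] (mod [m]). *)
Definition glue m c (i : 'I_m) (x : cut_vertex c) : 'I_m * K :=
  match x with
  | inl v => (i, v)
  | inr w => (ordS i, ssval w)
  end.

Definition covering m c (side : {set K} -> K -> bool) : cell_complex :=
  @CellComplex ('I_m * K)%type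
    [set glue i @: e
       | i : 'I_m, e : {set cut_vertex c} in edges (cut_map c side)]
    [set glue i @: f
       | i : 'I_m, f : {set cut_vertex c} in faces (cut_map c side)].

End Maps.

Definition covering_map (m : nat) (K L : cell_complex) : Prop :=
  exists (c : seq K) (side : {set K} -> K -> bool),
    [/\ nontrivial_cycle c, divides_face_cycles c, side_labelling c side
      & L = covering m c side].

Definition types : seq (seq (nat * nat)) :=
  [:: [:: (3, 7)];
      [:: (3, 5); (4, 1)];
      [:: (3, 4); (4, 2)];
      [:: (3, 3); (4, 1); (3, 1); (4, 1)];
      [:: (3, 5); (5, 1)];
      [:: (3, 4); (7, 1)];
      [:: (3, 4); (8, 1)];
      [:: (3, 4); (9, 1)];
      [:: (3, 4); (10, 1)];
      [:: (3, 2); (5, 1); (3, 1); (5, 1)];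
      [:: (3, 3); (4, 1); (6, 1)];
      [:: (3, 2); (4, 1); (3, 1); (6, 1)];
      [:: (3, 1); (4, 1); (3, 1); (4, 2)];
      [:: (3, 1); (4, 4)];
      [:: (3, 1); (7, 1); (3, 1); (7, 1)];
      [:: (3, 1); (4, 1); (7, 1); (4, 1)];
      [:: (3, 1); (4, 1); (8, 1); (4, 1)];
      [:: (4, 3); (5, 1)];
      [:: (3, 1); (4, 1); (9, 1); (4, 1)];
      [:: (3, 1); (4, 1); (10, 1); (4, 1)];
      [:: (3, 1); (5, 3)];
      [:: (3, 1); (6, 1); (4, 1); (6, 1)];
      [:: (4, 1); (6, 1); (18, 1)];
      [:: (4, 3); (6, 1)];
      [:: (5, 1); (4, 1); (5, 1); (4, 1)];
      [:: (4, 1); (6, 1); (14, 1)];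
      [:: (4, 1); (6, 1); (16, 1)];
      [:: (4, 1); (6, 1); (20, 1)];
      [:: (4, 1); (8, 1); (10, 1)];
      [:: (4, 1); (8, 1); (12, 1)];
      [:: (6, 2); (7, 1)];
      [:: (8, 1); (6, 2)];
      [:: (9, 1); (6, 2)];
      [:: (10, 1); (6, 2)];
      [:: (5, 1); (8, 2)];
      [:: (6, 1); (8, 2)];
      [:: (4, 1); (10, 2)];
      [:: (3, 1); (14, 2)];
      [:: (7, 3)]].

(* Main.v *)
(* For each type an explicit polyhedral map K of Euler characteristic -2 and a
   two-sided nonseparating cycle c are given. The m-fold covering along c has
   the deck group Z_m, and its flags are the pairs (sheet, flag of K); a word
   in the three flag involutions lifts to a closed path exactly if it is closed
   in K and crosses c algebraically 0 times modulo m. Automorphisms commute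
   with the flag involutions, and each certificate contains words that are
   closed with crossing number 0 at a base flag but, at every other flag of K,
   are open or have crossing number 1 or -1, hence are open in the covering for
   all m >= 2 at once. So an automorphism maps the lifts of the base flag to
   each other, and by rigidity it is a deck transformation. For six types all
   maps K that we found have an involution reversing the class of c; then two
   flags are left over, the involution lifts to a reflection of the covering,
   and the group is dihedral. *)
Require Import Defs.
From Stdlib Require Import NArith.
From mathcomp Require Import all_boot all_order all_algebra all_fingroup.
From mathcomp Require Import all_solvable zify.

Set Implicit Arguments.
Unset Strict Implicit.
Unset Printing Implicit Defensive.

Import GRing.Theory.

(** * Polyhedral maps *)

(** An automorphism of the covering need not descend to [K]: nothing says in advance that it
    normalises the deck group. It is therefore tested on flags of the covering itself. To make one
    finite check on [K] serve all numbers [M] of sheets, sheet changes are counted by two natural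
    numbers, forward and backward, that do not mention [M]; 1 and -1 are the only integers divisible
    by no [M >= 2]. The gluing is reduced to a 0/1 shift per corner: a corner on side B of [c] lies
    one sheet further than its face. Along an edge the shifts of the two adjacent faces differ by
    the same amount at both ends, and this local consistency makes faces, edges and face-cycles
    lift. The global statements come from one spanning tree of the dual graph that avoids [c] and
    never changes the sheet. It gives connectedness of [K], non-separation by [c] (hence also that
    [c] bounds no disk) and, together with one crossing of [c], connectedness of the covering. The
    same propagation from face to face spreads the fixed points of an automorphism and gives
    rigidity. *)

Lemma next_next_neq (T : eqType) (c : seq T) x : 3 <= size c -> uniq c -> x \in
  c ->
  next c (next c x) != x.
Proof.
move=> c3 cU xc; have [i p pE] := rot_to xc.
rewrite -!(next_rot i cU) pE.
have := cU; rewrite -(rot_uniq i) pE.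
have := c3; rewrite -(size_rot i) pE.
case: p {pE} => [|y [|z p]] //= _ /andP[+ _].
rewrite !inE !negb_or eqxx => /and3P[/negPf xy /negPf xz _].
rewrite ![y == x]eq_sym xy eqxx.
by rewrite eq_sym xz.
Qed.

(** Reachability of every face from [f0] in the dual graph, stated as an induction principle, so
    that each use plugs in its own predicate instead of handling paths. [R f g e] is what is known
    about a crossing; a stronger [R] makes a stronger principle. *)
Definition face_induction (K : cell_complex)
    (R : {set K} -> {set K} -> {set K} -> Prop) (f0 : {set K}) : Prop :=
  forall Q : {set K} -> Prop, Q f0 ->
    (forall f g e, f \in faces K -> g \in faces K -> e \in edges K ->
       e \subset f -> e \subset g -> R f g e -> Q f -> Q g) ->
  forall f, f \in faces K -> Q f.

(** The predicate [Q f -> Q f0] runs the induction backwards, so [g0] reaches [f0] and through it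
    every face; crossings are reversible because they carry no condition here. *)
Lemma face_induction_base (K : cell_complex) f0 g0 :
  f0 \in faces K -> g0 \in faces K ->
  @face_induction K (fun _ _ _ => True) f0 ->
  @face_induction K (fun _ _ _ => True) g0.
Proof.
move=> f0K g0K ind Q Qg0 Qstep; apply: (ind) => //.
suff: Q g0 -> Q f0 by apply.
apply: (ind (fun f => Q f -> Q f0)) g0K => // f g e fK gK eK ef eg _ IH Qg.
exact: IH (Qstep g f e gK fK eK eg ef I Qg).
Qed.

Section MapTheory.

Variable K : cell_complex.
Hypothesis mapK : is_map K.
Implicit Types (u v w : K) (e f g : {set K}).

Lemma edge_card e : e \in edges K -> #|e| = 2.
Proof. by case: mapK => _ [+ _] _ _ _ => /[apply]. Qed.

Lemma edge_faces e : e \in edges K -> #|[set f in faces K | e \subset f]| = 2.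
Proof. by case: mapK => _ [_ +] _ _ _ => /[apply]. Qed.

Lemma face_polygon f : f \in faces K -> is_polygon f.
Proof. by case: mapK => _ _ + _ _; apply. Qed.

Lemma adj_sym u v : adj u v = adj v u.
Proof. by rewrite /adj /= setUC. Qed.

Lemma edge_endpoints e : e \in edges K ->
  exists u v, [/\ u != v, e = [set u; v] & adj u v].
Proof.
move=> eK; have /eqP/cards2P[u [v [uv eE]]] := edge_card eK.
by exists u, v; split; rewrite // /adj /= -eE.
Qed.

Lemma other_faceE e f g g' : e \in edges K -> f \in faces K ->
  g \in faces K -> g' \in faces K -> e \subset f -> e \subset g ->
  e \subset g' -> g != f -> g' != f -> g = g'.
Proof.
move=> eK fK gK g'K ef eg eg' gf g'f; apply/eqP/negPn/negP => gg'.
have := edge_faces eK.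
suff : 3 <= #|[set f in faces K | e \subset f]| by move=> + E; rewrite E.
have <- : #|[set f; g; g']| = 3.
  by rewrite cardsU cards2 cards1 eq_sym gf (_ : _ :&: _ = set0) ?cards0 //;
    apply/setP => x; rewrite !inE andbC; case: eqP => // ->;
    rewrite (negPf g'f) eq_sym (negPf gg').
by apply: subset_leq_card; apply/subsetP => x;
  rewrite !inE => /orP[/orP[]|] /eqP->; apply/andP.
Qed.

(** Among the two neighbours of [u] on the polygon, excluding [v1] leaves a single one. *)
Lemma polygon_neighbours f u v1 v2 v3 : f \in faces K ->
  u \in f -> v1 \in f -> v2 \in f -> v3 \in f ->
  adj u v1 -> adj u v2 -> adj u v3 -> v2 != v1 -> v3 != v1 -> v2 = v3.
Proof.
move=> /face_polygon [c [_ _ _ adjE]] uf f1 f2 f3; rewrite !adjE //.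
by do 3![case/orP=> /eqP->]; rewrite ?eqxx.
Qed.

(** Two consecutive vertices fix a direction around the polygon, and the step extends [P] from each
    consecutive pair to the next vertex. It serves to spread the fixed points of an automorphism,
    for which one fixed vertex would not suffice. *)
Lemma polygon_walk f (P : K -> Prop) u v : f \in faces K ->
    u \in f -> v \in f -> adj u v -> P u -> P v ->
    (forall x y z, x \in f -> y \in f -> z \in f -> adj y x -> adj y z ->
       z != x -> P x -> P y -> P z) ->
  forall x, x \in f -> P x.
Proof.
move=> fK uf vf uv Pu Pv Pstep.
have [c [c3 cU fE adjE]] := face_polygon fK.
have inf x : (x \in f) = (x \in c) by rewrite fE inE.
have nextf x : x \in f -> next c x \in f by rewrite !inf mem_next.
have adjn x : x \in f -> adj x (next c x).
  by move=> xf; rewrite adjE ?nextf // eqxx.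
have nnext x : x \in f -> next c (next c x) != x.
  by rewrite inf; exact: next_next_neq.
(* The pair is oriented along [next]: if [v] precedes [u], the walk starts at [v]. *)
have {Pu Pv uv vf uf u v} [u [uf Pu Pnu]] : exists u,
    [/\ u \in f, P u & P (next c u)].
  have /orP[/eqP vE|/eqP vE] : (v == next c u) || (v == prev c u).
  - by rewrite -adjE.
  - by exists u; split; rewrite -?vE.
  by exists v; split=> //; rewrite vE next_prev.
have Pk k : iter k (next c) u \in f /\
    P (iter k (next c) u) /\ P (next c (iter k (next c) u)).
  elim: k => [|k [kf [Pk Pnk]]]; first by split.
  rewrite iterS nextf //; do 2!split=> //.
  apply: (Pstep (iter k (next c) u) (next c (iter k (next c) u))) => //.
  - exact: nextf.
  - exact: (nextf _ (nextf _ kf)).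
  - by rewrite adj_sym adjn.
  - by rewrite adjn // nextf.
  - exact: nnext.
move=> x xf; have xc : fconnect (next c) u x.
  have cycc := cycle_next cU.
  by rewrite (fconnect_cycle cycc) -?inf.
by have [+ [+ _]] := Pk (findex (next c) u x); rewrite iter_findex.
Qed.

Lemma face_neq0 f : f \in faces K -> f != set0.
Proof.
move=> /face_polygon [[|x c] [//= _ _ -> _]].
by apply/set0Pn; exists x; rewrite !inE eqxx.
Qed.

Lemma vertex_face v : exists2 f, f \in faces K & v \in f.
Proof.
case: mapK => _ _ _ /(_ v) [s [s3 _ sE _]] _.
case: s s3 sE => [//|f s] _ sE; exists f.
- by have := sE f; rewrite inE eqxx => /esym/andP[].
- by have := sE f; rewrite inE eqxx => /esym/andP[].
Qed.

Lemma edge_face e : e \in edges K -> exists2 f, f \in faces K & e \subset f.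
Proof.
move=> /edge_faces e2; have : 0 < #|[set f in faces K | e \subset f]|.
  by rewrite e2.
by case/card_gt0P => f; rewrite inE => /andP[]; exists f.
Qed.

End MapTheory.

(** * Connectedness of the graph from the dual graph *)

Section Connectivity.

Variable K : cell_complex.
Hypothesis polyK : forall f, f \in faces K -> is_polygon f.
Hypothesis edge2 : forall e, e \in edges K -> #|e| = 2.
Hypothesis coverK : forall v : K, exists2 f, f \in faces K & v \in f.

Lemma polygon_connect f (u v : K) : f \in faces K -> u \in f -> v \in f ->
  connect (@adj K) u v.
Proof.
move=> /polyK [c [c3 cU fE adjE]] uf vf.
have uc : u \in c by move: uf; rewrite fE inE.
have vc : v \in c by move: vf; rewrite fE inE.
have : fconnect (next c) u v by rewrite (fconnect_cycle (cycle_next cU)).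
move=> /iter_findex <-; elim: (findex _ _ _) => [|k IHk] //=.
apply: connect_trans IHk (connect1 _).
have kf : iter k (next c) u \in f.
  by elim: k => [|k] //=; rewrite fE !inE mem_next.
by rewrite adjE ?eqxx //; move: kf; rewrite fE !inE mem_next.
Qed.

(** Each face is connected along its boundary, and consecutive faces share the ends of an edge. The
    section assumes less than [is_map] because connectedness is a clause of [is_map] that is still
    to be proved, both for [K] and for the covering. *)
Lemma face_induction_connect R f0 : @face_induction K R f0 ->
  f0 \in faces K -> forall u v : K, connect (@adj K) u v.
Proof.
move=> ind f0K u v.
have sym : connect_sym (@adj K) by apply: sym_connect_sym => x y;
  rewrite /adj /= setUC.
have [x xf0] : exists x, x \in f0.
  have [[|x c] [//= _ _ -> _]] := polyK f0K.
  by exists x; rewrite !inE eqxx.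
suff conn f : f \in faces K -> forall y, y \in f -> connect (@adj K) x y.
  have [f fK uf] := coverK u; have [g gK vg] := coverK v.
  by apply: connect_trans (conn _ gK _ vg); rewrite sym (conn _ fK).
move: f; apply: ind => [y yf0|f g e fK gK eK ef eg _ IH y yg].
  exact: polygon_connect yf0.
have [z ze] : exists z, z \in e by apply/card_gt0P; rewrite edge2.
apply: connect_trans (IH z (subsetP ef _ ze)) _.
exact: polygon_connect (subsetP eg _ ze) yg.
Qed.

End Connectivity.

(** * Non-separating cycles *)

Section FacesConnected.

Variables (K : cell_complex) (c : seq K).

Lemma face_induction_faces_connected R f0 :
    (forall f g e, R f g e -> e \notin cycle_edges c) -> f0 \in faces K ->
  @face_induction K R f0 -> faces_connected (faces K) (cycle_edges c).
Proof.
move=> Rc f0K ind f g fK gK; set r := (X in connect X).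
have rsym : connect_sym r.
  apply: sym_connect_sym => x y; rewrite /r /= andbCA; congr [&& _, _ & _].
  by apply: eq_existsb => e; rewrite [X in _ && X]andbC.
have conn h : h \in faces K -> connect r f0 h.
  move: h; apply: ind => // h h' e hK h'K eK eh eh' /Rc ec /connect_trans;
    apply.
  apply: connect1; rewrite /r /= hK h'K; apply/existsP; exists e.
  by rewrite inE ec eK eh eh'.
by apply: connect_trans (conn _ gK); rewrite rsym conn.
Qed.

(** A set [D] of faces with boundary [c] can only be left across an edge of [c]. As the complement
    of [c] is connected, [D] would contain all faces; every edge would then be in two faces of [D],
    so none would be a boundary edge, although [c] has edges. The genus-separating case is refuted
    by connectedness itself. *)
Lemma nonseparating_nontrivial : is_map K -> is_cycle c ->
  faces_connected (faces K) (cycle_edges c) -> nontrivial_cycle c.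
Proof.
move=> mapK cc conn; split=> //; last by case=> _; apply.
case=> D [DK bD _ _].
have c_edges : exists2 e, e \in cycle_edges c & e \in boundary_edges D.
  case/and3P: cc; case: c bD => [|x p] // bD _ _ _.
  by exists [set x; next (x :: p) x]; rewrite ?bD;
    apply/imsetP; exists x; rewrite ?inE ?eqxx.
have [e0 _ e0D] := c_edges.
have [f fD] : exists f, f \in D.
  move: e0D; rewrite inE => /andP[_ /cards1P[f /setP/(_ f)]].
  by rewrite !inE eqxx => /andP[fD _]; exists f.
have fK := subsetP DK _ fD.
have allD g : g \in faces K -> g \in D.
  move=> gK; have := conn f g fK gK; case/connectP => p + ->.
  elim: p f fD {fK} => [|h p IHp] x xD //= /andP[/and3P[xK hK /existsP[e]]].
  case/andP; rewrite inE => /andP[ec eK] /andP[ex eh]; apply: IHp.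
  apply/negPn/negP => hD; case/negP: ec; rewrite -bD inE eK /=.
  apply/cards1P; exists x; apply/setP => y; rewrite !inE.
  apply/andP/eqP => [[yD ey]|->]; last by [].
  apply: (other_faceE mapK eK hK (subsetP DK _ yD) xK) => //.
    by apply: contraNneq hD => <-.
  by apply: contraNneq hD => <-.
move: e0D; rewrite inE => /andP[e0K]; rewrite (_ : [set f in D | _] =
  [set f in faces K | e0 \subset f]) ?(edge_faces mapK e0K) //.
by apply/setP => g; rewrite !inE; congr (_ && _);
  apply/idP/idP => [/(subsetP DK)|/allD].
Qed.

End FacesConnected.

(** * Cyclic coverings *)

Section Covering.

Variables (K : cell_complex) (m : nat) (c : seq K).
Variable side : {set K} -> K -> bool.
(** Written as [m.+2], the number of sheets makes ['I_M] the ring of integers modulo [M], with 1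
    different from 0. *)
Local Notation M := m.+2.
Local Notation L := (covering M c side).
Implicit Types (i j k : 'I_M) (u v w : K) (e f g A B : {set K}).

(** The side B vertex over [v] in copy [i] is glued to the side A vertex in copy [i + 1], so a
    corner of a face in sheet [i] lies in sheet [i] or [i + 1]. *)
Definition sheet_shift f v : bool := (v \in c) && side f v.

Local Open Scope ring_scope.

(** [A] is lifted as a part of the face [f] placed in sheet [i]. The same set lifted through another
    face may need a different [i]. *)
Definition lift_set i f A : {set L} := [set (i + (sheet_shift f v)%:R, v) | v
  in A].

Lemma ordS_Zp i : ordS i = i + 1.
Proof. apply: val_inj => /=. by rewrite modnDmr addn1. Qed.

(** Collapses cutting, copying and gluing into the single formula behind [lift_set]. *)
Lemma glue_corner i f v :
  glue i (corner c side f v) = (i + (sheet_shift f v)%:R, v) :> 'I_M * K.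
Proof.
rewrite /corner /sheet_shift; case: (side f v) => /=;
  last by rewrite andbF addr0.
by case: insubP => [w -> wE|/negPf->] /=; rewrite ?ordS_Zp ?wE ?addr0.
Qed.

Lemma glue_lift i f A : [set glue i (corner c side f v) | v in A] = lift_set i
  f A.
Proof. by apply: eq_imset => v; rewrite glue_corner. Qed.

Lemma covering_facesP (F : {set L}) :
  reflect (exists i f, f \in faces K /\ F = lift_set i f f) (F \in faces L).
Proof.
apply: (iffP imset2P) => [[i _ _ /imsetP[f fK ->] ->]|[i [f [fK ->]]]].
  by exists i, f; rewrite -glue_lift imset_comp.
exists i [set corner c side f v | v in f]; rewrite ?imset_f //.
by rewrite -glue_lift imset_comp.
Qed.

Lemma covering_edgesP (E : {set L}) :
  reflect (exists i f e, [/\ f \in faces K, e \in edges K, e \subset f &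
            E = lift_set i f e]) (E \in edges L).
Proof.
apply: (iffP imset2P) => [[i _ _ /imset2P[f e fK + ->] ->]|[i [f [e [fK eK ef
  ->]]]]].
  rewrite inE => /andP[eK ef].
  by exists i, f, e; split=> //; rewrite -glue_lift imset_comp.
exists i [set corner c side f v | v in e] => //.
  by apply/imset2P; exists f e; rewrite // inE eK.
by rewrite -glue_lift imset_comp.
Qed.

Lemma mem_lift i f A j v :
  ((j, v) \in lift_set i f A) = (v \in A) && (j == i + (sheet_shift f v)%:R).
Proof.
apply/imsetP/andP => [[w wA [-> ->]]|[vA /eqP->]]; first by rewrite wA.
by exists v.
Qed.

Lemma snd_lift i f A : [set x.2 | x in lift_set i f A] = A.
Proof.
by rewrite /lift_set -imset_comp (eq_imset (g := id)) ?imset_id.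
Qed.

Lemma lift_injr i j f g A B : lift_set i f A = lift_set j g B -> A = B.
Proof. by move=> E; rewrite -(snd_lift i f A) E snd_lift. Qed.

Lemma lift_injl i j f A : A != set0 -> lift_set i f A = lift_set j f A -> i = j.
Proof.
case/set0Pn => v vA E.
have : (i + (sheet_shift f v)%:R, v) \in lift_set i f A by rewrite mem_lift vA
  eqxx.
by rewrite E mem_lift vA => /eqP/addIr.
Qed.

Lemma liftS i f A B : A \subset B -> lift_set i f A \subset lift_set i f B.
Proof. exact: imsetS. Qed.

Lemma sub_lift i j f g A B : lift_set i f A \subset lift_set j g B -> A \subset
  B.
Proof. by move/(imsetS snd); rewrite !snd_lift. Qed.

Lemma card_lift i f A : #|lift_set i f A| = #|A|.
Proof. by rewrite card_imset // => u v [_ ->]. Qed.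

Lemma lift2 i f u v :
  lift_set i f [set u; v] = [set (i + (sheet_shift f u)%:R, u);
    (i + (sheet_shift f v)%:R, v)].
Proof. by rewrite /lift_set imsetU1 imset_set1. Qed.

Hypothesis mapK : is_map K.
(** Cocycle condition: the sheet change across an edge does not depend on the end at which it is
    read. It is written with sums because truncated subtraction would lose the sign. *)
Hypothesis compat : forall e f g u v, e \in edges K -> f \in faces K ->
  g \in faces K -> e \subset f -> e \subset g -> u \in e -> v \in e ->
  (sheet_shift f u + sheet_shift g v = sheet_shift f v + sheet_shift g u)%N.

(* Passing from [f] to [g] across an edge at [u] changes the sheet by this
   amount. *)
Definition jump f g u : 'I_M := (sheet_shift f u)%:R - (sheet_shift g u)%:R.

Lemma jumpE e f g u v : e \in edges K -> f \in faces K ->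
  g \in faces K -> e \subset f -> e \subset g -> u \in e -> v \in e ->
  jump f g u = jump f g v.
Proof.
move=> eK fK gK ef eg ue ve.
have /(congr1 (fun n => n%:R : 'I_M)) := compat eK fK gK ef eg ue ve.
by rewrite !natrD /jump => E; apply/eqP;
  rewrite subr_eq addrAC eq_sym subr_eq E.
Qed.

Lemma lift_jump i e f g u : e \in edges K -> f \in faces K ->
  g \in faces K -> e \subset f -> e \subset g -> u \in e ->
  lift_set i f e = lift_set (i + jump f g u) g e.
Proof.
move=> eK fK gK ef eg ue; apply: eq_in_imset => v ve /=.
by rewrite (jumpE eK fK gK ef eg ue ve) /jump -addrA subrK.
Qed.

(** The covering property at an edge: over each face through [e] exactly one lift contains the given
    lifted edge, namely that in the sheet reached by the jump. *)
Lemma lift_sub_face i j e f g u : e \in edges K -> f \in faces K ->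
    g \in faces K -> e \subset f -> e \subset g -> u \in e ->
  (lift_set i f e \subset lift_set j g g) = (j == i + jump f g u).
Proof.
move=> eK fK gK ef eg ue; apply/idP/eqP => [/subsetP E|->]; last first.
  by rewrite (lift_jump i eK fK gK ef eg ue) liftS.
have /E : (i + (sheet_shift f u)%:R, u) \in lift_set i f e by rewrite mem_lift
  ue eqxx.
by rewrite mem_lift => /andP[_ /eqP E']; rewrite /jump addrA E' addrK.
Qed.

Lemma adj_lift i f u v : f \in faces K -> u \in f -> v \in f ->
  @adj L (i + (sheet_shift f u)%:R, u) (i + (sheet_shift f v)%:R, v) = adj u v.
Proof.
move=> fK uf vf; apply/covering_edgesP/idP => [[j [g [e [gK eK eg E]]]]|uv].
  by rewrite /adj /=; rewrite -lift2 in E; rewrite (lift_injr E).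
exists i, f, [set u; v]; split=> //; last by rewrite lift2.
by apply/subsetP => x; rewrite !inE => /orP[]/eqP->.
Qed.

(** * The covering is a polyhedral map *)

Lemma covering_edge_faces i e f : e \in edges K -> f \in faces K ->
  e \subset f -> #|[set F in faces L | lift_set i f e \subset F]| = 2.
Proof.
move=> eK fK ef; have [u ue] : exists u, u \in e.
  by apply/card_gt0P; rewrite (edge_card mapK eK).
rewrite (_ : [set F in _ | _] = [set lift_set (i + jump f g u) g g
    | g in [set g in faces K | e \subset g]]).
  by rewrite card_in_imset ?(edge_faces mapK eK) // => g h _ _;
    apply: lift_injr.
apply/setP => F; rewrite inE.
apply/andP/imsetP => [[]|[g]].
  case/covering_facesP => j [g [gK ->]] sub; have eg := sub_lift sub.
  exists g; first by rewrite inE gK.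
  by move: sub; rewrite (lift_sub_face _ _ eK fK gK ef eg ue) => /eqP->.
rewrite inE => /andP[gK eg] ->; split;
  last by rewrite (lift_sub_face _ _ eK fK gK ef eg ue).
by apply/covering_facesP; exists (i + jump f g u), g.
Qed.

Lemma covering_polygon i f : f \in faces K -> @is_polygon L (lift_set i f f).
Proof.
move=> fK; have [p [p3 pU fE adjE]] := face_polygon mapK fK.
pose l v : L := (i + (sheet_shift f v)%:R, v).
have l_inj : injective l by move=> u v [_].
have inf x : (x \in f) = (x \in p) by rewrite fE inE.
exists (map l p); split; rewrite ?size_map ?map_inj_uniq //.
  apply/setP => [[j v]]; rewrite mem_lift inE inf.
  apply/andP/mapP => [[vp /eqP->]|[w wp [-> ->]]]; first by exists v.
  by rewrite wp.
move=> _ _ /imsetP[u uf ->] /imsetP[v vf ->].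
rewrite adj_lift // adjE // -/(l u) -/(l v).
by rewrite (next_map l_inj pU) (prev_map l_inj pU) !(inj_eq l_inj).
Qed.

(** A face [f] has its corner at [(i, v)] exactly when it sits in sheet [i - sheet_shift f v].
    Consecutive faces stay consecutive since these sheets differ by the jump at [v]. *)
Lemma covering_face_cycle i v s : @face_cycle K v s ->
  @face_cycle L (i, v) [seq lift_set (i - (sheet_shift f v)%:R) f f | f : {set
    K} <- s].
Proof.
case=> s3 sU sE sC; split; rewrite ?size_map //.
- by rewrite map_inj_in_uniq // => f g _ _; apply: lift_injr.
- move=> F; apply/mapP/andP => [[f fs ->]|[/covering_facesP[j [f [fK ->]]]]].
    move: fs; rewrite sE mem_lift => /andP[fK ->].
    by rewrite subrK eqxx; split=> //; apply/covering_facesP;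
      exists (i - (sheet_shift f v)%:R), f.
  rewrite mem_lift => /andP[vf /eqP->]; exists f; first by rewrite sE fK.
  by rewrite addrK.
rewrite cycle_map; apply: (sub_in_cycle (P := mem s)) sC => [f g fs gs|];
  last exact/allP.
case/existsP => e /and4P[eK ve ef eg].
have [fK gK] : f \in faces K /\ g \in faces K.
  have fs' : f \in s := fs; have gs' : g \in s := gs.
  by move: fs' gs'; rewrite !sE => /andP[-> _] /andP[-> _].
apply/existsP; exists (lift_set (i - (sheet_shift f v)%:R) f e); apply/and4P;
  split.
- by apply/covering_edgesP; exists (i - (sheet_shift f v)%:R), f, e.
- by rewrite mem_lift ve subrK eqxx.
- exact: liftS.
by rewrite (lift_sub_face _ _ eK fK gK ef eg ve) /jump addrA subrK.
Qed.

(** Two lifts of one face are disjoint, as a vertex determines the sheet of a given face. For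
    distinct faces the projection is injective on the intersection of the lifts and maps it into
    [f :&: g]; if two points occur, they fill the lift of the edge [f :&: g]. *)
Lemma covering_cap i j f g : f \in faces K -> g \in faces K ->
    lift_set i f f != lift_set j g g ->
  let I := lift_set i f f :&: lift_set j g g in
  [\/ I = set0, #|I| = 1 | I \in edges L].
Proof.
move=> fK gK; have [->|fg] := eqVneq f g => [ij|_] I.
  apply: Or31; apply/setP => [[k v]]; rewrite !inE !mem_lift.
  apply/negP => /andP[/andP[_ /eqP->] /andP[_ /eqP/addIr ijE]].
  by rewrite ijE eqxx in ij.
have sndI : [set x.2 | x in I] \subset f :&: g.
  apply/subsetP => _ /imsetP[[k v] + ->] /=.
  by rewrite !inE !mem_lift => /andP[/andP[-> _] /andP[-> _]].
have cardI : #|[set x.2 | x in I]| = #|I|.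
  apply: card_in_imset => -[k u] [l v]; rewrite !inE !mem_lift /=.
  by move=> /andP[/andP[_ /eqP->] _] /andP[/andP[_ /eqP->] _] ->.
have [I0|] := boolP (I == set0); first by apply: Or31; apply/eqP.
case/set0Pn => -[k u] uI.
have [I1|I1] := eqVneq #|I| 1; first exact: Or32.
have I2 : (2 <= #|I|)%N.
  by rewrite ltn_neqAle eq_sym I1 card_gt0; apply/set0Pn; exists (k, u).
have uf : u \in f by move: uI; rewrite !inE !mem_lift => /andP[/andP[]].
have ug : u \in g by move: uI; rewrite !inE !mem_lift => /andP[_ /andP[]].
case: mapK => _ _ _ _ /(_ f g fK gK fg) [fg0|fg1|fgK].
- by have : u \in f :&: g by [rewrite inE uf ug]; rewrite fg0 inE.
- by have := leq_trans I2 (leq_trans (eq_leq (esym cardI)) (subset_leq_card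
  sndI));
     rewrite fg1.
apply: Or33; apply/covering_edgesP; exists i, f, (f :&: g); split=> //.
  exact: subsetIl.
apply/eqP; rewrite eqEcard card_lift (edge_card mapK fgK) I2 andbT.
apply/subsetP => -[l v] vI; rewrite mem_lift (subsetP sndI) ?imset_f //=;
  last first.
  by apply/imsetP; exists (l, v).
by move: vI; rewrite !inE !mem_lift => /andP[/andP[]].
Qed.

(** * Cell counts of the covering *)

Lemma covering_card_faces : #|faces L| = (M * #|faces K|)%N.
Proof.
rewrite (_ : faces L = [set lift_set p.1 p.2 p.2 | p in setX setT (faces K)]).
  rewrite card_in_imset ?cardsX ?cardsT ?card_ord // => -[i f] [j g].
  rewrite !inE /= => fK gK E; have fg := lift_injr E; move: E; rewrite -fg.
  by move/(lift_injl (face_neq0 mapK fK)) ->.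
apply/setP => F; apply/covering_facesP/imsetP => [[i [f [fK ->]]]|[[i f]]].
  by exists (i, f); rewrite ?inE.
by rewrite !inE /= => fK ->; exists i, f.
Qed.

(** A lifted edge has two descriptions, one through each of its faces. Fixing one face [fc e] for
    every edge makes the pairs of a sheet and an edge correspond to the lifted edges. *)
Lemma covering_card_edges : #|edges L| = (M * #|edges K|)%N.
Proof.
pose fc e := odflt set0 [pick f in faces K | e \subset f].
have fcP e : e \in edges K -> fc e \in faces K /\ e \subset fc e.
  move=> eK; rewrite /fc; case: pickP => [f /andP[]|no] //=.
  by have [f fK ef] := edge_face mapK eK; move: (no f); rewrite fK ef.
rewrite (_ : edges L = [set lift_set p.1 (fc p.2) p.2 | p in setX setT (edges
  K)]).
  rewrite card_in_imset ?cardsX ?cardsT ?card_ord // => -[i e] [j e'].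
  rewrite !inE /= => eK e'K E; have ee := lift_injr E; move: E; rewrite -ee.
  suff e0 : e != set0 by move/(lift_injl e0) ->.
  by rewrite -card_gt0 (edge_card mapK eK).
apply/setP => E; apply/covering_edgesP/imsetP => [[i [f [e [fK eK ef ->]]]]|[[i
  e]]].
  have [u ue] : exists u, u \in e by apply/card_gt0P;
    rewrite (edge_card mapK eK).
  have [gK eg] := fcP e eK.
  by exists (i + jump f (fc e) u, e); rewrite ?inE //= -lift_jump.
by rewrite !inE /= => eK ->; have [fK ef] := fcP e eK; exists i, (fc e), e.
Qed.

Lemma covering_euler : euler_char K = (- 2%:Z)%R ->
  euler_char L = (- (2 * M)%:Z)%R.
Proof.
rewrite /euler_char covering_card_faces covering_card_edges card_prod card_ord.
rewrite !PoszM -mulrBr -mulrDr => ->; by rewrite mulrN mulrC.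
Qed.

(** Connectedness stays a premise, being the only clause that is not local over [K]. *)
Lemma covering_is_map :
  (forall x y : L, connect (@adj L) x y) -> is_map L.
Proof.
move=> conn; split.
- split=> //; rewrite card_prod card_ord muln_gt0 /=.
  by case: mapK => [[]].
- split=> E /covering_edgesP[i [f [e [fK eK ef ->]]]].
    by rewrite card_lift (edge_card mapK).
  exact: covering_edge_faces.
- by move=> F /covering_facesP[i [f [fK ->]]]; apply: covering_polygon.
- move=> [i v]; case: mapK => _ _ _ /(_ v)[s /(covering_face_cycle i)].
  by exists [seq lift_set (i - (sheet_shift f v)%:R) f f | f : {set K} <- s].
move=> F G /covering_facesP[i [f [fK ->]]] /covering_facesP[j [g [gK ->]]].
exact: covering_cap.
Qed.

Lemma covering_semi_equivelar X :
  (forall x y : L, connect (@adj L) x y) ->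
  semi_equivelar K X -> semi_equivelar L X.
Proof.
move=> conn [_ XV star]; split=> //; first exact: covering_is_map.
move=> [i v]; have [s [sC sX]] := star v; have := covering_face_cycle i sC.
exists [seq lift_set (i - (sheet_shift f v)%:R) f f | f : {set K} <- s];
  split=> //.
by rewrite -sX -map_comp; apply: eq_map => f /=; rewrite card_lift.
Qed.

(* Every lift of a face is reached inside its sheet; the edge of the cut
   between [f1] (on side B) and [g1] (on side A) joins consecutive sheets. *)
Variables (f0 f1 g1 e1 : {set K}) (u1 : K).
Hypothesis f0K : f0 \in faces K.
Hypothesis dualK : @face_induction K
  (fun f g e => e \notin cycle_edges c /\ {in e, sheet_shift f =1 sheet_shift
    g}) f0.
Hypothesis cross : [/\ f1 \in faces K, g1 \in faces K, e1 \in edges K,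
  e1 \subset f1 & e1 \subset g1] /\ [/\ u1 \in e1, sheet_shift f1 u1 & ~~
    sheet_shift g1 u1].

Lemma covering_face_induction :
  @face_induction L (fun _ _ _ => True) (lift_set 0 f0 f0).
Proof.
move=> Q Q0 Qstep; have [[f1K g1K e1K ef1 eg1] [ue sf sg]] := cross.
have Qedge i j f g e u : f \in faces K -> g \in faces K -> e \in edges K ->
    e \subset f -> e \subset g -> u \in e -> j = i + jump f g u ->
    Q (lift_set i f f) -> Q (lift_set j g g).
  move=> fK gK eK ef eg ue' jE; apply: (Qstep _ _ (lift_set i f e)) => //.
  - by apply/covering_facesP; exists i, f.
  - by apply/covering_facesP; exists j, g.
  - by apply/covering_edgesP; exists i, f, e.
  - exact: liftS.
  - by rewrite (lift_sub_face _ _ eK fK gK ef eg ue') jE.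
have rsheet i h : h \in faces K -> Q (lift_set i f0 f0) -> Q (lift_set i h h).
  move=> hK Qi; move: h hK; apply: dualK => // f g e fK gK eK ef eg [_ sfg].
  have [u ue'] : exists u, u \in e.
    by apply/card_gt0P; rewrite (edge_card mapK eK).
  by apply: (Qedge _ _ _ _ _ _ fK gK eK ef eg ue');
    rewrite /jump sfg // subrr addr0.
(* The induction only leads away from [f0]; applied to an implication it also leads back within the
   sheet. *)
have back i g : g \in faces K -> Q (lift_set i g g) -> Q (lift_set i f0 f0).
  move=> gK; pose P f := Q (lift_set i f f) -> Q (lift_set i f0 f0).
  rewrite -/(P g); move: g gK; apply: dualK => // f g e fK gK eK ef eg [_ sfg].
  have [u ue'] : exists u, u \in e.
    by apply/card_gt0P; rewrite (edge_card mapK eK).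
  move=> Pf Qg; apply: Pf; apply: (Qedge _ _ _ _ _ _ gK fK eK eg ef ue') Qg.
  by rewrite /jump sfg // subrr addr0.
have Qs (n : nat) : Q (lift_set n%:R f0 f0).
  elim: n => [|n IHn]; first by rewrite mulr0n.
  rewrite -natr1; apply: (back _ g1) => //.
  apply: (Qedge _ _ _ _ _ _ f1K g1K e1K ef1 eg1 ue) (rsheet _ _ f1K IHn).
  by rewrite /jump sf (negPf sg) subr0.
move=> F /covering_facesP[i [f [fK ->]]]; apply: rsheet => //.
by rewrite -[i]natr_Zp.
Qed.

Lemma covering_connected (x y : L) : connect (@adj L) x y.
Proof.
apply: (@face_induction_connect L _ _ _ _ _ covering_face_induction).
- by move=> F /covering_facesP[i [f [fK ->]]]; apply: covering_polygon.
- by move=> E /covering_edgesP[i [f [e [fK eK ef ->]]]];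
  rewrite card_lift (edge_card mapK).
- move=> [i v]; have [f fK vf] := vertex_face mapK v.
  exists (lift_set (i - (sheet_shift f v)%:R) f f);
    last by rewrite mem_lift vf subrK eqxx.
  by apply/covering_facesP; exists (i - (sheet_shift f v)%:R), f.
by apply/covering_facesP; exists 0, f0.
Qed.

End Covering.

(** * Automorphisms of a covering *)

Section Flags.

Variable K : cell_complex.
Implicit Types (a : {perm K}) (f : {set K}).

(** The edge is stored by its other end: [((u, v), f)] stands for the vertex [u], the edge [uv] and
    the face [f]. *)
Definition flag : Type := (K * K * {set K})%type.

Definition is_flag (p : flag) : bool :=
  [&& adj p.1.1 p.1.2, p.2 \in faces K, p.1.1 \in p.2 & p.1.2 \in p.2].

(* [flag_rel k p q]: the flag [q] differs from [p] exactly in its vertex, edge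
  or
   face, for [k = 0], [1] or at least [2]. *)
Definition flag_rel (k : nat) (p q : flag) : Prop :=
  [/\ is_flag p, is_flag q &
  match k with
  | 0 => q = (p.1.2, p.1.1, p.2)
  | 1 => [/\ q.1.1 = p.1.1, q.2 = p.2 & q.1.2 != p.1.2]
  | _ => q.1 = p.1 /\ q.2 != p.2
  end].

(** Words act by a relation, so that one notion serves [K] and the covering and is transported by
    automorphisms, without choosing the involutions as functions. *)
Fixpoint flag_path (w : seq nat) (p q : flag) : Prop :=
  if w is k :: w' then exists2 r, flag_rel k p r & flag_path w' r q else p = q.

Definition act a (p : flag) : flag := (a p.1.1, a p.1.2, a @: p.2).

Lemma autP a : reflect ((forall e : {set K}, (a @: e \in edges K) = (e \in
  edges K)) /\
    (forall f : {set K}, (a @: f \in faces K) = (f \in faces K))) (a \in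
      Aut_map K).
Proof.
have iff (S : {set {set K}}) : ([set a @: e | e : {set K} in S] == S) =
    [forall e : {set K}, (a @: e \in S) == (e \in S)].
  have inja : injective (fun e : {set K} => a @: e).
    by apply: imset_inj; apply: perm_inj.
  apply/eqP/forallP => [E e|E]; first by rewrite -{1}E mem_imset.
  apply/eqP; rewrite eqEcard card_imset // leqnn andbT.
  by apply/subsetP => _ /imsetP[e eS ->]; rewrite (eqP (E e)).
rewrite inE /is_aut !iff; apply: (iffP andP) => -[].
  by move=> /forallP E /forallP F; split=> e; [apply/eqP/E|apply/eqP/F].
by move=> E F; split; apply/forallP => e; rewrite ?E ?F.
Qed.

(** An injective map of a finite set of cells into itself is onto, so preservation in one direction
    suffices. *)
Lemma perm_autP (a : {perm K}) :
  (forall e : {set K}, e \in edges K -> a @: e \in edges K) ->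
  (forall f : {set K}, f \in faces K -> a @: f \in faces K) -> a \in Aut_map K.
Proof.
have inja : injective (fun e : {set K} => a @: e).
  by apply: imset_inj; apply: perm_inj.
have main (S : {set {set K}}) : (forall e : {set K}, e \in S -> a @: e \in S) ->
    [set a @: e | e : {set K} in S] = S.
  move=> aS; apply/eqP; rewrite eqEcard card_imset // leqnn andbT.
  by apply/subsetP => _ /imsetP[e /aS eS ->].
by move=> aE aF; rewrite inE /is_aut !main ?eqxx.
Qed.

Lemma aut_adj a u v : a \in Aut_map K -> adj (a u) (a v) = adj u v.
Proof. by move=> /autP[E _]; rewrite /adj /= -(E [set u;
  v]) imsetU1 imset_set1. Qed.

Lemma aut_face a f : a \in Aut_map K -> (a @: f \in faces K) = (f \in faces K).
Proof. by move=> /autP[_ E]; rewrite E. Qed.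

Lemma aut_is_flag a p : a \in Aut_map K -> is_flag (act a p) = is_flag p.
Proof.
move=> aK; rewrite /is_flag /act /= aut_adj // aut_face //.
by rewrite !(mem_imset _ _ (@perm_inj _ a)).
Qed.

Lemma act_flag_rel a k p q : a \in Aut_map K -> flag_rel k p q -> flag_rel k
  (act a p) (act a q).
Proof.
move=> aK [pK qK kpq]; split; rewrite ?aut_is_flag //.
case: k kpq => [-> //|[|k]] /=.
  by case=> -> -> qp; split=> //; rewrite (inj_eq perm_inj).
case=> E qp; rewrite /act /= E; split=> //.
by rewrite (inj_eq (imset_inj (@perm_inj _ a))).
Qed.

Lemma act_flag_path a w p q : a \in Aut_map K -> flag_path w p q -> flag_path w
  (act a p) (act a q).
Proof.
move=> aK; elim: w p => [|k w IHw] p /=; first by move->.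
by case=> r /(act_flag_rel aK) pr /IHw rq; exists (act a r).
Qed.

Lemma actM a b p : act (a * b)%g p = act b (act a p).
Proof.
rewrite /act /= !permM; congr (_, _).
by rewrite -imset_comp; apply: eq_imset => x /=; rewrite permM.
Qed.

Hypothesis mapK : is_map K.

Lemma flag_edge p : is_flag p ->
  [set p.1.1; p.1.2] \in edges K /\ [set p.1.1; p.1.2] \subset p.2.
Proof.
case/and4P => ? _ up vp; split=> //.
by apply/subsetP => x; rewrite !inE => /orP[]/eqP->.
Qed.

(** The other neighbour on a polygon and the other face at an edge are unique. Hence a word has at
    most one end at a given start, which turns closed words into constraints on automorphisms. *)
Lemma flag_rel_inj k p q q' : flag_rel k p q -> flag_rel k p q' -> q = q'.
Proof.
case: p q q' => [[u v] f] [[u1 v1] f1] [[u2 v2] f2] [pK qK kpq] [_ q'K].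
case: k kpq => [-> -> //|[|k]] /=.
  move=> [E1 E2 n1] [E3 E4 n2]; subst u1 f1 u2 f2.
  case/and4P: pK qK q'K => /= uv fK uf vf /and4P[/= uv1 _ _ vf1] /and4P[/= uv2
    _ _ vf2].
  by rewrite (polygon_neighbours mapK fK uf vf vf1 vf2 uv uv1 uv2).
move=> [[E1 E2] n1] [[E3 E4] n2]; subst u1 v1 u2 v2.
have [eK ef] := flag_edge pK; have [_ ef1] := flag_edge qK.
have [_ ef2] := flag_edge q'K.
case/and4P: pK qK q'K => /= uv fK uf vf /and4P[/= uv1 f1K _ _] /and4P[/= uv2
  f2K _ _].
by rewrite (other_faceE mapK eK fK f1K f2K ef ef1 ef2).
Qed.

Lemma flag_path_inj w p q q' : flag_path w p q -> flag_path w p q' -> q = q'.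
Proof.
elim: w p => [|k w IHw] p /=; first by move->.
by case=> r pr rq [r' pr' r'q']; rewrite -(flag_rel_inj pr pr') in r'q';
  apply: IHw r'q'.
Qed.

(* The faces fixed pointwise propagate across edges. *)
Lemma aut_rigid R f0 a p : a \in Aut_map K -> is_flag p -> act a p = p ->
  p.2 = f0 -> @face_induction K R f0 -> a = 1%g.
Proof.
move=> aK pK aE pf ind.
(* A fixed flag gives two consecutive fixed vertices on an invariant polygon, from which fixed
   points spread around it. *)
have fix_face (q : flag) : is_flag q -> act a q = q -> {in q.2, a =1 id}.
  case: q => [[u v] f] qK [au av af] x xf /=.
  case/and4P: (qK) => /= uv fK uf vf.
  apply: (polygon_walk (P := fun x => a x = x) mapK fK uf vf uv au av) xf => y
    z t yf zf tf zy zt ty ay az.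
  have atf : a t \in f by rewrite -af imset_f.
  apply: (polygon_neighbours mapK fK zf yf atf tf zy _ zt _ ty).
    by rewrite -az aut_adj.
  by rewrite -{1}ay (inj_eq perm_inj).
suff fixf f : f \in faces K -> {in f, a =1 id}.
  apply/permP => x; have [f fK xf] := vertex_face mapK x.
  by rewrite perm1 (fixf f fK).
move: f; apply: ind => [|f g e fK gK eK ef eg _ af]; first by rewrite -pf;
  apply: fix_face.
have [u [v [uv eE adjuv]]] := edge_endpoints mapK eK.
have ue : u \in e by rewrite eE !inE eqxx.
have ve : v \in e by rewrite eE !inE eqxx orbT.
have au := af u (subsetP ef _ ue); have av := af v (subsetP ef _ ve).
have gF : is_flag ((u, v), g) by rewrite /is_flag /= adjuv gK !(subsetP eg).
have fF : is_flag ((u, v), f) by rewrite /is_flag /= adjuv fK !(subsetP ef).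
have agE (h : {set K}) : {in h, a =1 id} -> a @: h = h.
  by move=> ah; rewrite -[RHS]imset_id; apply: eq_in_imset.
have [->//|gf] := eqVneq g f.
apply: (fix_face ((u, v), g)) => //.
(* The image of the flag on [g] is again the flag across the edge from the fixed flag on [f], so
   uniqueness makes it fixed. *)
have m1 : flag_rel 2 ((u, v), f) ((u, v), g) by split.
have := act_flag_rel aK m1; rewrite /act /= au av (agE f) // => m2.
by rewrite (flag_rel_inj m1 m2).
Qed.

Lemma aut_eq R f0 a b p : a \in Aut_map K -> b \in Aut_map K -> is_flag p ->
  act a p = act b p -> p.2 = f0 -> @face_induction K R f0 -> a = b.
Proof.
move=> aK bK pK ab pf ind; apply/eqP; rewrite eq_mulgV1; apply/eqP.
apply: (aut_rigid (R := R) (f0 := f0) _ pK _ pf ind);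
  first by rewrite groupM ?groupV.
rewrite actM ab -actM mulgV /act !perm1; case: p {pK ab pf} => [[u v] f] /=.
by congr (_, _); rewrite -[RHS]imset_id; apply: eq_imset => x; rewrite perm1.
Qed.

End Flags.

(** * Lifted flags and crossing numbers of words *)

Section CoveringAut.

Variables (K : cell_complex) (m : nat) (c : seq K).
Variable side : {set K} -> K -> bool.
Local Notation M := m.+2.
Local Notation L := (covering M c side).
Local Notation shift := (@sheet_shift K c side).
Local Notation lift_set := (@lift_set K m c side).
Implicit Types (i j : 'I_M) (u v : K) (e f g A : {set K}).
Local Open Scope ring_scope.

Hypothesis mapK : is_map K.
Hypothesis compat : forall e f g u v, e \in edges K -> f \in faces K ->
  g \in faces K -> e \subset f -> e \subset g -> u \in e -> v \in e ->
  (shift f u + shift g v = shift f v + shift g u)%N.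
Hypothesis mapL : is_map L.

Definition lift_flag i (p : flag K) : flag L :=
  ((i + (shift p.2 p.1.1)%:R, p.1.1), (i + (shift p.2 p.1.2)%:R, p.1.2),
   lift_set i p.2 p.2).

Lemma lift_is_flag i p : is_flag p -> is_flag (lift_flag i p).
Proof.
case: p => [[u v] f] /and4P[/= uv fK uf vf].
apply/and4P; split; rewrite /= ?mem_lift ?uf ?vf ?eqxx //.
  by rewrite adj_lift.
by apply/covering_facesP; exists i, f.
Qed.

Lemma flag_of_lift (q : flag L) : is_flag q ->
  exists i p, is_flag p /\ q = lift_flag i p.
Proof.
case: q => [[[j u] [k v]] F] /and4P[/= uv /covering_facesP[i [f [fK FE]]]].
rewrite FE !mem_lift => /andP[uf /eqP jE] /andP[vf /eqP kE].
exists i, (u, v, f); split; last by rewrite /lift_flag /= -jE -kE.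
by apply/and4P; split=> //=; rewrite jE kE adj_lift in uv.
Qed.

Lemma lift_flag_inj i j p q : is_flag p -> lift_flag i p = lift_flag j q ->
  i = j /\ p = q.
Proof.
case: p q => [[u v] f] [[u' v'] f'] pK E.
have fE : f = f' := lift_injr (congr1 snd E).
have uE : u = u' := congr1 (fun x : flag L => x.1.1.2) E.
have vE : v = v' := congr1 (fun x : flag L => x.1.2.2) E.
have := congr1 (fun x : flag L => x.1.1.1) E.
by rewrite /= -uE -vE -fE => /addIr->.
Qed.

(** Stands for the flag involutions of [K] as functions; by [flag_rel_inj] the hypothesis [stepP]
    determines them on flags. *)
Variable step : nat -> flag K -> flag K.
Hypothesis stepP : forall k p, is_flag p -> flag_rel k p (step k p).

Fixpoint run (w : seq nat) (p : flag K) : flag K :=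
  if w is k :: w' then run w' (step k p) else p.

(** Only a change of face can change the sheet. The jump is a difference of two shifts, and its two
    terms are kept apart, as [step_up] and [step_down], to remain natural numbers independent of
    [M]. *)
Definition step_up k (p : flag K) : nat :=
  if k is k'.+2 then shift p.2 p.1.1 else 0.

Definition step_down k (p : flag K) : nat :=
  if k is k'.+2 then shift (step k p).2 p.1.1 else 0.

Fixpoint up (w : seq nat) (p : flag K) : nat :=
  if w is k :: w' then (step_up k p + up w' (step k p))%N else 0.

Fixpoint down (w : seq nat) (p : flag K) : nat :=
  if w is k :: w' then (step_down k p + down w' (step k p))%N else 0.

Lemma run_is_flag w p : is_flag p -> is_flag (run w p).
Proof. by elim: w p => [|k w IHw] p //= pK; apply: IHw; case: (stepP k pK). Qed.

Lemma lift_step i k p : is_flag p -> flag_rel k (lift_flag i p)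
  (lift_flag (i + (step_up k p)%:R - (step_down k p)%:R) (step k p)).
Proof.
move=> pK; have [_ qK kpq] := stepP k pK.
split; [exact: lift_is_flag|exact: lift_is_flag|].
case: k qK kpq => [qK|[|k] qK] /=.
- by move=> -> /=; rewrite addr0 subr0.
- rewrite addr0 subr0; case: (step 1 p) => [[u v] f] /= [-> -> vp].
  by rewrite /lift_flag /=; split=> //; rewrite xpair_eqE negb_and vp orbT.
case=> E fp; move: (step k.+2 p) E fp qK => [[u v] f] /= E fp qK.
move: pK; rewrite E in qK *;
  case: p E fp qK => [[u' v'] f'] /= [-> ->] fp qK pK.
rewrite /lift_flag /=; have [eK ef] := flag_edge qK;
  have [_ ef'] := flag_edge pK.
have fK : f \in faces K by case/and4P: qK.
have f'K : f' \in faces K by case/and4P: pK.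
split; last by apply: contraNneq fp => /lift_injr->.
rewrite subrK; congr (_, (_, _)).
(* The sheet of the new face was computed at the first end of the edge; by the cocycle condition the
   lift of the second end is unchanged as well. *)
have := jumpE m compat eK f'K fK ef' ef (u := u') (v := v').
rewrite !inE !eqxx orbT => /(_ isT isT); rewrite /jump => E'.
by rewrite -(addrA i) E' -addrA subrK.
Qed.

Lemma lift_run i w p : is_flag p -> flag_path w (lift_flag i p)
  (lift_flag (i + (up w p)%:R - (down w p)%:R) (run w p)).
Proof.
elim: w i p => [|k w IHw] i p pK /=; first by rewrite addr0 subr0.
exists (lift_flag (i + (step_up k p)%:R - (step_down k p)%:R) (step k p)).
  exact: lift_step.
have [_ qK _] := stepP k pK;
  have := IHw (i + (step_up k p)%:R - (step_down k p)%:R) _ qK.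
suff -> : i + (step_up k p)%:R - (step_down k p)%:R + (up w (step k p))%:R -
    (down w (step k p))%:R = i + (step_up k p + up w (step k p))%:R -
    (step_down k p + down w (step k p))%:R by [].
by rewrite !natrD opprD !addrA; congr (_ - _); rewrite addrAC.
Qed.


(** * Deck transformations and the automorphism group *)

Definition deck_fun j (x : L) : L := (x.1 + j, x.2).

Lemma deck_fun_inj j : injective (deck_fun j).
Proof. by move=> [i u] [k v] E; congr (_, _);
  [apply: (addIr j (congr1 fst E))|exact: (congr1 snd E)]. Qed.

Definition deck j : {perm L} := perm (@deck_fun_inj j).

Lemma deckE j (x : L) : deck j x = (x.1 + j, x.2).
Proof. exact: permE. Qed.

Lemma deck0 : deck 0 = 1%g.
Proof. by apply/permP => -[i v]; rewrite deckE perm1 /= addr0. Qed.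

Lemma deck_lift i j f A : deck j @: lift_set i f A = lift_set (i + j) f A.
Proof.
rewrite /lift_set -imset_comp; apply: eq_imset => v /=.
by rewrite deckE /= addrAC.
Qed.

Lemma deckD i j : deck (i + j) = (deck i * deck j)%g.
Proof. by apply/permP => x; rewrite permM !deckE /= addrA. Qed.

Lemma deck_aut j : deck j \in Aut_map L.
Proof.
apply: perm_autP => [E /covering_edgesP[i [f [e [fK eK ef ->]]]]|F
  /covering_facesP[i [f [fK ->]]]].
  by rewrite deck_lift; apply/covering_edgesP; exists (i + j), f, e.
by rewrite deck_lift; apply/covering_facesP; exists (i + j), f.
Qed.

Lemma deck_act i j p : act (deck j) (lift_flag i p) = lift_flag (i + j) p.
Proof.
by rewrite /act /lift_flag /= deck_lift !deckE /= ![_ + _ + j]addrAC.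
Qed.

Lemma deck_inj : injective deck.
Proof.
move=> i j /permP E; have /card_gt0P[v _] : (0 < #|K|)%N by case: mapK => [[]].
by have := congr1 fst (E (0, v)); rewrite !deckE /= !add0r.
Qed.

Definition escapes (w : seq nat) (p : flag K) : Prop :=
  run w p <> p \/ (up w p = (down w p).+1 \/ down w p = (up w p).+1).

Variables (W : seq (seq nat)) (p0 : flag K).
Hypothesis p0K : is_flag p0.
Hypothesis loops : forall w, w \in W -> run w p0 = p0 /\ up w p0 = down w p0.
Hypothesis indL : @face_induction L (fun _ _ _ => True) (lift_set 0 p0.2 p0.2).

(** The automorphism carries the closed lift of [w] at the base flag to a closed path at the lift of
    [p]. By uniqueness of ends, [w] is closed at [p] and its crossing number vanishes modulo [M],
    while 1 and -1 do not. *)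
Lemma aut_no_escape (a : {perm L}) i p w : a \in Aut_map L -> is_flag p ->
  act a (lift_flag 0 p0) = lift_flag i p -> w \in W -> ~ escapes w p.
Proof.
move=> aL pK aE /loops[loop vol] esc.
have := lift_run 0 w p0K; rewrite loop vol addrK => /(act_flag_path aL);
  rewrite aE => p_loop.
have := flag_path_inj mapL p_loop (lift_run i w pK).
case/(lift_flag_inj pK) => iE pE.
case: esc => [|esc]; first by rewrite -pE.
have ud : (up w p)%:R - (down w p)%:R = 0 :> 'I_M.
  by apply: (addrI i); rewrite addr0 addrA -iE.
case: esc ud => ->; rewrite -natr1.
  by rewrite addrAC subrr add0r => /eqP; rewrite oner_eq0.
by rewrite opprD addrA subrr sub0r => /eqP; rewrite oppr_eq0 oner_eq0.
Qed.

Lemma aut_lift_eq (a b : {perm L}) i p : a \in Aut_map L -> b \in Aut_map L ->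
  act a (lift_flag 0 p0) = lift_flag i p -> act b (lift_flag 0 p0) = lift_flag
    i p ->
  a = b.
Proof.
move=> aL bL aE bE.
by apply: (aut_eq mapL aL bL (lift_is_flag 0 p0K) _ erefl indL); rewrite aE bE.
Qed.

Lemma aut_image (a : {perm L}) : a \in Aut_map L -> exists i p,
  is_flag p /\ act a (lift_flag 0 p0) = lift_flag i p.
Proof.
move=> aL; apply: flag_of_lift; rewrite aut_is_flag //; exact: lift_is_flag.
Qed.

(** The product on the left of the morphism equation is the group law of ['Z_M], which is
    addition. *)
Lemma deck_morphM : {in [set: 'Z_M] &, {morph deck : i j / (i * j)%g}}.
Proof. by move=> i j _ _; rewrite /= -deckD. Qed.

Canonical deck_morphism := Morphism deck_morphM.

Lemma deck_injm : ('injm deck_morphism)%g.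
Proof. by apply/injmP => i j _ _; apply: deck_inj. Qed.

Theorem covering_aut_Zp :
    (forall p, is_flag p -> p <> p0 -> exists2 w, w \in W & escapes w p) ->
  Aut_map L \isog Zp M.
Proof.
move=> esc; rewrite isog_sym; apply/isogP.
exists deck_morphism; first exact: deck_injm.
apply/setP => a; apply/morphimP/idP => [[j _ _ ->]|aL]; first exact: deck_aut.
have [i [p [pK aE]]] := aut_image aL.
have [pE|/eqP/(esc p pK)[w wW]] := eqVneq p p0;
  last by case/(aut_no_escape aL pK aE wW).
exists i; rewrite ?inE //; apply: (aut_lift_eq aL (deck_aut i) aE).
by rewrite deck_act add0r pE.
Qed.

(* An involution of [K] that reverses the direction in which the sheets are
   traversed. *)
Variables (alpha : K -> K) (h : K -> nat).
Hypothesis alphaK : involutive alpha.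
Hypothesis hK : forall v, h (alpha v) = h v.
Hypothesis alpha_edge : forall e, e \in edges K -> alpha @: e \in edges K.
Hypothesis alpha_face : forall f, f \in faces K -> alpha @: f \in faces K /\
  exists n, forall v, v \in f ->
    h v = (n + shift f v + shift (alpha @: f) (alpha v))%N.

Definition reflection_fun (x : L) : L := ((h x.2)%:R - x.1, alpha x.2).

Lemma reflection_funK : involutive reflection_fun.
Proof. by move=> [i v];
  rewrite /reflection_fun /= hK alphaK opprB addrC subrK. Qed.

Definition reflection : {perm L} := perm (inv_inj reflection_funK).

Lemma reflectionE (x : L) : reflection x = ((h x.2)%:R - x.1, alpha x.2).
Proof. exact: permE. Qed.

(** Subtracting the sheet [i + shift f v] of a corner from [h v] leaves [n - i] plus the shift of
    the image corner, where [n] depends on the face only. So the copy of [f] in sheet [i] goes to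
    the copy of [alpha @: f] in sheet [n - i]. *)
Lemma reflection_lift f : f \in faces K -> exists j, forall i A, A \subset f ->
  reflection @: lift_set i f A = lift_set (j - i) (alpha @: f) (alpha @: A) /\
  {in A, forall v, reflection (i + (shift f v)%:R, v) =
                   (j - i + (shift (alpha @: f) (alpha v))%:R, alpha v)}.
Proof.
move=> fK; have [_ [n hE]] := alpha_face fK; exists n%:R => i A Af.
have rE v : v \in A -> reflection (i + (shift f v)%:R, v) =
    (n%:R - i + (shift (alpha @: f) (alpha v))%:R, alpha v).
  move=> vA; rewrite reflectionE /= (hE v (subsetP Af _ vA)) !natrD;
    congr (_, _).
  by apply/eqP; rewrite subr_eq addrACA subrK [in eqbRHS](addrC (shift _ (alpha
    v))%:R) addrA.
split=> //; rewrite /lift_set -!imset_comp; apply: eq_in_imset => v vA /=.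
by rewrite rE.
Qed.

Lemma reflection_aut : reflection \in Aut_map L.
Proof.
apply: perm_autP => [E /covering_edgesP[i [f [e [fK eK ef ->]]]]|F
  /covering_facesP[i [f [fK ->]]]].
  have [j jE] := reflection_lift fK; have [-> _] := jE i e ef.
  apply/covering_edgesP; exists (j - i), (alpha @: f), (alpha @: e).
  by have [afK _] := alpha_face fK; split; rewrite ?alpha_edge // imsetS.
have [j jE] := reflection_lift fK; have [-> _] := jE i f (subxx f).
by apply/covering_facesP; exists (j - i), (alpha @: f);
  have [] := alpha_face fK.
Qed.

Definition reflect_flag (p : flag K) : flag K :=
  (alpha p.1.1, alpha p.1.2, alpha @: p.2).

Lemma reflection_act : exists j,
  act reflection (lift_flag 0 p0) = lift_flag j (reflect_flag p0).
Proof.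
case: p0 p0K => [[u v] f] /and4P[/= _ fK uf vf].
have [j jE] := reflection_lift fK; have [E1 E2] := jE 0 f (subxx f).
by exists (j - 0); rewrite /act /lift_flag /= E1 !E2.
Qed.

(** Sheets are negated by the reflection; this makes [reflection * deck 1] an involution. *)
Lemma reflection_deck j : (deck j * reflection = reflection * deck (- j))%g.
Proof.
by apply/permP => x; rewrite !permM !(deckE, reflectionE) /= opprD addrA.
Qed.

Lemma reflection_sq : (reflection * reflection = 1)%g.
Proof. by apply/permP => x; rewrite permM perm1 !permE;
  apply: reflection_funK. Qed.

(** The deck group has index two; its other coset consists of the automorphisms sending the base
    flag over the reflected flag. The reflection and its product with [deck 1] are distinct
    involutions that generate both cosets, and a finite group generated by two distinct involutions
    is dihedral, the four-group for [M = 2] included. *)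
Theorem covering_aut_dihedral : reflect_flag p0 <> p0 ->
    (forall p, is_flag p -> p <> p0 -> p <> reflect_flag p0 ->
       exists2 w, w \in W & escapes w p) ->
  Aut_map L \isog 'D_(2 * M)%N.
Proof.
move=> p10 esc; set D := (deck_morphism @* [set: 'Z_M])%g.
have deckD1 j : deck j \in D by apply: mem_morphim; rewrite inE.
have [j0 rE] := reflection_act.
(* A deck transformation keeps the flag below, whereas the reflection moves the base flag over a
   different one. *)
have r_nD : reflection \notin D.
  apply/negP => /morphimP[j _ _ jE]; case: p10.
  move: rE; rewrite jE /= deck_act => /esym/lift_flag_inj[] //.
  (* [lift_flag_inj] asks that the reflected triple be a flag of [K]; this is read off from its
     lift. *)
  have := lift_is_flag 0 p0K; rewrite -(aut_is_flag _ reflection_aut).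
  have [j1 -> ] := reflection_act; case/and4P; rewrite /= !mem_lift.
  move=> a1 /covering_facesP[i [f [fK /lift_injr fE]]] /andP[u1 _] /andP[v1 _].
  by apply/and4P; split=> //=; rewrite ?fE //; move: a1; rewrite adj_lift // fE.
have AutE : Aut_map L = (D :|: reflection *: D)%g :> {set _}.
  apply/setP => a; apply/idP/idP => [aL|].
    have [i [p [pK aE]]] := aut_image aL.
    have [pE|/eqP p0p] := eqVneq p p0.
      rewrite inE (aut_lift_eq aL (deck_aut i) aE) ?deckD1 //.
      by rewrite deck_act add0r pE.
    have [pE|/eqP p1p] := eqVneq p (reflect_flag p0); last first.
      by have [w wW /(aut_no_escape aL pK aE wW)] := esc p pK p0p p1p.
    (* The reflection lands in sheet [j0]; the deck factor makes up the remaining difference. *)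
    rewrite inE; apply/orP; right; apply/lcosetP; exists (deck (i - j0)) => //.
    apply: (aut_lift_eq aL _ aE);
      first by rewrite groupM ?reflection_aut ?deck_aut.
    by rewrite actM rE deck_act pE addrC subrK.
  case/setUP=> [/morphimP[j _ _ ->]|/lcosetP[_ /morphimP[j _ _ ->] ->]].
    exact: deck_aut.
  by rewrite groupM ?reflection_aut // deck_aut.
have AutC : #|Aut_map L| = (2 * M)%N.
  have Dd : (D :&: reflection *: D)%g = set0.
    apply/setP => a; rewrite !inE; apply/negP => /andP[aD /lcosetP[b bD E]].
    by case/negP: r_nD; rewrite -(mulgK b reflection) -E groupM ?groupV.
  rewrite AutE cardsU Dd cards0 subn0 card_lcoset addnn mul2n.
  by rewrite card_injm ?deck_injm // cardsT card_ord.
have r1 : reflection != 1%g by apply: contraNneq r_nD => ->; apply: group1.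
have rd1 : (reflection * deck 1%R)%g != 1%g.
  apply: contraNneq r_nD => /(canRL (mulgK _)); rewrite mul1g => ->.
  by rewrite groupV.
have genE : <<[set reflection;
  reflection * deck 1%R]>>%g = Aut_map L :> {set _}.
  apply/eqP; rewrite eqEsubset gen_subG; apply/andP; split.
    apply/subsetP => a; rewrite in_set2 => /orP[]/eqP->;
      first exact: reflection_aut.
    by rewrite groupM ?reflection_aut ?deck_aut.
  set S := [set _; _]; pose G := <<S>>%G; rewrite -[<<S>>%g]/(gval G).
  have rG : reflection \in G by apply: mem_gen; rewrite !inE eqxx.
  have dG : deck 1 \in G.
    have -> : deck 1 = (reflection * (reflection * deck 1%R))%g.
      by rewrite mulgA reflection_sq mul1g.
    by rewrite groupM //; apply: mem_gen; rewrite !inE eqxx orbT.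
  have DG : D \subset G.
    apply/subsetP => _ /morphimP[j _ _ ->] /=; rewrite -[j]natr_Zp.
    elim: (val j) => [|n IHn]; last by rewrite -natr1 deckD groupM.
    by rewrite mulr0n deck0.
  rewrite AutE subUset DG /=.
  by apply/subsetP => _ /lcosetP[a aD ->]; rewrite groupM // (subsetP DG).
have /involutions_gen_dihedral : #[reflection]%g = 2.
  by apply: nt_prime_order; rewrite // expgS expg1 reflection_sq.
move=> /(_ (reflection * deck 1%R)%g) /=; rewrite genE AutC; apply.
- apply: nt_prime_order; rewrite // expgS expg1.
  rewrite mulgA -(mulgA reflection) reflection_deck !mulgA reflection_sq mul1g.
  by rewrite -deckD addNr deck0.
- rewrite -{1}[reflection]mulg1 (inj_eq (mulgI _)) eq_sym.
  apply/eqP => E; have /eqP := deck_inj (etrans E (esym deck0)).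
  by rewrite oner_eq0.
Qed.

End CoveringAut.

(** * Finite certificates *)

(* Faces are referred to by their position in [face_list] and list their
   vertices in cyclic order; [star_list] gives the face-cycle of each vertex,
   read so that the face sizes form [face_sizes X]. An entry [(v, (s1, s2))] of
   [cut_list] splits the face-cycle of [v] into the faces [s1] on side A and
   [s2] on side B of the cutting cycle. The letters 0, 1 and 2 of a word change
   the vertex, edge and face of a flag [(u, v, j)] with vertex [u], edge [uv]
   and face [j]. If not empty, [symmetry] lists for each [v] the pair
   [(alpha v, h v)] of a reflection [(i, v) |-> (h v - i, alpha v)]. *)
Record map_data := MapData {
  last_vertex : nat;
  face_list : seq (seq N);
  star_list : seq (seq nat);
  cut_list : seq (N * (seq nat * seq nat));
  word_list : seq (seq nat);
  base_flag : N * N * nat;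
  symmetry : seq (N * nat)
}.

Section Check.

Variables (X : seq (nat * nat)) (d : map_data).

Definition nb_vertices := (last_vertex d).+1.
Definition vertices : seq N := map bin_of_nat (iota 0 nb_vertices).
Definition nb_faces := size (face_list d).
Definition face_at (j : nat) : seq N := nth [::] (face_list d) j.
Definition star_at (v : N) : seq nat := nth [::] (star_list d) v.

(** The membership test guards against the default of [next] and [prev], which fix every element
    outside the list. *)
Definition consec (f : seq N) (u v : N) : bool :=
  (u \in f) && ((next f u == v) || (prev f u == v)).

Definition check_faces : bool :=
  (0 < nb_faces) && all (fun f : seq N =>
    [&& 2 < size f, uniq f & all (fun v : N => v < nb_vertices) f]) (face_list
      d).

(** The count makes [s] complete: its entries are distinct faces at [v], as many as the face list
    has at [v]. *)
Definition star_ok (v : N) (s : seq nat) : bool :=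
  [&& 2 < size s, uniq s,
      all (fun j => (j < nb_faces) && (v \in face_at j)) s,
      count (fun f : seq N => v \in f) (face_list d) == size s
    & path.cycle (fun i j => consec (face_at j) v (next (face_at i) v) ||
                             consec (face_at j) v (prev (face_at i) v)) s].

Definition check_stars : bool :=
  all (fun v => star_ok v (star_at v) &&
    ([seq size (face_at j) | j <- star_at v] == face_sizes X)) vertices.

Definition shiftN (j : nat) (v : N) : bool :=
  has (fun e => (e.1 == v) && (j \in e.2.2)) (cut_list d).

Definition common (u v : N) : seq nat := [seq j <- star_at u | v \in face_at j].

(** Asking the ends to be consecutive on every common face excludes edges that are chords of a face.
    The last condition is the cocycle condition of the covering. *)
Definition check_edges : bool :=
  all (fun f : seq N => all (fun u =>
    let v := next f u in let js := common u v in
    [&& size js == 2, all (fun j => consec (face_at j) u v) js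
      & all (fun i => all (fun j => shiftN i u + shiftN j v ==
                                    shiftN i v + shiftN j u) js) js]) f)
    (face_list d).

Definition meet_ok (f g : seq N) : bool :=
  match [seq v <- f | v \in g] with
  | [::] | [:: _] => true
  | [:: u; v] => consec f u v
  | _ => false
  end.

Definition check_meets : bool := pairwise meet_ok (face_list d).

(** Ordering the two ends gives each edge one representative, so that the size counts edges. *)
Definition edge_list : seq (N * N) :=
  undup [seq (let v := next f u in if u < v then (u, v) else (v, u)) |
           f : seq N <- face_list d, u : N <- f].

(** [V - E + F = -2] without subtraction. *)
Definition check_euler : bool := size edge_list == nb_vertices + nb_faces + 2.

Definition cut : seq N := unzip1 (cut_list d).

(** The default index [nb_faces] denotes the empty face, on which [consec] fails; so both sides [s1]
    and [s2] are forced to be nonempty. *)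
Definition check_cut : bool :=
  [&& 2 < size cut, uniq cut, all (fun v : N => v < nb_vertices) cut
    & all (fun e => let: (v, (s1, s2)) := e in
        let u := prev cut v in let w := next cut v in
        [&& star_ok v (s1 ++ s2),
            consec (face_at (head nb_faces s1)) v u,
            consec (face_at (last nb_faces s2)) v u,
            consec (face_at (last nb_faces s1)) v w,
            consec (face_at (head nb_faces s2)) v w
          & all (fun j => shiftN j v == shiftN j w) (common v w)]) (cut_list
            d)].

Definition link (i j : nat) : bool :=
  match [seq v <- face_at i | v \in face_at j] with
  | [:: u; v] => [&& ~~ consec cut u v, shiftN i u == shiftN j u
                   & shiftN i v == shiftN j v]
  | _ => false
  end.

(** The faces are listed so that each one after face 0 is linked to an earlier one. The links form a
    spanning tree of the dual graph that avoids the cut and stays in one sheet. *)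
Definition check_dual : bool :=
  all (fun j => has (link^~ j) (rev (iota 0 j))) (iota 1 nb_faces.-1).

Definition stepN (k : nat) (p : N * N * nat) : N * N * nat :=
  let: (u, v, j) := p in
  match k with
  | 0 => (v, u, j)
  | 1 => (u, if next (face_at j) u == v then prev (face_at j) u
             else next (face_at j) u, j)
  | _ => (u, v, head j [seq i <- common u v | i != j])
  end.

Fixpoint walk (w : seq nat) (p : N * N * nat) (a b : nat) :
    (N * N * nat) * nat * nat :=
  if w is k :: w' then
    let q := stepN k p in
    if k is k'.+2 then walk w' q (a + shiftN p.2 p.1.1) (b + shiftN q.2 p.1.1)
    else walk w' q a b
  else (p, a, b).

Definition escapesN (p : N * N * nat) (w : seq nat) : bool :=
  let: (q, a, b) := walk w p 0 0 in
  [|| q != p, a == b.+1 | b == a.+1].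

Definition flagsN : seq (N * N * nat) :=
  flatten [seq flatten [seq [:: (u, next (face_at j) u, j);
    (u, prev (face_at j) u, j)]
    | u <- face_at j] | j <- iota 0 nb_faces].

Definition sym (v : N) : N := (nth (0%num, 0) (symmetry d) v).1.
Definition height (v : N) : nat := (nth (0%num, 0) (symmetry d) v).2.
Definition has_symmetry : bool := symmetry d != [::].

(** For the faces an inclusion is tested: in a polyhedral map two faces with three common vertices
    coincide. *)
Definition reflectedN (p q : N * N * nat) : bool :=
  [&& sym p.1.1 == q.1.1, sym p.1.2 == q.1.2
    & all (fun v => sym v \in face_at q.2) (face_at p.2)].

Definition check_words : bool :=
  let p0 := base_flag d in
  [&& (p0.2 < nb_faces) && consec (face_at p0.2) p0.1.1 p0.1.2,
      all (fun w => let: (q, a, b) := walk w p0 0 0 in (q == p0) && (a == b))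
        (word_list d)
    & all (fun p => [|| p == p0, has_symmetry && reflectedN p0 p
                      | has (escapesN p) (word_list d)]) flagsN].

(* The last condition makes the truncated subtractions before it exact. *)
Definition check_symmetry : bool :=
  has_symmetry ==>
  [&& sym (base_flag d).1.1 != (base_flag d).1.1,
      all (fun v => [&& sym v < nb_vertices, sym (sym v) == v
                      & height (sym v) == height v]) vertices
    & all (fun i => has (fun j =>
        [&& size (face_at i) == size (face_at j),
            all (fun u => consec (face_at j) (sym u) (sym (next (face_at i)
              u))) (face_at i)
          & constant [seq height v - shiftN i v - shiftN j (sym v) | v <-
            face_at i]
            && all (fun v => shiftN i v + shiftN j (sym v) <= height v)
              (face_at i)])
        (star_at (sym (head 0%num (face_at i))))) (iota 0 nb_faces)].

Definition check : bool :=
  [&& valid_type X, check_faces, check_stars, check_edges, check_meets,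
      check_euler, check_cut, check_dual, check_words & check_symmetry].

End Check.

(** * Realization of a certificate *)

Lemma set2_eq (T : finType) (a b x y : T) : [set a; b] = [set x; y] ->
  a = x /\ b = y \/ a = y /\ b = x.
Proof.
move=> E; have := set21 a b; have := set22 a b; rewrite E !inE.
have := set21 x y; have := set22 x y; rewrite -E !inE.
by do 4![case/orP=> /eqP ?]; subst; auto.
Qed.

Lemma consec_mem (f : seq N) u v : consec f u v -> (u \in f) && (v \in f).
Proof. by case/andP => uf /orP[]/eqP<-; rewrite uf ?mem_next ?mem_prev. Qed.

Lemma consec_sym (f : seq N) u v : uniq f -> consec f u v = consec f v u.
Proof.
move=> fU; apply/idP/idP => H; have /andP[uf vf] := consec_mem H;
  rewrite /consec ?uf ?vf /=; case/andP: H => _ /orP[]/eqP<-;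
  by rewrite ?(prev_next fU) ?(next_prev fU) eqxx ?orbT.
Qed.

Section MapOfData.

Variable d : map_data.
Local Notation V := 'I_(last_vertex d).+1.
Local Notation nf := (nb_faces d).
Local Notation face := (face_at d).
Local Notation star := (star_at d).

Definition label (v : V) : N := bin_of_nat v.
Definition unlabel (x : N) : V := inord (nat_of_bin x).
Definition vset (f : seq N) : {set V} := [set v | label v \in f].
Definition pair_set (p : N * N) : {set V} := [set unlabel p.1; unlabel p.2].

Definition map_of : cell_complex :=
  @CellComplex V [set e in map pair_set (edge_list d)]
    [set f in map vset (face_list d)].

Lemma labelK : cancel label unlabel.
Proof. by move=> v; rewrite /unlabel bin_of_natK inord_val. Qed.

Lemma label_inj : injective label.
Proof. exact: can_inj labelK. Qed.

Lemma unlabelK (x : N) : x < nb_vertices d -> label (unlabel x) = x.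
Proof. by move=> xn; rewrite /label inordK // nat_of_binK. Qed.

Lemma label_lt v : label v < nb_vertices d.
Proof. by rewrite bin_of_natK. Qed.

Lemma label_vertices v : label v \in vertices d.
Proof. by apply/mapP; exists (val v); rewrite // mem_iota add0n ltn_ord. Qed.

Lemma map_labelK (s : seq N) : all (fun x : N => x < nb_vertices d) s ->
  map label (map unlabel s) = s.
Proof.
by move=> /allP sn; rewrite -map_comp map_id_in // => x /sn /unlabelK.
Qed.

Lemma mem_vset f v : (v \in vset f) = (label v \in f).
Proof. by rewrite inE. Qed.

Lemma map_of_facesP (F : {set map_of}) :
  reflect (exists2 j, j < nf & F = vset (face j)) (F \in faces map_of).
Proof.
rewrite inE; apply: (iffP mapP) => [[f /(nthP [::])[j jn <-] ->]|[j jn ->]].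
  by exists j.
by exists (face j) => //; apply: mem_nth.
Qed.

Variable X : seq (nat * nat).
Hypothesis dok : check X d.

Lemma dok_faces : check_faces d. Proof. by case/and5P: dok. Qed.
Lemma dok_stars : check_stars X d. Proof. by case/and5P: dok. Qed.
Lemma dok_edges : check_edges d. Proof. by case/and5P: dok. Qed.
Lemma dok_meets : check_meets d. Proof. by case/and5P: dok => _ _ _ _ /and5P[].
  Qed.
Lemma dok_euler : check_euler d. Proof. by case/and5P: dok => _ _ _ _ /and5P[].
  Qed.
Lemma dok_cut : check_cut d. Proof. by case/and5P: dok => _ _ _ _ /and5P[]. Qed.
Lemma dok_dual : check_dual d. Proof. by case/and5P: dok => _ _ _ _ /and5P[].
  Qed.
Lemma dok_words : check_words d.
Proof. by case/and5P: dok => _ _ _ _ /and5P[_ _ _ _ /andP[]]. Qed.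
Lemma dok_symmetry : check_symmetry d.
Proof. by case/and5P: dok => _ _ _ _ /and5P[_ _ _ _ /andP[]]. Qed.

Lemma face_ok j : j < nf ->
  [/\ 2 < size (face j), uniq (face j) &
      all (fun v : N => v < nb_vertices d) (face j)].
Proof. by case/andP: dok_faces => _ /all_nthP H /(H [::])/and3P. Qed.

Lemma face_uniq j : uniq (face j).
Proof.
by have [/face_ok[]//|jn] := ltnP j nf; rewrite /face_at nth_default.
Qed.

Lemma face_lt j (x : N) : x \in face j -> x < nb_vertices d.
Proof.
have [/face_ok[_ _ /allP H] /H//|jn] := ltnP j nf.
by rewrite /face_at nth_default.
Qed.

Lemma mem_face_lt j (x : N) : x \in face j -> j < nf.
Proof. by apply: contraTT; rewrite -leqNgt => ?;
  rewrite /face_at nth_default. Qed.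

Lemma face_next_neq j x : x \in face j -> x != next (face j) x.
Proof.
move=> xf; have [f3 fU _] := face_ok (mem_face_lt xf); apply/eqP => E.
by have := next_next_neq f3 fU xf; rewrite -!E eqxx.
Qed.

Lemma face_prev_next_neq j x : x \in face j ->
  prev (face j) x != next (face j) x.
Proof.
move=> xf; have [f3 fU _] := face_ok (mem_face_lt xf); apply/eqP => E.
by have := next_next_neq f3 fU xf; rewrite -{1}E next_prev ?eqxx.
Qed.

Lemma face_consec_sym j u v : consec (face j) u v = consec (face j) v u.
Proof. exact: consec_sym (face_uniq j). Qed.

Lemma vset_unlabel j x : x \in face j -> unlabel x \in vset (face j).
Proof. by move=> xf; rewrite mem_vset unlabelK // (face_lt xf). Qed.

Lemma vset_seq j : vset (face j) = [set v in map unlabel (face j)].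
Proof.
apply/setP => v; rewrite !inE; apply/idP/mapP => [vf|[x xf ->]].
  by exists (label v); rewrite ?labelK.
by rewrite unlabelK // (face_lt xf).
Qed.

Lemma uniq_unlabel j : uniq (map unlabel (face j)).
Proof.
rewrite map_inj_in_uniq ?face_uniq // => x y xf yf E.
by rewrite -(unlabelK (face_lt xf)) E unlabelK // (face_lt yf).
Qed.

Lemma card_vset j : #|vset (face j)| = size (face j).
Proof. by rewrite vset_seq cardsE (card_uniqP (uniq_unlabel j)) size_map. Qed.

Lemma star_okP v s : star_ok d v s ->
  (forall j, (j \in s) = (v \in face j)) /\ (forall j, j \in s -> j < nf).
Proof.
case/and5P => _ sU /allP s_sub /eqP s_count _.
have sn j : j \in s -> j < nf by case/s_sub/andP.
split=> // j; apply/idP/idP => [/s_sub/andP[]//|vj].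
(* [s] is a duplicate-free part of [t] of the same size, hence has the same members. *)
pose t := [seq i <- iota 0 nf | v \in face i].
have -> : j \in s = (j \in t).
  apply: (uniq_min_size sU _ _).2 => [i is_|].
    by rewrite mem_filter mem_iota add0n sn // (andP (s_sub _ is_)).2.
  rewrite size_filter -s_count -[in leqRHS](mkseq_nth [::] (face_list d)).
  by rewrite count_map.
by rewrite mem_filter vj mem_iota (mem_face_lt vj).
Qed.

Lemma star_star_ok v : star_ok d (label v) (star (label v)).
Proof. by have /allP/(_ _ (label_vertices v))/andP[] := dok_stars. Qed.

Lemma mem_star (x : N) j : x < nb_vertices d -> (j \in star x) = (x \in face j).
Proof.
by move=> xn; have := star_star_ok (unlabel x);
  rewrite unlabelK // => /star_okP[->].
Qed.

Lemma mem_common (x y : N) j : x < nb_vertices d ->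
  (j \in common d x y) = (x \in face j) && (y \in face j).
Proof. by move=> xn; rewrite mem_filter mem_star // andbC. Qed.

Lemma common_uniq (x y : N) : x < nb_vertices d -> uniq (common d x y).
Proof.
move=> xn; apply: filter_uniq.
by have /and5P[] := star_star_ok (unlabel x); rewrite unlabelK.
Qed.

(** The check runs along each face in the direction of [next]; the opposite order of the ends
    follows by the symmetry of the three conclusions. *)
Lemma edge_two j x y : consec (face j) x y ->
  [/\ size (common d x y) = 2,
      {in common d x y, forall i, consec (face i) x y} &
      {in common d x y &, forall i k,
        shiftN d i x + shiftN d k y = shiftN d i y + shiftN d k x}].
Proof.
have main u i : u \in face i -> let v := next (face i) u in
  [/\ size (common d u v) = 2,
      {in common d u v, forall i, consec (face i) u v} &
      {in common d u v &, forall i k,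
        shiftN d i u + shiftN d k v = shiftN d i v + shiftN d k u}].
  move=> ui v; have /allP/(_ (face i)) := dok_edges.
  rewrite mem_nth ?(mem_face_lt ui) // => /(_ isT)/allP/(_ u ui).
  case/and3P => /eqP s2 /allP cons /allP sh; split=> // k l kc lc.
  by apply/eqP; have /allP := sh k kc; apply.
move=> H; have /andP[xj yj] := consec_mem H.
case/andP: (H) => _ /orP[]/eqP E; first by rewrite -E; apply: main.
have [s2 cons sh] := main y j yj.
rewrite -E next_prev ?face_uniq // E in s2 cons sh.
have memE : common d x y =i common d y x.
  by move=> i; rewrite !mem_common ?(face_lt xj) ?(face_lt yj) // andbC.
split.
- rewrite -s2; apply: perm_size; apply: uniq_perm => //; apply: common_uniq.
    exact: face_lt xj.
  exact: face_lt yj.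
- by move=> i; rewrite memE face_consec_sym; apply: cons.
move=> i k; rewrite !memE => ic kc; have := sh k i kc ic.
by rewrite addnC => ->; rewrite addnC.
Qed.

Lemma edge_listP p : p \in edge_list d ->
  p.1 < p.2 /\ exists j, consec (face j) p.1 p.2.
Proof.
rewrite mem_undup => /allpairsPdep[f [x [/(nthP [::])[j jn <-] xf ->]]] /=.
rewrite -/(face_at d j) in xf *.
have xy : consec (face j) x (next (face j) x) by rewrite /consec xf eqxx.
case: (ltnP x (next (face j) x)) => [lt|]; first by split=> //; exists j.
rewrite leq_eqVlt => /orP[/eqP E|lt].
  by have := face_next_neq xf; rewrite (can_inj nat_of_binK E) eqxx.
by split=> //; exists j; rewrite face_consec_sym.
Qed.

Lemma map_of_adjP (u v : map_of) :
  reflect (exists j, consec (face j) (label u) (label v)) (adj u v).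
Proof.
rewrite /adj /= inE; apply: (iffP mapP) => [[p]|[j H]].
  case/edge_listP => _ [j H] /set2_eq E; exists j.
  have /andP[xj yj] := consec_mem H.
  case: E => -[-> ->]; rewrite !unlabelK ?(face_lt xj) ?(face_lt yj) //.
  by rewrite face_consec_sym.
have [x [xj E]] : exists x, x \in face j /\
    ((label u, label v) = (x, next (face j) x) \/ (label v, label u) = (x, next
      (face j) x)).
  have /andP[uj vj] := consec_mem H.
  case/andP: (H) => _ /orP[]/eqP E; [exists (label u)|exists (label v)];
    split=> //.
    by left; rewrite E.
  by right; rewrite -E next_prev ?face_uniq.
pose y := next (face j) x.
exists (if x < y then (x, y) else (y, x)).
  rewrite mem_undup; apply/allpairsPdep; exists (face j), x; split=> //=.
  by apply: mem_nth; apply: mem_face_lt xj.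
have -> : pair_set (if x < y then (x, y) else (y, x)) = [set unlabel x;
  unlabel y].
  by case: ifP => _ //; rewrite /pair_set setUC.
by case: E => -[Ex Ey]; rewrite /y -Ey -Ex !labelK // setUC.
Qed.

Lemma map_of_edgeP (e : {set map_of}) : e \in edges map_of ->
  exists u v, [/\ e = [set u; v], adj u v & u != v].
Proof.
move=> eK; have := eK; rewrite inE => /mapP[p /edge_listP[lt [j H]] E].
exists (unlabel p.1), (unlabel p.2); rewrite /adj /= -[[set _; _]]E; split=> //.
have /andP[xj yj] := consec_mem H.
apply: contraTneq lt => /(congr1 label).
by rewrite !unlabelK ?(face_lt xj) ?(face_lt yj) // => ->; rewrite ltnn.
Qed.

Lemma map_of_edge_card (e : {set map_of}) : e \in edges map_of -> #|e| = 2.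
Proof. by case/map_of_edgeP => u [v [-> _ uv]]; rewrite cards2 uv. Qed.

(** The edge may have been contributed by another face, but [check_edges] makes its ends consecutive
    on every common face: faces are induced cycles. *)
Lemma adj_consec j (u v : map_of) : u \in vset (face j) -> v \in vset (face j)
  ->
  adj u v = consec (face j) (label u) (label v).
Proof.
rewrite !mem_vset => uj vj; apply/map_of_adjP/idP => [[i]|]; last by exists j.
case/edge_two => _ + _; apply.
by rewrite mem_common ?label_lt // uj.
Qed.

Lemma map_of_polygon f : f \in faces map_of -> is_polygon f.
Proof.
case/map_of_facesP => j jn ->; have [f3 fU fn] := face_ok jn.
exists (map unlabel (face j)); split; rewrite ?size_map ?uniq_unlabel //.
  exact: vset_seq.
move=> u v uf vf; rewrite (adj_consec uf vf).
rewrite !mem_vset in uf vf; rewrite /consec uf /=.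
rewrite -{1 2}(map_labelK fn) (next_map label_inj) ?(prev_map label_inj)
  ?uniq_unlabel //.
by rewrite !(inj_eq label_inj) ![_ == v]eq_sym.
Qed.

(** The second part names the two common vertices as [link] computes them, for use in the dual
    spanning tree. *)
Lemma map_of_meet i j : i < j -> j < nf -> let I := vset (face i) :&: vset
  (face j) in
  [\/ I = set0, #|I| = 1 | I \in edges map_of] /\
  (forall x y, [seq v <- face i | v \in face j] = [:: x; y] ->
    [/\ I = [set unlabel x; unlabel y], x \in face i, y \in face i,
        x \in face j & y \in face j]).
Proof.
move=> ij jn I; have in_ := ltn_trans ij jn.
have : meet_ok (face i) (face j).
  by have /(pairwiseP [::])/(_ i j) := dok_meets; rewrite !inE; apply.
have IE : I = [set v in map unlabel [seq v <- face i | v \in face j]].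
  apply/setP => v; rewrite !inE; apply/andP/mapP => [[vi vj]|[x]].
    by exists (label v); rewrite ?labelK // mem_filter vj.
  by rewrite mem_filter => /andP[xj xi] ->; rewrite unlabelK // (face_lt xi).
have sub x : x \in [seq v <- face i | v \in face j] -> x \in face i /\ x \in
  face j.
  by rewrite mem_filter => /andP[].
rewrite /meet_ok; move: IE sub.
case: [seq _ <- _ | _] => [|x [|y [|z s]]] //= IE sub H.
- by split=> //; apply: Or31; apply/setP => v; rewrite IE !inE.
- split=> //; apply: Or32; apply/eqP/cards1P; exists (unlabel x).
  by apply/setP => v; rewrite IE !inE.
have E : I = [set unlabel x; unlabel y] by apply/setP => v; rewrite IE !inE.
split=> [|_ _ [<- <-]]; last first.
  by have [] := sub x; have [] := sub y; rewrite ?inE ?eqxx ?orbT //; split.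
apply: Or33; rewrite E; apply/map_of_adjP; exists i.
by have /andP[xi yi] := consec_mem H;
  rewrite !unlabelK ?(face_lt xi) ?(face_lt yi).
Qed.

(** A face listed twice would meet its copy in at least three vertices, against [check_meets]. *)
Lemma vset_inj i j : i < nf -> j < nf -> vset (face i) = vset (face j) -> i = j.
Proof.
have main k l : k < l -> l < nf -> vset (face k) <> vset (face l).
  move=> kl ln E; have [+ _] := map_of_meet kl ln; rewrite -E setIid.
  have [f3 _ _] := face_ok (ltn_trans kl ln); rewrite -card_vset in f3.
  case=> [I0|I1|/map_of_edge_card I2]; first by rewrite I0 cards0 in f3.
    by rewrite I1 in f3.
  by rewrite I2 in f3.
move=> in_ jn E; have [ij|ji|//] := ltngtP i j;
  first by case: (main _ _ ij jn E).
by case: (main _ _ ji in_ (esym E)).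
Qed.

Lemma map_of_face_cycle (v : map_of) s : star_ok d (label v) s ->
  face_cycle v [seq vset (face j) : {set map_of} | j <- s].
Proof.
move=> sok; have [sE sn] := star_okP sok; case/and5P: sok => s3 sU _ _ sC.
split; rewrite ?size_map //.
- by rewrite map_inj_in_uniq // => i j /sn ? /sn ?; apply: vset_inj.
- move=> F; apply/mapP/andP => [[j js ->]|[/map_of_facesP[j jn ->]]].
    rewrite mem_vset -sE js; split=> //.
    by apply/map_of_facesP; exists j => //; apply: sn.
  by rewrite mem_vset -sE; exists j.
rewrite cycle_map; apply: (sub_in_cycle (P := mem s)) sC => [i j is_ js H|];
  last exact/allP.
have vi : label v \in face i by rewrite -sE.
have [w [wi wj]] : exists w, consec (face i) (label v) w /\ consec (face j)
  (label v) w.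
  case/orP: H => H; [exists (next (face i) (label v))|exists (prev (face i)
    (label v))];
  by rewrite /consec vi !eqxx ?orbT.
have /andP[_ wi'] := consec_mem wi; have /andP[vj wj'] := consec_mem wj.
apply/existsP; exists [set v; unlabel w]; apply/and4P; split.
- by apply/map_of_adjP; exists i; rewrite unlabelK ?(face_lt wi').
- by rewrite !inE eqxx.
- by apply/subsetP => x; rewrite !inE => /orP[]/eqP-> //;
  rewrite unlabelK ?(face_lt wi').
by apply/subsetP => x; rewrite !inE => /orP[]/eqP-> //;
  rewrite unlabelK ?(face_lt wi').
Qed.

Lemma map_of_edge_faces (e : {set map_of}) : e \in edges map_of ->
  #|[set f in faces map_of | e \subset f]| = 2.
Proof.
case/map_of_edgeP => u [v [-> /map_of_adjP[j H] uv]].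
have [s2 _ _] := edge_two H.
rewrite (_ : [set f in _ | _] =
  [set f in [seq vset (face i) : {set map_of} | i <- common d (label u) (label
    v)]]).
  rewrite cardsE (card_uniqP _) ?size_map // map_inj_in_uniq ?common_uniq
    ?label_lt //.
  move=> i k; rewrite !mem_common ?label_lt // => /andP[/mem_face_lt ik _]
    /andP[/mem_face_lt kn _].
  exact: vset_inj.
apply/setP => f; rewrite !inE;
  apply/andP/mapP => [[/mapP[g gf ->] /subsetP uvf]|[i]].
  case/(nthP [::]): gf uvf => i ik <- uvf; exists i => //.
  rewrite mem_common ?label_lt //.
  by have := uvf u; have := uvf v; rewrite !inE !eqxx orbT => -> // ->.
rewrite mem_common ?label_lt // => /andP[ui vi] ->; split.
  by apply: map_f; apply: mem_nth; apply: mem_face_lt ui.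
by apply/subsetP => x; rewrite !inE => /orP[]/eqP->.
Qed.

(** * The cutting cycle and its two sides *)

Definition cut_cycle : seq map_of := map unlabel (cut d).

(** Faces are indices in the certificate but sets in the labelling; the comparison with [vset]
    translates, unambiguously by [vset_inj]. *)
Definition side (F : {set map_of}) (v : map_of) : bool :=
  has (fun e => (e.1 == label v) && has (fun j => F == vset (face j)) e.2.2)
    (cut_list d).

Lemma cut_lt : all (fun x : N => x < nb_vertices d) (cut d).
Proof. by case/and4P: dok_cut. Qed.

Lemma cut_uniq : uniq (cut d).
Proof. by case/and4P: dok_cut. Qed.

Lemma label_cut : map label cut_cycle = cut d.
Proof. exact: map_labelK cut_lt. Qed.

Lemma cut_cycle_uniq : uniq cut_cycle.
Proof. by rewrite -(map_inj_uniq label_inj) label_cut cut_uniq. Qed.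

Lemma mem_cut_cycle v : (v \in cut_cycle) = (label v \in cut d).
Proof. by rewrite -label_cut (mem_map label_inj). Qed.

Lemma label_next v : label (next cut_cycle v) = next (cut d) (label v).
Proof. by rewrite -label_cut (next_map label_inj) ?cut_cycle_uniq. Qed.

Lemma label_prev v : label (prev cut_cycle v) = prev (cut d) (label v).
Proof. by rewrite -label_cut (prev_map label_inj) ?cut_cycle_uniq. Qed.

Lemma cut_entry v : v \in cut_cycle -> exists s1 s2,
  (label v, (s1, s2)) \in cut_list d.
Proof.
by rewrite mem_cut_cycle => /mapP[[x [s1 s2]] xs /= ->]; exists s1, s2.
Qed.

Lemma cut_entry_inj x s t : (x, s) \in cut_list d -> (x, t) \in cut_list d -> s
  = t.
Proof.
move=> xs xt; have := cut_uniq; rewrite /cut /unzip1 => U.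
have s1 : (index (x, s) (cut_list d)) = index (x, t) (cut_list d).
  apply/eqP; rewrite -(nth_uniq 0%num _ _ U) ?size_map ?index_mem //.
  by rewrite !(nth_map (x, s)) ?index_mem // !nth_index.
by have := nth_index (x, s) xs; rewrite s1 (nth_index _ xt) => -[].
Qed.

Lemma cut_entry_ok v s1 s2 : (label v, (s1, s2)) \in cut_list d ->
  [/\ star_ok d (label v) (s1 ++ s2),
      consec (face (head nf s1)) (label v) (label (prev cut_cycle v)) /\
      consec (face (last nf s2)) (label v) (label (prev cut_cycle v)),
      consec (face (last nf s1)) (label v) (label (next cut_cycle v)) /\
      consec (face (head nf s2)) (label v) (label (next cut_cycle v))
    & forall j, label v \in face j -> label (next cut_cycle v) \in face j ->
        shiftN d j (label v) = shiftN d j (label (next cut_cycle v))].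
Proof.
have /and4P[_ _ _ /allP H] := dok_cut.
move=> /H /and5P[sok c1 c2 c3 /andP[c4 /allP sh]].
rewrite label_prev label_next; split=> // j vj wj; apply/eqP/sh.
by rewrite mem_common ?label_lt // vj.
Qed.

Lemma shiftN_entry v s1 s2 j : (label v, (s1, s2)) \in cut_list d ->
  shiftN d j (label v) = (j \in s2).
Proof.
move=> vs; apply/hasP/idP => [[[x t] xt /= /andP[/eqP E]]|js].
  by rewrite E in xt; rewrite (cut_entry_inj xt vs).
by exists (label v, (s1, s2)); rewrite //= eqxx.
Qed.

Lemma sideE j v : j < nf -> side (vset (face j)) v = shiftN d j (label v).
Proof.
move=> jn; apply/hasP/hasP => -[[x [s1 s2]] xs /= /andP[/eqP xv]].
  case/hasP => i is2 /eqP E; exists (x, (s1, s2)); rewrite //= xv eqxx /=.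
  rewrite xv in xs; have [/star_okP[_ sn] _ _ _] := cut_entry_ok xs.
  by rewrite (vset_inj jn _ E) // sn // mem_cat is2 orbT.
move=> js; exists (x, (s1, s2)); rewrite //= xv eqxx /=.
by apply/hasP; exists j.
Qed.

Local Notation shift := (@sheet_shift map_of cut_cycle side).

Lemma shiftE j v : j < nf -> shift (vset (face j)) v = shiftN d j (label v).
Proof.
move=> jn; rewrite /sheet_shift sideE //;
  apply/andb_idl => /hasP[[x s] xs /= /andP[/eqP xv _]].
by rewrite mem_cut_cycle -xv; apply/mapP; exists (x, s).
Qed.

Lemma cut_chord v s1 s2 : (label v, (s1, s2)) \in cut_list d ->
  chord (prev cut_cycle v) v (next cut_cycle v)
    [seq vset (face j) : {set map_of} | j <- s1]
    [seq vset (face j) : {set map_of} | j <- s2].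
Proof.
case/cut_entry_ok => sok [p1 p2] [n1 n2] _.
(* Matches the default [set0] in [chord] with the default index [nf] of the certificate, whose face
   is empty. *)
have vset0 : set0 = vset (face nf) :> {set map_of}.
  by apply/setP => x; rewrite mem_vset /face_at nth_default // inE.
have headE s : head (set0 : {set map_of}) [seq vset (face j) : {set map_of} | j
  <- s] =
    vset (face (head nf s)) by case: s => //=; rewrite vset0.
have lastE s : last (set0 : {set map_of}) [seq vset (face j) : {set map_of} | j
  <- s] =
    vset (face (last nf s)).
  by rewrite vset0 (last_map (fun j => vset (face j) : {set map_of})).
have sub j (u w : map_of) : consec (face j) (label u) (label w) ->
    [set u; w] \subset vset (face j).
  by case/consec_mem/andP => ui wi; apply/subsetP => x;
    rewrite !inE => /orP[]/eqP->.
rewrite /chord !headE !lastE !subsetI; split.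
- by rewrite -map_cat; apply: map_of_face_cycle.
- by rewrite ![[set _; v]]setUC !sub.
- by rewrite !sub.
Qed.

(** [s1] and [s2] are disjoint as parts of a duplicate-free list, so being in [s2] tells them apart;
    agreement along each edge of the cut is part of [check_cut]. *)
Lemma map_of_side_labelling : side_labelling cut_cycle side.
Proof.
split=> [v /cut_entry[s1 [s2 vs]]|F v /map_of_facesP[j jn ->] vc].
  exists [seq vset (face j) : {set map_of} | j <- s1],
         [seq vset (face j) : {set map_of} | j <- s2].
  have [sok _ _ _] := cut_entry_ok vs; have [_ sn] := star_okP sok.
  have : uniq (s1 ++ s2) by case/and5P: sok.
  rewrite cat_uniq => /and3P[_ /hasPn s12 _].
  split; [exact: cut_chord|apply/allP => _ /mapP[j js ->]..].
    rewrite sideE ?sn ?mem_cat ?js // (shiftN_entry _ vs).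
    by apply: contraL js => /s12.
  by rewrite sideE ?sn ?mem_cat ?js ?orbT // (shiftN_entry _ vs).
rewrite !mem_vset !sideE //;
  have [s1 [s2 /cut_entry_ok[_ _ _]]] := cut_entry vc.
by apply.
Qed.

Lemma map_of_divides : divides_face_cycles cut_cycle.
Proof.
by move=> v /cut_entry[s1 [s2 /cut_chord]]; eexists; eexists; eassumption.
Qed.

Lemma map_of_compat (e f g : {set map_of}) u v : e \in edges map_of ->
  f \in faces map_of -> g \in faces map_of -> e \subset f -> e \subset g ->
  u \in e -> v \in e -> (shift f u + shift g v = shift f v + shift g u)%N.
Proof.
case/map_of_edgeP => x [y [-> xy _]] /map_of_facesP[i in_ ->] /map_of_facesP[j
  jn ->].
rewrite !subUset !sub1set => /andP[xi yi] /andP[xj yj].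
have [_ _ sh] := edge_two (etrans (esym (adj_consec xi yi)) xy).
have ic : i \in common d (label x) (label y).
  by rewrite mem_common ?label_lt // -!mem_vset xi.
have jc : j \in common d (label x) (label y).
  by rewrite mem_common ?label_lt // -!mem_vset xj.
rewrite !inE !shiftE //.
by case/orP=> /eqP-> /orP[]/eqP-> //; [|symmetry]; apply: sh.
Qed.

(** Strong induction on the position of the face, with the earlier neighbour given by
    [check_dual]. *)
Lemma map_of_dual : @face_induction map_of
  (fun f g e => e \notin cycle_edges cut_cycle /\ {in e, shift f =1 shift g})
  (vset (face 0)).
Proof.
move=> Q Q0 Qstep F /map_of_facesP[j + ->]; elim/ltn_ind: j => -[//|j] IH jn.
have /allP/(_ j.+1) := dok_dual; rewrite mem_iota addnC.
rewrite (_ : _ < _ + 1 = true); last by lia.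
move=> /(_ isT)/hasP[i]; rewrite mem_rev mem_iota /= add0n => ij.
rewrite /link; have [_] := map_of_meet ij jn.
case E : [seq _ <- _ | _] => [|x [|y [|z s]]] //= /(_ x y erefl)[I xi yi xj yj].
case/and3P => xy /eqP sx /eqP sy.
have in_ := ltn_trans ij jn.
apply: (Qstep (vset (face i)) _ [set unlabel x; unlabel y]) (IH i ij in_).
- by apply/map_of_facesP; exists i.
- by apply/map_of_facesP; exists j.+1.
- have [+ _] := map_of_meet ij jn; rewrite I => -[I0|/eqP|//].
    by have := set21 (unlabel x) (unlabel y); rewrite I0 inE.
  have : uniq [:: x; y] by rewrite -E filter_uniq ?face_uniq.
  rewrite /= inE andbT => /negP x_y; rewrite cards2.
  case: (unlabel x =P unlabel y) => // /(congr1 label).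
  by rewrite !unlabelK ?(face_lt xi) ?(face_lt yi) // => /eqP/x_y.
- by rewrite -I subsetIl.
- by rewrite -I subsetIr.
split; last first.
  by move=> v; rewrite !inE => /orP[]/eqP->;
    rewrite !shiftE // unlabelK ?(face_lt xi) ?(face_lt yi).
(* An edge of the cycle has ends consecutive on the cut, which [link] forbids. *)
apply: contra xy => /imsetP[v vc /set2_eq E'].
have mem_c z : z \in cut_cycle -> consec (cut d) (label z) (label (next
  cut_cycle z)).
  by move=> zc; rewrite /consec -mem_cut_cycle zc label_next eqxx.
have := mem_c v vc; case: E' => -[<- <-];
  rewrite !unlabelK ?(face_lt xi) ?(face_lt yi) //.
by rewrite consec_sym ?cut_uniq.
Qed.

Lemma map_of_face0 : vset (face 0) \in faces map_of.
Proof. by apply/map_of_facesP; exists 0 => //; case/andP: dok_faces. Qed.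

Lemma map_of_is_map : is_map map_of.
Proof.
split.
- split; first by rewrite card_ord.
  apply: (face_induction_connect _ _ _ map_of_dual map_of_face0).
  + exact: map_of_polygon.
  + exact: map_of_edge_card.
  move=> v; have := star_star_ok v; case: (star (label v)) => [|j s] sok //.
  have [sE sn] := star_okP sok.
  exists (vset (face j)); last by rewrite mem_vset -sE inE eqxx.
  by apply/map_of_facesP; exists j => //; apply: sn; rewrite inE eqxx.
- by split; [exact: map_of_edge_card|exact: map_of_edge_faces].
- exact: map_of_polygon.
- by move=> v; eexists; apply: map_of_face_cycle (star_star_ok v).
move=> F G /map_of_facesP[i in_ ->] /map_of_facesP[j jn ->] ij.
have [lt|gt|E] := ltngtP i j; last by rewrite E eqxx in ij.
  by have [] := map_of_meet lt jn.
by have [] := map_of_meet gt in_; rewrite setIC.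
Qed.

Lemma map_of_semi_equivelar : semi_equivelar map_of X.
Proof.
split; [exact: map_of_is_map|by case/andP: dok|move=> v].
have /allP/(_ _ (label_vertices v))/andP[sok /eqP <-] := dok_stars.
exists [seq vset (face j) : {set map_of} | j <- star (label v)].
split; first exact: map_of_face_cycle.
by rewrite -map_comp; apply: eq_map => j /=; rewrite card_vset.
Qed.

Lemma map_of_euler : euler_char map_of = (- 2%:Z)%R.
Proof.
rewrite /euler_char card_ord !cardsE.
have fU : uniq (map vset (face_list d)).
  apply/(uniqP set0) => i j; rewrite !inE !size_map => in_ jn.
  by rewrite !(nth_map [::]) // => E; apply: vset_inj.
have eU : uniq (map pair_set (edge_list d)).
  rewrite map_inj_in_uniq ?undup_uniq // => p q pe qe.
  have [pl [i /consec_mem/andP[p1 p2]]] := edge_listP pe.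
  have [ql [j /consec_mem/andP[q1 q2]]] := edge_listP qe.
  case/set2_eq => -[/(congr1 label) + /(congr1 label)];
    rewrite !unlabelK ?(face_lt p1) ?(face_lt p2) ?(face_lt q1) ?(face_lt q2)
      // => E1 E2.
    by rewrite (surjective_pairing p) (surjective_pairing q) E1 E2.
  (* A crossed equality of ends contradicts that both pairs are increasing. *)
  by move: pl; rewrite E1 E2 ltnNge ltnW.
have -> : #|[pred e in map pair_set (edge_list d)]| = size (edge_list d).
  by rewrite (card_uniqP eU) size_map.
have -> : #|[pred e in map vset (face_list d)]| = size (face_list d).
  by rewrite (card_uniqP fU) size_map.
rewrite (eqP dok_euler) /nb_faces /nb_vertices; lia.
Qed.

Lemma map_of_nontrivial : nontrivial_cycle cut_cycle.
Proof.
apply: (nonseparating_nontrivial map_of_is_map).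
  rewrite /is_cycle cut_cycle_uniq size_map; have /and4P[-> _ _ _] := dok_cut.
  apply: (cycle_from_next cut_cycle_uniq) => v /cut_entry[s1 [s2]].
  by case/cut_entry_ok => _ _ [n1 _] _; apply/map_of_adjP; exists (last nf s1).
by apply: (face_induction_faces_connected _ map_of_face0 map_of_dual) => f g e
  [].
Qed.

(** Any vertex of the cut will do: the edge to its successor lies on the first face of [s2], on side
    B, and on the last face of [s1], on side A. *)
Lemma map_of_cross : exists (f1 g1 e1 : {set map_of}) u1,
  [/\ f1 \in faces map_of, g1 \in faces map_of, e1 \in edges map_of,
      e1 \subset f1 & e1 \subset g1] /\ [/\ u1 \in e1, shift f1 u1 & ~~ shift
        g1 u1].
Proof.
have /and4P[c3 _ _ _] := dok_cut.
have [v vc] : exists v, v \in cut_cycle.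
  have : 2 < size cut_cycle by rewrite size_map.
  by case: cut_cycle => [//|v s] _; exists v; rewrite inE eqxx.
have [s1 [s2 vs]] := cut_entry vc.
have [sok _ [n1 n2] _] := cut_entry_ok vs.
have [_ sn] := star_okP sok.
have s1n : s1 != [::].
  by case: s1 n1 {vs sok sn} => //= /consec_mem/andP[/mem_face_lt];
    rewrite ltnn.
have s2n : s2 != [::].
  by case: s2 n2 {vs sok sn} => //= /consec_mem/andP[/mem_face_lt];
    rewrite ltnn.
have l1 : last nf s1 \in s1 by case: s1 s1n {n1 vs sok sn} => //= j s _;
  apply: mem_last.
have h2 : head nf s2 \in s2 by case: s2 s2n {n2 vs sok sn} => //= j s _;
  rewrite inE eqxx.
have : uniq (s1 ++ s2) by case/and5P: sok.
rewrite cat_uniq => /and3P[_ /hasPn s12 _].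
have i1 := mem_face_lt (andP (consec_mem n1)).1.
have i2 := mem_face_lt (andP (consec_mem n2)).1.
exists (vset (face (head nf s2))), (vset (face (last nf s1))), [set v;
  next cut_cycle v], v.
split; split.
- by apply/map_of_facesP; exists (head nf s2).
- by apply/map_of_facesP; exists (last nf s1).
- by apply/map_of_adjP; exists (head nf s2).
- by case/consec_mem/andP: n2 => vi wi; apply/subsetP => x;
  rewrite !inE => /orP[]/eqP->.
- by case/consec_mem/andP: n1 => vi wi; apply/subsetP => x;
  rewrite !inE => /orP[]/eqP->.
- exact: set21.
- by rewrite shiftE // (shiftN_entry _ vs).
by rewrite shiftE // (shiftN_entry _ vs); apply: contraL l1 => /s12.
Qed.


(** * Flags and words of a certificate *)

Definition encode (p : flag map_of) : N * N * nat :=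
  (label p.1.1, label p.1.2, find (fun f => vset f == p.2) (face_list d)).

Definition decode (q : N * N * nat) : flag map_of :=
  (unlabel q.1.1, unlabel q.1.2, vset (face q.2)).

Definition flagN (q : N * N * nat) : bool := consec (face q.2) q.1.1 q.1.2.

Lemma find_vset j : j < nf ->
  find (fun f => vset f == vset (face j)) (face_list d) = j.
Proof.
move=> jn; have fh : has (fun f => vset f == vset (face j)) (face_list d).
  by apply/hasP; exists (face j); rewrite ?eqxx // mem_nth.
apply: vset_inj => //; first by rewrite -has_find.
exact/eqP/(nth_find [::] fh).
Qed.

Lemma encodeK q : flagN q -> encode (decode q) = q.
Proof.
case: q => [[x y] j] /consec_mem/andP[/= xj yj].
rewrite /encode /decode /= find_vset ?(mem_face_lt xj) //.
by rewrite !unlabelK ?(face_lt xj) ?(face_lt yj).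
Qed.

Lemma encode_flagN p : is_flag p -> flagN (encode p).
Proof.
case: p => [[u v] F] /and4P[/= uv /map_of_facesP[j jn ->] uj vj].
by rewrite /flagN /encode /= find_vset // -adj_consec.
Qed.

Lemma decodeK p : is_flag p -> decode (encode p) = p.
Proof.
case: p => [[u v] F] /and4P[/= _ /map_of_facesP[j jn ->] _ _].
by rewrite /decode /encode /= find_vset // !labelK.
Qed.

Lemma decode_is_flag q : flagN q -> is_flag (decode q).
Proof.
case: q => [[x y] j] H; have /andP[/= xj yj] := consec_mem H.
have xv := vset_unlabel xj; have yv := vset_unlabel yj.
apply/and4P; split=> //=; last by apply/map_of_facesP; exists j;
  rewrite ?(mem_face_lt xj).
by rewrite (adj_consec xv yv) !unlabelK ?(face_lt xj) ?(face_lt yj).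
Qed.

Lemma stepN_flagN k q : flagN q -> flagN (stepN d k q) /\
  (1 < k -> (stepN d k q).2 != q.2).
Proof.
case: q => [[x y] j] H; have /andP[/= xj yj] := consec_mem H.
case: k => [|[|k]] /=; rewrite /flagN /=; first by rewrite face_consec_sym.
  by rewrite /consec xj; case: ifP; rewrite eqxx ?orbT.
have [s2 cons _] := edge_two H; set s := [seq i <- _ | _].
have : head j s \in s.
  (* Two distinct faces contain the edge, so one is left after removing [j] and [head] does not fall
     back on its default. *)
  have : s != [::].
    apply/eqP => s0; have := common_uniq y (face_lt xj).
    have : {subset common d x y <= [:: j]}.
      by move=> i ic; have := mem_filter (predC1 j) i (common d x y);
        rewrite -/s s0 ic andbT /= inE => /esym/negbFE.
    by move=> sub /uniq_leq_size/(_ sub); rewrite s2.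
  by case: s => //= i t _; rewrite inE eqxx.
by rewrite mem_filter => /andP[ij ic]; split=> //; apply: cons.
Qed.

Definition step (k : nat) (p : flag map_of) : flag map_of :=
  decode (stepN d k (encode p)).

Lemma stepN_rel k q : flagN q -> flag_rel k (decode q) (decode (stepN d k q)).
Proof.
case: q => [[x y] j] H; have [sN s2] := stepN_flagN k H.
split; [exact: decode_is_flag|exact: decode_is_flag|].
have /andP[/= xj yj] := consec_mem H; case: k sN s2 => [|[|k]] //= sN s2.
  split=> //; apply/eqP => /(congr1 label) E.
  have /andP[_ zj] := consec_mem sN; move: E;
    rewrite !unlabelK ?(face_lt zj) ?(face_lt yj) //=.
  case: eqP => [E1 E2|nE E2].
    by have := face_prev_next_neq xj; rewrite E1 E2 eqxx.
  by rewrite E2 in nE.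
split=> //; apply/eqP => E; have /andP[/mem_face_lt zn _] := consec_mem sN.
have /eqP := s2 isT; apply; apply: vset_inj => //.
exact: mem_face_lt xj.
Qed.

Lemma stepP k p : is_flag p -> flag_rel k p (step k p).
Proof.
by move=> pK; rewrite -{1}(decodeK pK); apply: stepN_rel; apply: encode_flagN.
Qed.

Local Notation up := (@up map_of cut_cycle side step).
Local Notation down := (@down map_of cut_cycle side step).

(** Ties evaluation to the theory: the accumulators of [walk] grow by the two halves of the crossing
    number. *)
Lemma walkE w p a b : is_flag p ->
  walk d w (encode p) a b = (encode (run step w p), a + up w p, b + down w p).
Proof.
elim: w p a b => [|k w IHw] p a b pK; first by rewrite /= !addn0.
have [_ qK _] := stepP k pK.
have qN := encode_flagN pK; have [sN _] := stepN_flagN k qN.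
have sE : encode (step k p) = stepN d k (encode p) by rewrite encodeK.
have pn : (encode p).2 < nf by have /andP[/mem_face_lt] := consec_mem qN.
have sn : (stepN d k (encode p)).2 < nf by have /andP[/mem_face_lt] :=
  consec_mem sN.
have -> : walk d (k :: w) (encode p) a b =
    if 1 < k then walk d w (stepN d k (encode p))
        (a + shiftN d (encode p).2 (encode p).1.1)
        (b + shiftN d (stepN d k (encode p)).2 (encode p).1.1)
      else walk d w (stepN d k (encode p)) a b.
  by case: k {sE sn qK sN} => [|[|k]].
have up_k : step_up cut_cycle side k p =
    (if 1 < k then shiftN d (encode p).2 (encode p).1.1 : nat else 0).
  by case: k {sE sn qK sN} => [|[|k]] //=; rewrite -{1}(decodeK pK) /= shiftE.
have down_k : step_down cut_cycle side step k p =
    (if 1 < k then shiftN d (stepN d k (encode p)).2 (encode p).1.1 : nat else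
      0).
  by case: k {sE qK sN up_k} sn => [|[|k]] // sn; rewrite /step_down shiftE.
rewrite -sE !IHw //= up_k down_k !addnA -sE; case: ifP => _ //.
by rewrite !addn0.
Qed.

Lemma flagN_flagsN q : flagN q -> q \in flagsN d.
Proof.
case: q => [[x y] j] H; have /andP[/= xj yj] := consec_mem H.
apply/flatten_mapP; exists j; first by rewrite mem_iota (mem_face_lt xj).
apply/flatten_mapP; exists x => //.
by case/andP: H => _ /orP[]/eqP /= <-; rewrite !inE eqxx ?orbT.
Qed.

Let p0 := decode (base_flag d).

Lemma base_flagN : flagN (base_flag d).
Proof. by case/and3P: dok_words => /andP[]. Qed.

Lemma base_is_flag : is_flag p0.
Proof. exact: decode_is_flag base_flagN. Qed.

Lemma base_loops w : w \in word_list d -> run step w p0 = p0 /\ up w p0 = down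
  w p0.
Proof.
have /and3P[_ /allP H _] := dok_words; move=> /H.
have := walkE w 0 0 base_is_flag; rewrite encodeK ?base_flagN // => ->.
case/andP => /eqP rE /eqP; split=> //.
have rK := run_is_flag stepP w base_is_flag.
by rewrite -(decodeK rK) rE.
Qed.

Lemma escapesN_escapes p w : is_flag p -> escapesN d (encode p) w ->
  escapes cut_cycle side step w p.
Proof.
move=> pK; rewrite /escapesN walkE // !add0n => /or3P[rp|/eqP E|/eqP E].
- by left=> E; rewrite E eqxx in rp.
- by right; left.
by right; right.
Qed.

Lemma flag_dichotomy p : is_flag p -> p <> p0 ->
  has_symmetry d && reflectedN d (base_flag d) (encode p) \/
  exists2 w, w \in word_list d & escapes cut_cycle side step w p.
Proof.
move=> pK pp0; have /and3P[_ _ /allP/(_ _ (flagN_flagsN (encode_flagN pK)))] :=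
  dok_words.
case/or3P => [/eqP E|H|/hasP[w wW H]]; last 1 first.
- by right; exists w => //; apply: escapesN_escapes.
- by case: pp0; rewrite -(decodeK pK) E.
by left.
Qed.

(** * The involution that reverses the sheets *)

Definition alpha (v : map_of) : map_of := unlabel (sym d (label v)).
Definition alpha_height (v : map_of) : nat := height d (label v).

Section Symmetric.

Hypothesis sym_d : has_symmetry d.

Lemma sym_ok v : [/\ sym d (label v) < nb_vertices d, sym d (sym d (label v)) =
  label v
  & height d (sym d (label v)) = height d (label v)].
Proof.
have := dok_symmetry; rewrite /check_symmetry sym_d => /and3P[_ /allP H _].
by have /and3P[? /eqP ? /eqP ?] := H _ (label_vertices v).
Qed.

Lemma label_alpha v : label (alpha v) = sym d (label v).
Proof. by have [lt _ _] := sym_ok v; rewrite unlabelK. Qed.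

Lemma alphaK : involutive alpha.
Proof.
by move=> v; apply: label_inj; rewrite !label_alpha; have [] := sym_ok v.
Qed.

Lemma alpha_heightK v : alpha_height (alpha v) = alpha_height v.
Proof. by rewrite /alpha_height label_alpha; have [] := sym_ok v. Qed.

(** The image of face [i] lies in face [j] and has its size, hence equals it; [n] is the value found
    constant on the face by [check_symmetry]. *)
Lemma alpha_face_index i : i < nf -> exists2 j, alpha @: vset (face i) = vset
  (face j) &
  [/\ j < nf, forall u, u \in face i -> consec (face j) (sym d u) (sym d (next
    (face i) u)) &
    exists n, forall v, label v \in face i ->
      alpha_height v = n + shiftN d i (label v) + shiftN d j (sym d (label v))].
Proof.
move=> in_; have := dok_symmetry;
  rewrite /check_symmetry sym_d => /and3P[_ _ /allP/(_ i)].
rewrite mem_iota in_ => /(_ isT)/hasP[j _ /and4P[/eqP sz /allP cons hconst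
  /allP hge]].
have aj v : label v \in face i -> label (alpha v) \in face j.
  by move=> /cons/consec_mem/andP[+ _]; rewrite label_alpha.
have jn : j < nf.
  have [f3 _ _] := face_ok in_; case E : (face i) f3 => [//|x s] _.
  have xi : x \in face i by rewrite E inE eqxx.
  by have /andP[/mem_face_lt] := consec_mem (cons x xi).
exists j.
  apply/eqP; rewrite eqEcard card_imset; last exact: (can_inj alphaK).
  rewrite !card_vset sz leqnn andbT; apply/subsetP => _ /imsetP[v vi ->].
  by rewrite mem_vset aj // -mem_vset.
split=> //.
pose g v := height d v - shiftN d i v - shiftN d j (sym d v).
exists (g (head 0%num (face i))) => v vi.
have -> : g (head 0%num (face i)) = g (label v).
  move: hconst vi; rewrite -/g; case: (face i) => [//|x s] /= /allP H.
  rewrite inE => /orP[/eqP->//|vs]; apply/esym/eqP.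
  by have := H _ (map_f g vs).
by rewrite /g /alpha_height; have := hge _ vi; lia.
Qed.

Lemma alpha_edge e : e \in edges map_of -> alpha @: e \in edges map_of.
Proof.
case/map_of_edgeP => u [v [-> /map_of_adjP[i H] _]].
have /andP[ui vi] := consec_mem H.
have [j _ [_ cons _]] := alpha_face_index (mem_face_lt ui).
rewrite imsetU1 imset_set1; apply/map_of_adjP; exists j; rewrite !label_alpha.
case/andP: H => _ /orP[]/eqP<-; first exact: cons.
rewrite face_consec_sym -{2}(next_prev (face_uniq i) (label u)).
by apply: cons; rewrite mem_prev.
Qed.

Lemma alpha_face f : f \in faces map_of -> alpha @: f \in faces map_of /\
  exists n, forall v, v \in f ->
    alpha_height v = n + shift f v + shift (alpha @: f) (alpha v).
Proof.
case/map_of_facesP => i in_ ->;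
  have [j -> [jn _ [n hE]]] := alpha_face_index in_.
split; first by apply/map_of_facesP; exists j.
exists n => v; rewrite mem_vset => /hE ->.
by rewrite !shiftE // label_alpha.
Qed.

Lemma reflect_base_neq : reflect_flag alpha p0 <> p0.
Proof.
have /andP[x0 _] := consec_mem base_flagN.
have := dok_symmetry; rewrite /check_symmetry sym_d => /and3P[/eqP E _ _].
move/(congr1 (fun p : flag map_of => label p.1.1)); rewrite /= label_alpha.
by rewrite unlabelK ?(face_lt x0).
Qed.

(** The face of [p] contains the reflected base face, which has at least three vertices; distinct
    faces share at most two, so the two are equal. *)
Lemma reflectedN_reflect p : is_flag p -> reflectedN d (base_flag d) (encode p)
  ->
  p = reflect_flag alpha p0.
Proof.
move=> pK; rewrite -{2}(decodeK pK); have pN := encode_flagN pK.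
have := base_flagN; rewrite /p0;
  move: (base_flag d) (encode p) pN => [[x y] i] [[z t] k].
move=> zt xy /and3P[/= /eqP xz /eqP yt /allP sub].
have /andP[/= xi yi] := consec_mem xy; have /andP[/= zk tk] := consec_mem zt.
have labx w : w \in face i -> alpha (unlabel w) = unlabel (sym d w).
  by move=> wi; rewrite /alpha unlabelK ?(face_lt wi).
rewrite /decode /reflect_flag /= !labx // xz yt; congr (_, _).
have [j E [jn _ _]] := alpha_face_index (mem_face_lt xi); rewrite E.
congr (vset (face _)); apply/eqP/negPn/negP => kj.
have [f3 _ _] := face_ok jn; have := card_vset j; rewrite -E.
have jk : vset (face j) \subset vset (face k).
  rewrite -E; apply/subsetP => _ /imsetP[v vi ->]; rewrite mem_vset label_alpha.
  by apply: sub; rewrite -mem_vset.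
move=> _; have kn := mem_face_lt zk.
have jkF : vset (face j) != vset (face k).
  by apply: contra kj => /eqP/(vset_inj jn kn)->.
have [_ _ _ _] := map_of_is_map; move=> /(_ (vset (face j)) (vset (face k))).
have /setIidPl -> := jk; rewrite -card_vset in f3.
case=> //; [by apply/map_of_facesP; exists j|by apply/map_of_facesP;
  exists k|..].
- by move=> E0; rewrite E0 cards0 in f3.
- by move=> E1; rewrite E1 in f3.
by move/map_of_edge_card => E2; rewrite E2 in f3.
Qed.

End Symmetric.

(** * The covering of a certified map *)

Theorem data_realizes m : 1 < m -> exists K Km : cell_complex,
  [/\ semi_equivelar K X /\ euler_char K = (- 2%:Z)%R,
      covering_map m K Km,
      semi_equivelar Km X,
      euler_char Km = (- (2 * m)%:Z)%R
    & (Aut_map Km \isog 'D_((2 * m)%N)) \/ (Aut_map Km \isog Zp m)].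
Proof.
case: m => [|[|m]] // _; exists map_of, (covering m.+2 cut_cycle side).
have mapK := map_of_is_map; have compat := map_of_compat.
have [f1 [g1 [e1 [u1 cross]]]] := map_of_cross.
have conn := covering_connected mapK compat map_of_face0 map_of_dual cross.
have ind := covering_face_induction mapK compat map_of_dual cross.
have mapL := covering_is_map mapK compat (@conn m).
split.
- by split; [exact: map_of_semi_equivelar|exact: map_of_euler].
- exists cut_cycle, side; split=> //; first exact: map_of_nontrivial.
    exact: map_of_divides.
  exact: map_of_side_labelling.
- by apply: (covering_semi_equivelar mapK compat (X := X));
  [exact: conn|exact: map_of_semi_equivelar].
- exact: covering_euler mapK compat map_of_euler.
(* Rigidity is applied at the base flag, so the induction over lifted faces is moved from face 0 to
   the face of that flag. *)
have indL : @face_induction (covering m.+2 cut_cycle side) (fun _ _ _ => True)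
    (lift_set cut_cycle side 0%R p0.2 p0.2).
  apply: (face_induction_base _ _ (ind m)); apply/covering_facesP.
    by exists 0%R, (vset (face 0)); split; first exact: map_of_face0.
  exists 0%R, p0.2; split=> //; by case/and4P: base_is_flag.
have [sym_d|nsym] := boolP (has_symmetry d).
  left; apply: (covering_aut_dihedral mapK compat mapL stepP base_is_flag
    base_loops indL (alphaK sym_d) (alpha_heightK sym_d) (alpha_edge sym_d)
    (alpha_face sym_d) (reflect_base_neq sym_d)) => p pK p_p0 p_p1.
  have [/andP[_ /(reflectedN_reflect sym_d pK)]|//] := flag_dichotomy pK p_p0.
  by move/p_p1.
right; apply: (covering_aut_Zp mapK compat mapL stepP base_is_flag base_loops
  indL).
move=> p pK p_p0; have [|//] := flag_dichotomy pK p_p0.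
by rewrite (negPf nsym).
Qed.

End MapOfData.

(** * Certificates for the types *)

(** In the names, [e] precedes an exponent. The number [V] of vertices is forced by the type: with
    [k] faces at each vertex and [S] the sum of the reciprocals of their sizes,
    [V (1 - k/2 + S) = -2]. This gives 12 here and 168 for [data_4_6_14], the labels starting at
    0. *)
Definition data_3e7 :=
  MapData 11 ([:: [:: 0; 1; 2]; [:: 3; 1; 0]; [:: 3; 0; 4]; [:: 3; 4; 2];
  [:: 5; 2; 4]; [:: 5; 4; 1]; [:: 5; 1; 3]; [:: 6; 5; 3]; [:: 6; 3; 7]; [:: 7;
  3; 2]; [:: 7; 2; 0]; [:: 8; 0; 7]; [:: 8; 7; 9]; [:: 9; 10; 7]; [:: 6; 7;
  10]; [:: 8; 9; 6]; [:: 8; 6; 5]; [:: 8; 11; 5]; [:: 11; 2; 5]; [:: 11; 1; 2];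
  [:: 9; 11; 1]; [:: 9; 1; 4]; [:: 9; 4; 10]; [:: 10; 4; 0]; [:: 8; 10; 0];
  [:: 8; 11; 10]; [:: 6; 10; 11]; [:: 6; 11; 9]])%num [:: [:: 0; 1; 2; 23; 24;
  11; 10]; [:: 0; 19; 20; 21; 5; 6; 1]; [:: 0; 10; 9; 3; 4; 18; 19]; [:: 3; 2;
  1; 6; 7; 8; 9]; [:: 3; 4; 5; 21; 22; 23; 2]; [:: 6; 5; 4; 18; 17; 16; 7];
  [:: 27; 26; 14; 8; 7; 16; 15]; [:: 10; 9; 8; 14; 13; 12; 11]; [:: 16; 15; 12;
  11; 24; 25; 17]; [:: 13; 22; 21; 20; 27; 15; 12]; [:: 23; 22; 13; 14; 26; 25;
  24]; [:: 18; 19; 20; 27; 26; 25; 17]] [:: (6%num, ([:: 14; 8; 7; 16; 15],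
  [:: 27; 26])); (9%num, ([:: 15; 12; 13], [:: 22; 21; 20; 27]));
  (10%num, ([:: 13; 14], [:: 26; 25; 24; 23; 22]))] [:: [:: 1; 2; 1; 0; 2; 1;
  2; 1; 2; 0; 1; 2; 1; 2; 0]; [:: 1; 0; 2; 1; 2; 1; 0; 2; 1; 2; 0; 1; 2; 0; 1;
  2]] (3%num, 0%num, 2) [::].

Definition data_3e5_4 :=
  MapData 23 ([:: [:: 0; 1; 2]; [:: 0; 3; 1]; [:: 4; 3; 1; 5]; [:: 4; 6; 5];
  [:: 6; 5; 7]; [:: 6; 7; 8]; [:: 8; 7; 0]; [:: 9; 0; 7]; [:: 9; 3; 0]; [:: 10;
  9; 3]; [:: 10; 3; 2]; [:: 8; 0; 2; 10]; [:: 11; 8; 10]; [:: 11; 10; 12];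
  [:: 12; 10; 9]; [:: 12; 9; 13]; [:: 12; 13; 14]; [:: 14; 13; 15]; [:: 14; 15;
  16]; [:: 15; 16; 4]; [:: 16; 2; 4]; [:: 4; 2; 3]; [:: 16; 1; 2]; [:: 17; 1;
  16]; [:: 17; 5; 1]; [:: 18; 17; 5]; [:: 18; 5; 7]; [:: 13; 9; 7; 18]; [:: 19;
  13; 18]; [:: 19; 18; 20]; [:: 20; 17; 18]; [:: 21; 20; 17]; [:: 21; 11; 20];
  [:: 22; 21; 11]; [:: 22; 11; 8]; [:: 22; 8; 6]; [:: 19; 22; 6; 15]; [:: 15;
  4; 6]; [:: 19; 23; 22]; [:: 23; 22; 21]; [:: 23; 21; 14]; [:: 23; 14; 12];
  [:: 23; 12; 11; 20]; [:: 19; 20; 23]; [:: 21; 17; 16; 14]; [:: 19; 13;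
  15]])%num [:: [:: 0; 1; 8; 7; 6; 11]; [:: 1; 0; 22; 23; 24; 2]; [:: 10; 21;
  20; 22; 0; 11]; [:: 21; 10; 9; 8; 1; 2]; [:: 3; 37; 19; 20; 21; 2]; [:: 3; 4;
  26; 25; 24; 2]; [:: 35; 5; 4; 3; 37; 36]; [:: 26; 4; 5; 6; 7; 27]; [:: 6; 5;
  35; 34; 12; 11]; [:: 7; 8; 9; 14; 15; 27]; [:: 10; 9; 14; 13; 12; 11];
  [:: 13; 12; 34; 33; 32; 42]; [:: 41; 16; 15; 14; 13; 42]; [:: 15; 16; 17; 45;
  28; 27]; [:: 18; 17; 16; 41; 40; 44]; [:: 37; 19; 18; 17; 45; 36]; [:: 18;
  19; 20; 22; 23; 44]; [:: 23; 24; 25; 30; 31; 44]; [:: 26; 25; 30; 29; 28;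
  27]; [:: 38; 43; 29; 28; 45; 36]; [:: 43; 29; 30; 31; 32; 42]; [:: 31; 32;
  33; 39; 40; 44]; [:: 35; 34; 33; 39; 38; 36]; [:: 41; 40; 39; 38; 43; 42]]
  [:: (0%num, ([:: 0; 1], [:: 8; 7; 6; 11])); (3%num, ([:: 1; 2; 21], [:: 10;
  9; 8])); (2%num, ([:: 21; 20; 22; 0], [:: 11; 10]))] [:: [:: 2; 0; 1; 2; 1;
  2; 0; 1; 2; 1; 2; 0; 1; 2; 1; 0; 1]] (12%num, 23%num, 42) [::].

(** The last field is nonempty here and in [data_3e2_4_3_6], [data_3_4e4], [data_4_6_20],
    [data_4_8_12] and [data_6_8e2]: the six dihedral cases. *)
Definition data_3e4_4e2 :=
  MapData 11 ([:: [:: 0; 1; 2]; [:: 0; 3; 1]; [:: 4; 3; 0]; [:: 4; 2; 3];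
  [:: 5; 4; 2]; [:: 5; 2; 0]; [:: 6; 0; 5; 7]; [:: 6; 8; 7]; [:: 8; 7; 9];
  [:: 7; 9; 1]; [:: 7; 1; 3]; [:: 7; 3; 10; 5]; [:: 10; 11; 5]; [:: 11; 5; 4];
  [:: 9; 1; 11; 4]; [:: 8; 11; 1; 2]; [:: 6; 11; 8]; [:: 6; 10; 11]; [:: 6; 9;
  10]; [:: 8; 9; 10]; [:: 8; 10; 3; 2]; [:: 6; 0; 4; 9]])%num [:: [:: 5; 0; 1;
  2; 21; 6]; [:: 9; 10; 1; 0; 15; 14]; [:: 0; 5; 4; 3; 20; 15]; [:: 3; 2; 1;
  10; 11; 20]; [:: 2; 3; 4; 13; 14; 21]; [:: 5; 4; 13; 12; 11; 6]; [:: 7; 16;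
  17; 18; 21; 6]; [:: 10; 9; 8; 7; 6; 11]; [:: 19; 8; 7; 16; 15; 20]; [:: 18;
  19; 8; 9; 14; 21]; [:: 12; 17; 18; 19; 20; 11]; [:: 13; 12; 17; 16; 15; 14]]
  [:: (1%num, ([:: 15; 14; 9; 10], [:: 1; 0])); (3%num, ([:: 10; 11; 20],
  [:: 3; 2; 1])); (2%num, ([:: 20; 15], [:: 0; 5; 4; 3]))] [:: [:: 2; 1; 2; 0;
  1; 2; 0; 1; 0; 1; 2; 1; 2; 1; 2; 0; 1]; [:: 1; 2; 1; 2; 1; 2; 0; 1; 2; 1; 2;
  0; 1; 2; 1; 0]] (9%num, 7%num, 8) [:: (2%num, 1); (5%num, 1); (0%num, 1);
  (4%num, 1); (3%num, 1); (1%num, 1); (8%num, 1); (11%num, 1); (6%num, 1);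
  (10%num, 1); (9%num, 1); (7%num, 1)].

Definition data_3e3_4_3_4 :=
  MapData 11 ([:: [:: 0; 1; 2]; [:: 3; 0; 1]; [:: 4; 3; 0]; [:: 5; 3; 4];
  [:: 5; 4; 2]; [:: 5; 2; 1]; [:: 5; 1; 6; 7]; [:: 8; 6; 1]; [:: 8; 9; 3; 1];
  [:: 3; 9; 10]; [:: 9; 10; 6]; [:: 9; 6; 2]; [:: 8; 4; 2; 6]; [:: 7; 8; 4];
  [:: 7; 4; 0; 10]; [:: 11; 0; 10]; [:: 11; 9; 2; 0]; [:: 11; 8; 9]; [:: 7; 11;
  8]; [:: 5; 7; 11]; [:: 5; 3; 10; 11]; [:: 7; 10; 6]])%num [:: [:: 0; 1; 2;
  14; 15; 16]; [:: 1; 0; 5; 6; 7; 8]; [:: 4; 5; 0; 16; 11; 12]; [:: 1; 2; 3;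
  20; 9; 8]; [:: 2; 3; 4; 12; 13; 14]; [:: 5; 4; 3; 20; 19; 6]; [:: 21; 10; 11;
  12; 7; 6]; [:: 13; 18; 19; 6; 21; 14]; [:: 13; 18; 17; 8; 7; 12]; [:: 11; 10;
  9; 8; 17; 16]; [:: 9; 10; 21; 14; 15; 20]; [:: 17; 18; 19; 20; 15; 16]]
  [:: (8%num, ([:: 18; 17; 8; 7], [:: 12; 13])); (6%num, ([:: 7; 6], [:: 21;
  10; 11; 12])); (7%num, ([:: 6; 19; 18], [:: 13; 14; 21]))] [:: [:: 0; 1; 2;
  1; 0; 2; 1; 0; 2; 1; 0; 1; 2; 0; 1; 2; 1]] (3%num, 0%num, 2) [::].

Definition data_3e5_5 :=
  MapData 14 ([:: [:: 0; 1; 2]; [:: 0; 3; 1]; [:: 4; 0; 3]; [:: 4; 3; 2];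
  [:: 5; 3; 2]; [:: 5; 2; 0]; [:: 6; 7; 8; 0; 5]; [:: 8; 4; 0]; [:: 9; 4; 8];
  [:: 9; 8; 1]; [:: 10; 8; 1]; [:: 10; 1; 2]; [:: 11; 12; 4; 2; 10]; [:: 9; 12;
  4]; [:: 6; 9; 12]; [:: 6; 12; 7]; [:: 12; 7; 13]; [:: 14; 7; 13]; [:: 14; 13;
  3; 1; 9]; [:: 13; 5; 3]; [:: 11; 13; 5]; [:: 11; 5; 6]; [:: 11; 6; 14];
  [:: 11; 14; 10]; [:: 14; 10; 7]; [:: 7; 10; 8]; [:: 11; 12; 13]; [:: 14; 6;
  9]])%num [:: [:: 5; 0; 1; 2; 7; 6]; [:: 1; 0; 11; 10; 9; 18]; [:: 11; 0; 5;
  4; 3; 12]; [:: 19; 4; 3; 2; 1; 18]; [:: 3; 2; 7; 8; 13; 12]; [:: 5; 4; 19;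
  20; 21; 6]; [:: 15; 14; 27; 22; 21; 6]; [:: 25; 24; 17; 16; 15; 6]; [:: 7; 8;
  9; 10; 25; 6]; [:: 9; 8; 13; 14; 27; 18]; [:: 11; 10; 25; 24; 23; 12];
  [:: 23; 22; 21; 20; 26; 12]; [:: 26; 16; 15; 14; 13; 12]; [:: 19; 20; 26; 16;
  17; 18]; [:: 27; 22; 23; 24; 17; 18]] [:: (6%num, ([:: 22; 21; 6], [:: 15;
  14; 27])); (7%num, ([:: 6; 25; 24], [:: 17; 16; 15])); (14%num, ([:: 24; 23;
  22], [:: 27; 18; 17]))] [:: [:: 2; 1; 0; 2; 1; 2; 1; 0; 2; 1; 2; 1; 2; 1; 2;
  0; 1; 0; 1; 2; 0; 1; 0]] (9%num, 4%num, 13) [::].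

Definition data_3e4_7 :=
  MapData 83 ([:: [:: 0; 1; 2]; [:: 3; 0; 1]; [:: 4; 3; 0]; [:: 5; 4; 3];
  [:: 6; 5; 4]; [:: 7; 5; 6]; [:: 8; 7; 5]; [:: 9; 7; 8]; [:: 10; 9; 7];
  [:: 11; 10; 9]; [:: 12; 11; 10]; [:: 13; 11; 12]; [:: 13; 2; 11]; [:: 14; 13;
  2]; [:: 14; 2; 0]; [:: 15; 4; 0; 14; 16; 17; 18]; [:: 16; 19; 14]; [:: 19;
  14; 13]; [:: 20; 12; 13; 19; 21; 22; 23]; [:: 24; 19; 21]; [:: 24; 21; 25];
  [:: 21; 25; 26]; [:: 26; 25; 8]; [:: 25; 8; 9]; [:: 27; 1; 2; 11; 9; 25; 24];
  [:: 27; 16; 24]; [:: 16; 24; 19]; [:: 17; 27; 16]; [:: 17; 28; 27]; [:: 28;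
  27; 1]; [:: 28; 1; 3]; [:: 29; 26; 8; 5; 3; 28; 30]; [:: 30; 17; 28]; [:: 18;
  30; 17]; [:: 31; 30; 18]; [:: 31; 18; 32]; [:: 32; 18; 15]; [:: 32; 15; 33];
  [:: 33; 15; 6]; [:: 15; 6; 4]; [:: 34; 33; 6; 7; 10; 35; 36]; [:: 35; 12;
  10]; [:: 20; 35; 12]; [:: 37; 20; 35]; [:: 38; 20; 37]; [:: 38; 23; 20];
  [:: 39; 38; 23]; [:: 39; 23; 40]; [:: 23; 40; 22]; [:: 40; 22; 29]; [:: 22;
  29; 26]; [:: 22; 26; 21]; [:: 40; 29; 31]; [:: 29; 31; 30]; [:: 41; 42; 39;
  40; 31; 32; 43]; [:: 42; 44; 39]; [:: 44; 39; 38]; [:: 45; 46; 37; 38; 44;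
  47; 48]; [:: 47; 49; 44]; [:: 49; 44; 42]; [:: 50; 42; 49]; [:: 50; 41; 42];
  [:: 51; 50; 41]; [:: 51; 41; 52]; [:: 41; 52; 43]; [:: 52; 43; 34]; [:: 43;
  34; 33]; [:: 43; 33; 32]; [:: 52; 34; 53]; [:: 34; 53; 36]; [:: 53; 36; 46];
  [:: 46; 36; 37]; [:: 36; 37; 35]; [:: 53; 46; 54]; [:: 54; 46; 45]; [:: 55;
  45; 54]; [:: 55; 54; 56]; [:: 56; 54; 53; 52; 51; 57; 58]; [:: 57; 59; 51];
  [:: 59; 51; 50]; [:: 60; 61; 62; 63; 49; 50; 59]; [:: 63; 47; 49]; [:: 64;
  47; 63]; [:: 48; 64; 47]; [:: 65; 48; 64]; [:: 65; 66; 48]; [:: 66; 48; 45];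
  [:: 66; 45; 55]; [:: 67; 55; 66; 68; 69; 70; 71]; [:: 68; 65; 66]; [:: 72;
  68; 65]; [:: 72; 73; 68]; [:: 73; 68; 69]; [:: 74; 72; 73]; [:: 75; 74; 72];
  [:: 75; 71; 74]; [:: 71; 74; 76]; [:: 71; 76; 70]; [:: 67; 75; 71]; [:: 67;
  77; 75]; [:: 67; 56; 77]; [:: 56; 77; 58]; [:: 77; 58; 78]; [:: 58; 78; 79];
  [:: 78; 79; 80]; [:: 78; 80; 81]; [:: 80; 62; 81]; [:: 62; 81; 63]; [:: 81;
  63; 64]; [:: 75; 72; 65; 64; 81; 78; 77]; [:: 82; 62; 80]; [:: 61; 82; 62];
  [:: 69; 61; 82]; [:: 70; 61; 69]; [:: 60; 70; 61]; [:: 76; 60; 70]; [:: 83;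
  60; 76]; [:: 83; 59; 60]; [:: 57; 83; 59]; [:: 79; 57; 83]; [:: 58; 79; 57];
  [:: 74; 76; 83; 79; 80; 82; 73]; [:: 73; 69; 82]; [:: 67; 55; 56]])%num
  [:: [:: 14; 0; 1; 2; 15]; [:: 29; 30; 1; 0; 24]; [:: 0; 14; 13; 12; 24];
  [:: 30; 1; 2; 3; 31]; [:: 2; 3; 4; 39; 15]; [:: 3; 4; 5; 6; 31]; [:: 38; 39;
  4; 5; 40]; [:: 5; 6; 7; 8; 40]; [:: 6; 7; 23; 22; 31]; [:: 23; 7; 8; 9; 24];
  [:: 8; 9; 10; 41; 40]; [:: 9; 10; 11; 12; 24]; [:: 42; 41; 10; 11; 18];
  [:: 11; 12; 13; 17; 18]; [:: 14; 13; 17; 16; 15]; [:: 39; 38; 37; 36; 15];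
  [:: 16; 26; 25; 27; 15]; [:: 27; 28; 32; 33; 15]; [:: 33; 34; 35; 36; 15];
  [:: 17; 16; 26; 19; 18]; [:: 42; 43; 44; 45; 18]; [:: 51; 21; 20; 19; 18];
  [:: 51; 50; 49; 48; 18]; [:: 48; 47; 46; 45; 18]; [:: 20; 19; 26; 25; 24];
  [:: 23; 22; 21; 20; 24]; [:: 22; 21; 51; 50; 31]; [:: 25; 27; 28; 29; 24];
  [:: 30; 29; 28; 32; 31]; [:: 53; 52; 49; 50; 31]; [:: 32; 33; 34; 53; 31];
  [:: 35; 34; 53; 52; 54]; [:: 67; 37; 36; 35; 54]; [:: 38; 37; 67; 66; 40];
  [:: 69; 68; 65; 66; 40]; [:: 41; 42; 43; 72; 40]; [:: 72; 71; 70; 69; 40];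
  [:: 71; 72; 43; 44; 57]; [:: 44; 45; 46; 56; 57]; [:: 47; 46; 56; 55; 54];
  [:: 52; 49; 48; 47; 54]; [:: 64; 63; 62; 61; 54]; [:: 55; 59; 60; 61; 54];
  [:: 67; 66; 65; 64; 54]; [:: 56; 55; 59; 58; 57]; [:: 74; 75; 87; 86; 57];
  [:: 71; 70; 73; 74; 57]; [:: 58; 81; 82; 83; 57]; [:: 83; 84; 85; 86; 57];
  [:: 60; 59; 58; 81; 80]; [:: 60; 61; 62; 79; 80]; [:: 63; 62; 79; 78; 77];
  [:: 68; 65; 64; 63; 77]; [:: 73; 70; 69; 68; 77]; [:: 76; 75; 74; 73; 77];
  [:: 123; 76; 75; 87; 88]; [:: 101; 100; 123; 76; 77]; [:: 78; 118; 119; 120;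
  77]; [:: 120; 103; 102; 101; 77]; [:: 79; 78; 118; 117; 80]; [:: 114; 115;
  116; 117; 80]; [:: 111; 112; 113; 114; 80]; [:: 107; 106; 110; 111; 80];
  [:: 81; 82; 108; 107; 80]; [:: 108; 82; 83; 84; 109]; [:: 84; 85; 89; 90;
  109]; [:: 87; 86; 85; 89; 88]; [:: 98; 99; 100; 123; 88]; [:: 89; 90; 91; 92;
  88]; [:: 92; 122; 112; 113; 88]; [:: 113; 114; 115; 97; 88]; [:: 97; 96; 95;
  98; 88]; [:: 90; 91; 93; 94; 109]; [:: 122; 92; 91; 93; 121]; [:: 93; 94; 95;
  96; 121]; [:: 94; 95; 98; 99; 109]; [:: 96; 97; 115; 116; 121]; [:: 102; 101;
  100; 99; 109]; [:: 105; 104; 103; 102; 109]; [:: 119; 120; 103; 104; 121];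
  [:: 104; 105; 106; 110; 121]; [:: 108; 107; 106; 105; 109]; [:: 110; 111;
  112; 122; 121]; [:: 116; 117; 118; 119; 121]] [:: (74%num, ([:: 121], [:: 93;
  94; 95; 96])); (73%num, ([:: 121; 122], [:: 92; 91; 93])); (69%num, ([:: 122;
  112; 113], [:: 88; 92])); (70%num, ([:: 113; 114; 115], [:: 97; 88]));
  (76%num, ([:: 115; 116; 121], [:: 96; 97]))] [:: [:: 0; 1; 2; 1; 2; 1; 0; 1;
  0; 2; 1; 0; 2; 1; 0; 2; 1; 0; 1; 2; 1; 2; 0; 1; 2; 0; 1; 0; 1; 2; 1; 2; 0; 1;
  2; 1; 0; 1; 0; 1; 2; 1]] (28%num, 17%num, 32) [::].

Definition data_3e4_8 :=
  MapData 47 ([:: [:: 0; 1; 2; 3; 4; 5; 6; 7]; [:: 8; 1; 0]; [:: 8; 9; 1];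
  [:: 10; 11; 12; 13; 14; 15; 9; 8]; [:: 10; 11; 16]; [:: 11; 17; 16]; [:: 16;
  17; 18; 19; 20; 21; 22; 23]; [:: 17; 18; 24]; [:: 24; 25; 18]; [:: 18; 26;
  25]; [:: 27; 28; 25; 26; 29; 30; 31; 32]; [:: 22; 28; 27]; [:: 22; 23; 28];
  [:: 28; 33; 23]; [:: 23; 33; 34]; [:: 35; 24; 33; 34; 36; 37; 38; 39];
  [:: 17; 24; 35]; [:: 11; 35; 17]; [:: 11; 12; 35]; [:: 35; 39; 12]; [:: 12;
  21; 39]; [:: 39; 20; 21]; [:: 39; 38; 20]; [:: 20; 40; 38]; [:: 38; 41; 40];
  [:: 40; 42; 43; 44; 45; 46; 47; 41]; [:: 19; 42; 40]; [:: 26; 42; 19];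
  [:: 26; 29; 42]; [:: 42; 43; 29]; [:: 29; 3; 43]; [:: 29; 30; 3]; [:: 30; 2;
  3]; [:: 46; 2; 30]; [:: 46; 45; 2]; [:: 31; 30; 46]; [:: 47; 46; 31]; [:: 47;
  31; 6]; [:: 32; 31; 6]; [:: 32; 6; 5]; [:: 14; 5; 32]; [:: 14; 15; 5]; [:: 5;
  4; 15]; [:: 15; 44; 4]; [:: 9; 15; 44]; [:: 45; 44; 9]; [:: 1; 45; 9]; [:: 1;
  2; 45]; [:: 43; 44; 4]; [:: 43; 4; 3]; [:: 27; 32; 14]; [:: 13; 14; 27];
  [:: 13; 27; 22]; [:: 21; 22; 13]; [:: 12; 13; 21]; [:: 7; 6; 47]; [:: 41; 47;
  7]; [:: 41; 7; 37]; [:: 37; 0; 7]; [:: 36; 37; 0]; [:: 36; 0; 8]; [:: 10; 8;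
  36]; [:: 10; 36; 34]; [:: 10; 34; 16]; [:: 16; 23; 34]; [:: 38; 37; 41];
  [:: 18; 19; 26]; [:: 20; 19; 40]; [:: 24; 33; 25]; [:: 28; 25; 33]])%num
  [:: [:: 1; 60; 59; 58; 0]; [:: 47; 46; 2; 1; 0]; [:: 32; 33; 34; 47; 0];
  [:: 49; 30; 31; 32; 0]; [:: 42; 43; 48; 49; 0]; [:: 39; 40; 41; 42; 0];
  [:: 55; 37; 38; 39; 0]; [:: 58; 57; 56; 55; 0]; [:: 61; 60; 1; 2; 3]; [:: 2;
  46; 45; 44; 3]; [:: 4; 63; 62; 61; 3]; [:: 18; 17; 5; 4; 3]; [:: 54; 20; 19;
  18; 3]; [:: 51; 52; 53; 54; 3]; [:: 41; 40; 50; 51; 3]; [:: 44; 43; 42; 41;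
  3]; [:: 5; 4; 63; 64; 6]; [:: 7; 16; 17; 5; 6]; [:: 66; 9; 8; 7; 6]; [:: 67;
  26; 27; 66; 6]; [:: 21; 22; 23; 67; 6]; [:: 53; 54; 20; 21; 6]; [:: 12; 11;
  52; 53; 6]; [:: 64; 14; 13; 12; 6]; [:: 68; 8; 7; 16; 15]; [:: 9; 8; 68; 69;
  10]; [:: 28; 27; 66; 9; 10]; [:: 11; 52; 51; 50; 10]; [:: 69; 13; 12; 11;
  10]; [:: 31; 30; 29; 28; 10]; [:: 35; 33; 32; 31; 10]; [:: 38; 37; 36; 35;
  10]; [:: 50; 40; 39; 38; 10]; [:: 14; 13; 69; 68; 15]; [:: 62; 63; 64; 14;
  15]; [:: 16; 17; 18; 19; 15]; [:: 59; 60; 61; 62; 15]; [:: 65; 57; 58; 59;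
  15]; [:: 22; 23; 24; 65; 15]; [:: 19; 20; 21; 22; 15]; [:: 26; 67; 23; 24;
  25]; [:: 24; 65; 57; 56; 25]; [:: 29; 28; 27; 26; 25]; [:: 48; 49; 30; 29;
  25]; [:: 45; 44; 43; 48; 25]; [:: 34; 47; 46; 45; 25]; [:: 36; 35; 33; 34;
  25]; [:: 56; 55; 37; 36; 25]] [:: (43%num, ([:: 48; 49], [:: 30; 29; 25]));
  (3%num, ([:: 49; 0], [:: 32; 31; 30])); (2%num, ([:: 0; 47], [:: 34; 33;
  32])); (45%num, ([:: 47; 46; 45], [:: 25; 34])); (44%num, ([:: 45; 44; 43;
  48], [:: 25]))] [:: [:: 0; 2; 1; 0; 2; 1; 2; 1; 0; 1; 0; 1; 2; 0; 1; 2; 0; 1;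
  2; 1; 0; 1; 0; 1; 0; 1]] (33%num, 34%num, 15) [::].

Definition data_3e4_9 :=
  MapData 35 ([:: [:: 0; 1; 2; 3; 4; 5; 6; 7; 8]; [:: 9; 1; 0]; [:: 9; 10; 1];
  [:: 11; 12; 10; 9; 13; 14; 15; 16; 17]; [:: 11; 5; 12]; [:: 5; 4; 12];
  [:: 12; 4; 18]; [:: 4; 19; 18]; [:: 20; 21; 22; 23; 18; 19; 24; 25; 26];
  [:: 17; 21; 20]; [:: 17; 16; 21]; [:: 21; 27; 16]; [:: 16; 28; 27]; [:: 29;
  30; 28; 27; 31; 32; 33; 34; 35]; [:: 29; 30; 11]; [:: 29; 17; 11]; [:: 29;
  20; 17]; [:: 29; 35; 20]; [:: 20; 26; 35]; [:: 35; 13; 26]; [:: 26; 14; 13];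
  [:: 26; 25; 14]; [:: 14; 7; 25]; [:: 25; 8; 7]; [:: 25; 24; 8]; [:: 33; 24;
  8]; [:: 33; 32; 24]; [:: 24; 19; 32]; [:: 32; 3; 19]; [:: 31; 32; 3]; [:: 2;
  3; 31]; [:: 22; 2; 31]; [:: 23; 22; 2]; [:: 1; 2; 23]; [:: 1; 23; 10];
  [:: 10; 18; 23]; [:: 10; 12; 18]; [:: 27; 31; 22]; [:: 21; 22; 27]; [:: 4; 3;
  19]; [:: 0; 8; 33]; [:: 34; 33; 0]; [:: 34; 0; 9]; [:: 13; 9; 34]; [:: 35;
  34; 13]; [:: 14; 15; 7]; [:: 7; 6; 15]; [:: 15; 6; 28]; [:: 30; 28; 6];
  [:: 30; 6; 5]; [:: 30; 5; 11]; [:: 16; 15; 28]])%num [:: [:: 1; 42; 41; 40;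
  0]; [:: 33; 34; 2; 1; 0]; [:: 30; 31; 32; 33; 0]; [:: 39; 28; 29; 30; 0];
  [:: 5; 6; 7; 39; 0]; [:: 49; 50; 4; 5; 0]; [:: 46; 47; 48; 49; 0]; [:: 23;
  22; 45; 46; 0]; [:: 40; 25; 24; 23; 0]; [:: 43; 42; 1; 2; 3]; [:: 2; 34; 35;
  36; 3]; [:: 4; 50; 14; 15; 3]; [:: 36; 6; 5; 4; 3]; [:: 20; 19; 44; 43; 3];
  [:: 45; 22; 21; 20; 3]; [:: 51; 47; 46; 45; 3]; [:: 10; 11; 12; 51; 3];
  [:: 15; 16; 9; 10; 3]; [:: 7; 6; 36; 35; 8]; [:: 27; 28; 39; 7; 8]; [:: 9;
  16; 17; 18; 8]; [:: 38; 11; 10; 9; 8]; [:: 32; 31; 37; 38; 8]; [:: 35; 34;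
  33; 32; 8]; [:: 24; 25; 26; 27; 8]; [:: 21; 22; 23; 24; 8]; [:: 18; 19; 20;
  21; 8]; [:: 37; 38; 11; 12; 13]; [:: 12; 51; 47; 48; 13]; [:: 14; 15; 16; 17;
  13]; [:: 48; 49; 50; 14; 13]; [:: 29; 30; 31; 37; 13]; [:: 26; 27; 28; 29;
  13]; [:: 41; 40; 25; 26; 13]; [:: 44; 43; 42; 41; 13]; [:: 17; 18; 19; 44;
  13]] [:: (16%num, ([:: 51; 3], [:: 10; 11; 12])); (17%num, ([:: 3], [:: 15;
  16; 9; 10])); (11%num, ([:: 3; 4; 50], [:: 14; 15])); (30%num, ([:: 50; 49;
  48], [:: 13; 14])); (28%num, ([:: 48; 47; 51], [:: 12; 13]))] [:: [:: 1; 2;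
  0; 1; 2; 0; 1; 0; 1; 2; 1; 2; 0; 1; 2; 1; 0; 1; 0; 1; 2; 0]]
  (3%num, 2%num, 30) [::].

Definition data_3e4_10 :=
  MapData 29 ([:: [:: 0; 1; 2; 3; 4; 5; 6; 7; 8; 9]; [:: 10; 1; 0]; [:: 10; 11;
  1]; [:: 12; 10; 11; 13; 14; 15; 16; 17; 18; 19]; [:: 20; 10; 12]; [:: 20; 0;
  10]; [:: 20; 21; 0]; [:: 22; 20; 21; 23; 24; 25; 26; 27; 28; 29]; [:: 22; 20;
  12]; [:: 22; 3; 12]; [:: 12; 19; 3]; [:: 3; 2; 19]; [:: 27; 2; 19]; [:: 28;
  27; 2]; [:: 1; 2; 28]; [:: 1; 28; 11]; [:: 11; 29; 28]; [:: 11; 13; 29];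
  [:: 13; 4; 29]; [:: 5; 4; 13]; [:: 14; 13; 5]; [:: 24; 14; 5]; [:: 25; 24;
  14]; [:: 15; 14; 25]; [:: 15; 25; 8]; [:: 8; 26; 25]; [:: 8; 7; 26]; [:: 9;
  8; 15]; [:: 9; 15; 16]; [:: 21; 16; 9]; [:: 21; 23; 16]; [:: 16; 17; 23];
  [:: 23; 6; 17]; [:: 17; 7; 6]; [:: 17; 18; 7]; [:: 7; 18; 26]; [:: 18; 27;
  26]; [:: 18; 19; 27]; [:: 23; 24; 6]; [:: 0; 9; 21]; [:: 6; 5; 24]; [:: 22;
  29; 4]; [:: 22; 4; 3]])%num [:: [:: 1; 5; 6; 39; 0]; [:: 14; 15; 2; 1; 0];
  [:: 11; 12; 13; 14; 0]; [:: 42; 9; 10; 11; 0]; [:: 19; 18; 41; 42; 0];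
  [:: 40; 21; 20; 19; 0]; [:: 33; 32; 38; 40; 0]; [:: 26; 35; 34; 33; 0];
  [:: 27; 24; 25; 26; 0]; [:: 39; 29; 28; 27; 0]; [:: 2; 1; 5; 4; 3]; [:: 17;
  16; 15; 2; 3]; [:: 4; 8; 9; 10; 3]; [:: 20; 19; 18; 17; 3]; [:: 23; 22; 21;
  20; 3]; [:: 28; 27; 24; 23; 3]; [:: 31; 30; 29; 28; 3]; [:: 34; 33; 32; 31;
  3]; [:: 37; 36; 35; 34; 3]; [:: 10; 11; 12; 37; 3]; [:: 6; 5; 4; 8; 7];
  [:: 30; 29; 39; 6; 7]; [:: 8; 9; 42; 41; 7]; [:: 38; 32; 31; 30; 7]; [:: 22;
  21; 40; 38; 7]; [:: 25; 24; 23; 22; 7]; [:: 36; 35; 26; 25; 7]; [:: 13; 12;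
  37; 36; 7]; [:: 16; 15; 14; 13; 7]; [:: 41; 18; 17; 16; 7]]
  [:: (26%num, ([:: 26; 25], [:: 7; 36; 35])); (25%num, ([:: 25; 24; 23; 22],
  [:: 7])); (24%num, ([:: 22; 21; 40], [:: 38; 7])); (6%num, ([:: 40; 0],
  [:: 33; 32; 38])); (7%num, ([:: 0; 26], [:: 35; 34; 33]))] [:: [:: 1; 0; 1;
  0; 1; 0; 2; 1; 0; 2; 1; 0; 2; 1; 0; 1; 2; 1; 2; 0; 1; 2; 1; 0]; [:: 2; 1; 0;
  2; 1; 2; 0; 1; 0; 1; 2; 1; 2; 0; 1; 2; 1; 0; 1; 0]] (19%num, 12%num, 3) [::].

Definition data_3e2_5_3_5 :=
  MapData 19 ([:: [:: 0; 1; 2]; [:: 3; 0; 1]; [:: 4; 5; 6; 3; 0]; [:: 5; 6; 2];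
  [:: 7; 6; 2]; [:: 7; 6; 8; 9; 10]; [:: 8; 3; 6]; [:: 11; 3; 8]; [:: 11; 12;
  13; 1; 3]; [:: 12; 13; 4]; [:: 12; 4; 0]; [:: 7; 2; 0; 12; 14]; [:: 14; 11;
  12]; [:: 14; 15; 11]; [:: 16; 14; 15; 9; 17]; [:: 9; 17; 18]; [:: 9; 18; 8];
  [:: 15; 19; 18; 8; 11]; [:: 19; 18; 5]; [:: 19; 5; 4]; [:: 16; 10; 19; 4;
  13]; [:: 10; 19; 15]; [:: 10; 15; 9]; [:: 16; 17; 13]; [:: 17; 13; 1];
  [:: 17; 18; 5; 2; 1]; [:: 7; 16; 10]; [:: 7; 14; 16]])%num [:: [:: 0; 1; 2;
  10; 11]; [:: 1; 0; 25; 24; 8]; [:: 4; 3; 25; 0; 11]; [:: 6; 7; 8; 1; 2];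
  [:: 9; 10; 2; 19; 20]; [:: 19; 18; 25; 3; 2]; [:: 3; 4; 5; 6; 2]; [:: 26; 27;
  11; 4; 5]; [:: 6; 7; 17; 16; 5]; [:: 16; 15; 14; 22; 5]; [:: 22; 21; 20; 26;
  5]; [:: 12; 13; 17; 7; 8]; [:: 10; 9; 8; 12; 11]; [:: 23; 24; 8; 9; 20];
  [:: 12; 13; 14; 27; 11]; [:: 21; 22; 14; 13; 17]; [:: 27; 26; 20; 23; 14];
  [:: 24; 23; 14; 15; 25]; [:: 15; 16; 17; 18; 25]; [:: 19; 18; 17; 21; 20]]
  [:: (5%num, ([:: 19; 18; 25], [:: 3; 2])); (2%num, ([:: 25], [:: 0; 11; 4;
  3])); (1%num, ([:: 25; 24], [:: 8; 1; 0])); (13%num, ([:: 24; 23; 20], [:: 9;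
  8])); (4%num, ([:: 20; 19], [:: 2; 10; 9]))] [:: [:: 1; 2; 1; 2; 0; 1; 2; 0;
  1; 0; 2; 1; 0; 1; 2; 1; 2; 0; 1; 2; 1; 0]] (3%num, 6%num, 6) [::].

Definition data_3e3_4_6 :=
  MapData 23 ([:: [:: 0; 1; 2]; [:: 3; 1; 0]; [:: 3; 4; 1]; [:: 5; 4; 3];
  [:: 5; 6; 4]; [:: 7; 6; 5]; [:: 7; 2; 6]; [:: 7; 0; 2]; [:: 8; 9; 7; 0];
  [:: 8; 10; 9]; [:: 10; 9; 11]; [:: 9; 11; 12]; [:: 11; 12; 13]; [:: 14; 13;
  12]; [:: 15; 14; 13]; [:: 15; 13; 3; 5]; [:: 16; 8; 0; 3; 13; 11]; [:: 16;
  17; 8]; [:: 17; 8; 10]; [:: 18; 19; 10; 17; 2; 1]; [:: 18; 19; 20]; [:: 20;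
  19; 21]; [:: 19; 21; 16]; [:: 21; 16; 17]; [:: 21; 17; 2; 6]; [:: 22; 14; 20;
  21; 6; 4]; [:: 22; 15; 14]; [:: 23; 22; 15]; [:: 18; 23; 22]; [:: 18; 20;
  23]; [:: 23; 20; 14; 12]; [:: 18; 22; 4; 1]; [:: 19; 16; 11; 10]; [:: 23; 15;
  5; 7; 9; 12]])%num [:: [:: 1; 0; 7; 8; 16]; [:: 0; 1; 2; 31; 19]; [:: 0; 7;
  6; 24; 19]; [:: 1; 2; 3; 15; 16]; [:: 4; 3; 2; 31; 25]; [:: 5; 4; 3; 15; 33];
  [:: 4; 5; 6; 24; 25]; [:: 5; 6; 7; 8; 33]; [:: 17; 18; 9; 8; 16]; [:: 11; 10;
  9; 8; 33]; [:: 18; 9; 10; 32; 19]; [:: 12; 11; 10; 32; 16]; [:: 11; 12; 13;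
  30; 33]; [:: 12; 13; 14; 15; 16]; [:: 26; 14; 13; 30; 25]; [:: 27; 26; 14;
  15; 33]; [:: 17; 23; 22; 32; 16]; [:: 18; 17; 23; 24; 19]; [:: 20; 29; 28;
  31; 19]; [:: 20; 21; 22; 32; 19]; [:: 21; 20; 29; 30; 25]; [:: 21; 22; 23;
  24; 25]; [:: 26; 27; 28; 31; 25]; [:: 27; 28; 29; 30; 33]]
  [:: (14%num, ([:: 26; 25; 30], [:: 13; 14])); (12%num, ([:: 30], [:: 33; 11;
  12; 13])); (23%num, ([:: 30; 29; 28; 27], [:: 33])); (15%num, ([:: 27; 26],
  [:: 14; 15; 33]))] [:: [:: 2; 1; 2; 1; 0; 2; 1; 2; 1; 0; 1; 2; 0; 1; 2; 0; 1;
  2; 0; 1; 0]] (2%num, 17%num, 19) [::].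

Definition data_3e2_4_3_6 :=
  MapData 23 ([:: [:: 0; 1; 2]; [:: 3; 0; 1]; [:: 4; 0; 3; 5]; [:: 6; 3; 5];
  [:: 7; 6; 3]; [:: 8; 6; 7; 9]; [:: 8; 9; 2]; [:: 9; 2; 10]; [:: 11; 12; 4;
  10; 9; 13]; [:: 14; 12; 4]; [:: 14; 4; 0]; [:: 15; 16; 14; 0; 2; 8]; [:: 16;
  17; 14]; [:: 16; 18; 17]; [:: 11; 19; 18; 16]; [:: 18; 19; 20]; [:: 18; 20;
  1]; [:: 20; 1; 2; 10]; [:: 20; 10; 5]; [:: 4; 5; 10]; [:: 19; 20; 5; 6; 21;
  22]; [:: 21; 8; 6]; [:: 15; 21; 8]; [:: 15; 13; 23; 21]; [:: 22; 23; 21];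
  [:: 17; 22; 23]; [:: 17; 14; 12; 22]; [:: 19; 12; 22]; [:: 11; 19; 12];
  [:: 17; 18; 1; 3; 7; 23]; [:: 13; 23; 7]; [:: 13; 7; 9]; [:: 11; 15; 13];
  [:: 11; 16; 15]])%num [:: [:: 0; 1; 2; 10; 11]; [:: 1; 0; 17; 16; 29]; [:: 6;
  7; 17; 0; 11]; [:: 4; 3; 2; 1; 29]; [:: 9; 10; 2; 19; 8]; [:: 18; 19; 2; 3;
  20]; [:: 3; 4; 5; 21; 20]; [:: 30; 31; 5; 4; 29]; [:: 22; 21; 5; 6; 11];
  [:: 7; 6; 5; 31; 8]; [:: 19; 18; 17; 7; 8]; [:: 32; 33; 14; 28; 8]; [:: 28;
  27; 26; 9; 8]; [:: 31; 30; 23; 32; 8]; [:: 10; 9; 26; 12; 11]; [:: 33; 32;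
  23; 22; 11]; [:: 12; 13; 14; 33; 11]; [:: 13; 12; 26; 25; 29]; [:: 16; 15;
  14; 13; 29]; [:: 27; 28; 14; 15; 20]; [:: 15; 16; 17; 18; 20]; [:: 21; 22;
  23; 24; 20]; [:: 24; 25; 26; 27; 20]; [:: 25; 24; 23; 30; 29]]
  [:: (10%num, ([:: 19; 18; 17], [:: 7; 8])); (2%num, ([:: 17; 0], [:: 11; 6;
  7])); (0%num, ([:: 0; 1; 2], [:: 10; 11])); (4%num, ([:: 2; 19], [:: 8; 9;
  10]))] [:: [:: 0; 1; 0; 1; 0; 2; 1; 2; 1; 0; 1; 2; 1; 2; 0; 1; 2; 1; 0; 1; 2;
  1; 2; 1; 0; 1]] (6%num, 5%num, 20) [:: (1%num, 1); (0%num, 1); (3%num, 1);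
  (2%num, 1); (20%num, 1); (10%num, 1); (9%num, 0); (8%num, 0); (7%num, 0);
  (6%num, 0); (5%num, 1); (22%num, 0); (19%num, 0); (21%num, 0); (18%num, 0);
  (23%num, 0); (17%num, 0); (16%num, 0); (14%num, 0); (12%num, 0); (4%num, 1);
  (13%num, 0); (11%num, 0); (15%num, 0)].

Definition data_3_4_3_4e2 :=
  MapData 23 ([:: [:: 0; 1; 2]; [:: 3; 4; 1; 2]; [:: 3; 2; 5]; [:: 6; 7; 2; 5];
  [:: 8; 6; 7]; [:: 9; 8; 6; 10]; [:: 10; 6; 11]; [:: 6; 11; 12; 5]; [:: 12;
  13; 5]; [:: 4; 0; 12; 13]; [:: 4; 13; 1]; [:: 14; 15; 13; 1]; [:: 16; 15;
  14]; [:: 17; 18; 15; 16]; [:: 15; 3; 18]; [:: 15; 13; 5; 3]; [:: 18; 3; 4;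
  19]; [:: 19; 4; 0]; [:: 7; 19; 0; 2]; [:: 20; 7; 19]; [:: 20; 21; 8; 7];
  [:: 21; 8; 17]; [:: 9; 16; 17; 8]; [:: 22; 9; 16]; [:: 20; 22; 9; 21]; [:: 9;
  10; 21]; [:: 23; 17; 21; 10]; [:: 23; 17; 18]; [:: 23; 18; 19; 20]; [:: 23;
  20; 22]; [:: 23; 22; 11; 10]; [:: 22; 16; 14; 11]; [:: 11; 12; 14]; [:: 14;
  12; 0; 1]])%num [:: [:: 17; 18; 0; 33; 9]; [:: 0; 1; 10; 11; 33]; [:: 2; 1;
  0; 18; 3]; [:: 14; 15; 2; 1; 16]; [:: 10; 9; 17; 16; 1]; [:: 2; 15; 8; 7; 3];
  [:: 6; 5; 4; 3; 7]; [:: 4; 20; 19; 18; 3]; [:: 21; 20; 4; 5; 22]; [:: 23; 24;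
  25; 5; 22]; [:: 6; 5; 25; 26; 30]; [:: 32; 7; 6; 30; 31]; [:: 32; 7; 8; 9;
  33]; [:: 10; 9; 8; 15; 11]; [:: 32; 31; 12; 11; 33]; [:: 12; 13; 14; 15; 11];
  [:: 23; 31; 12; 13; 22]; [:: 21; 26; 27; 13; 22]; [:: 14; 13; 27; 28; 16];
  [:: 19; 18; 17; 16; 28]; [:: 29; 28; 19; 20; 24]; [:: 25; 26; 21; 20; 24];
  [:: 23; 24; 29; 30; 31]; [:: 29; 28; 27; 26; 30]] [:: (0%num, ([:: 17; 18;
  0], [:: 33; 9])); (1%num, ([:: 0; 1], [:: 10; 11; 33])); (4%num, ([:: 1; 16;
  17], [:: 9; 10]))] [:: [:: 2; 0; 1; 0; 1; 2; 1; 0; 2; 1; 0; 1; 2; 1; 0; 1]]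
  (13%num, 4%num, 9) [::].

Definition data_3_4e4 :=
  MapData 11 ([:: [:: 0; 1; 2]; [:: 3; 0; 1; 4]; [:: 5; 6; 4; 1]; [:: 4; 6; 7];
  [:: 8; 6; 7; 2]; [:: 8; 2; 9; 3]; [:: 9; 3; 5]; [:: 3; 5; 6; 0]; [:: 10; 8;
  6; 0]; [:: 11; 10; 8]; [:: 11; 10; 5; 1]; [:: 10; 7; 9; 5]; [:: 10; 0; 2; 7];
  [:: 11; 4; 7; 9]; [:: 11; 9; 2; 1]; [:: 11; 8; 3; 4]])%num [:: [:: 0; 1; 7;
  8; 12]; [:: 0; 14; 10; 2; 1]; [:: 0; 12; 4; 5; 14]; [:: 6; 7; 1; 15; 5];
  [:: 3; 2; 1; 15; 13]; [:: 6; 11; 10; 2; 7]; [:: 3; 4; 8; 7; 2]; [:: 3; 13;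
  11; 12; 4]; [:: 9; 15; 5; 4; 8]; [:: 6; 5; 14; 13; 11]; [:: 9; 8; 12; 11;
  10]; [:: 9; 10; 14; 13; 15]] [:: (1%num, ([:: 14; 10], [:: 2; 1; 0]));
  (5%num, ([:: 10; 11], [:: 6; 7; 2])); (9%num, ([:: 11; 13; 14], [:: 5; 6]));
  (2%num, ([:: 14], [:: 0; 12; 4; 5]))] [:: [:: 1; 2; 1; 0; 1; 0; 2; 1; 0; 2;
  1; 2; 1; 0]] (5%num, 9%num, 11) [:: (6%num, 0); (7%num, 1); (4%num, 1);
  (8%num, 0); (2%num, 1); (10%num, 1); (0%num, 0); (1%num, 1); (3%num, 0);
  (11%num, 1); (5%num, 1); (9%num, 1)].

Definition data_3_7_3_7 :=
  MapData 41 ([:: [:: 0; 1; 2]; [:: 3; 4; 5; 1; 2; 6; 7]; [:: 8; 6; 2]; [:: 9;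
  10; 11; 12; 13; 6; 8]; [:: 12; 14; 11]; [:: 15; 16; 0; 1; 14; 12; 17];
  [:: 17; 12; 13]; [:: 18; 19; 7; 13; 17; 20; 21]; [:: 7; 6; 13]; [:: 20; 17;
  15]; [:: 22; 23; 24; 25; 15; 20; 26]; [:: 25; 16; 15]; [:: 27; 28; 10; 29;
  30; 16; 25]; [:: 16; 0; 30]; [:: 10; 11; 29]; [:: 31; 32; 33; 29; 11; 14; 5];
  [:: 5; 1; 14]; [:: 33; 30; 29]; [:: 32; 33; 34]; [:: 28; 10; 9]; [:: 35; 36;
  22; 37; 38; 28; 9]; [:: 38; 27; 28]; [:: 24; 39; 19; 3; 40; 38; 27]; [:: 40;
  3; 4]; [:: 41; 21; 26; 37; 40; 4; 31]; [:: 37; 38; 40]; [:: 21; 20; 26];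
  [:: 22; 26; 37]; [:: 31; 5; 4]; [:: 41; 31; 32]; [:: 41; 18; 39; 23; 36; 34;
  32]; [:: 39; 19; 18]; [:: 23; 24; 39]; [:: 36; 22; 23]; [:: 34; 35; 36];
  [:: 33; 34; 35; 8; 2; 0; 30]; [:: 35; 9; 8]; [:: 41; 18; 21]; [:: 19; 7; 3];
  [:: 24; 27; 25]])%num [:: [:: 0; 5; 13; 35]; [:: 0; 1; 16; 5]; [:: 0; 35; 2;
  1]; [:: 23; 1; 38; 22]; [:: 23; 24; 28; 1]; [:: 16; 1; 28; 15]; [:: 2; 1; 8;
  3]; [:: 8; 1; 38; 7]; [:: 2; 3; 36; 35]; [:: 19; 20; 36; 3]; [:: 14; 3; 19;
  12]; [:: 4; 3; 14; 15]; [:: 4; 5; 6; 3]; [:: 6; 7; 8; 3]; [:: 4; 15; 16; 5];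
  [:: 11; 10; 9; 5]; [:: 13; 5; 11; 12]; [:: 6; 5; 9; 7]; [:: 31; 30; 37; 7];
  [:: 38; 7; 31; 22]; [:: 9; 7; 26; 10]; [:: 26; 7; 37; 24]; [:: 27; 10; 33;
  20]; [:: 32; 10; 33; 30]; [:: 39; 22; 32; 10]; [:: 11; 12; 39; 10]; [:: 26;
  24; 27; 10]; [:: 21; 12; 39; 22]; [:: 19; 12; 21; 20]; [:: 14; 12; 17; 15];
  [:: 13; 12; 17; 35]; [:: 28; 15; 29; 24]; [:: 18; 15; 29; 30]; [:: 17; 35;
  18; 15]; [:: 34; 35; 18; 30]; [:: 36; 20; 34; 35]; [:: 33; 20; 34; 30];
  [:: 25; 20; 27; 24]; [:: 21; 22; 25; 20]; [:: 31; 22; 32; 30]; [:: 23; 22;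
  25; 24]; [:: 29; 24; 37; 30]] [:: (0%num, ([:: 5; 13], [:: 35; 0]));
  (30%num, ([:: 13; 12; 17], [:: 35])); (33%num, ([:: 17; 15; 18], [:: 35]));
  (34%num, ([:: 18], [:: 30; 34; 35])); (32%num, ([:: 18; 15], [:: 29; 30]));
  (31%num, ([:: 15], [:: 28; 24; 29])); (5%num, ([:: 15; 16], [:: 1; 28]));
  (1%num, ([:: 16; 5], [:: 0; 1]))] [:: [:: 0; 1; 2; 1; 2; 0; 1; 0; 1; 2; 1; 2;
  0; 1; 2; 0; 1; 2; 1; 0; 1]; [:: 2; 1; 2; 0; 1; 0; 2; 1; 2; 1; 0; 1; 2; 0; 1;
  2; 0; 1; 0; 1; 0; 1]] (23%num, 24%num, 10) [::].

Definition data_3_4_7_4 :=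
  MapData 83 ([:: [:: 0; 1; 2]; [:: 3; 4; 0; 1]; [:: 5; 3; 4]; [:: 6; 7; 3; 5];
  [:: 8; 6; 7]; [:: 9; 10; 8; 6]; [:: 11; 9; 10]; [:: 12; 13; 11; 9]; [:: 14;
  12; 13]; [:: 15; 16; 14; 12]; [:: 17; 15; 16]; [:: 18; 19; 17; 15]; [:: 20;
  18; 19]; [:: 21; 22; 18; 20]; [:: 21; 23; 22]; [:: 24; 25; 21; 23]; [:: 26;
  24; 25]; [:: 27; 28; 24; 26]; [:: 29; 27; 28]; [:: 30; 31; 29; 27]; [:: 32;
  30; 31]; [:: 33; 34; 32; 30]; [:: 35; 33; 34]; [:: 36; 37; 35; 33]; [:: 38;
  36; 37]; [:: 39; 40; 38; 36]; [:: 41; 39; 40]; [:: 42; 43; 39; 41]; [:: 44;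
  42; 43]; [:: 45; 46; 44; 42]; [:: 47; 45; 46]; [:: 48; 49; 47; 45]; [:: 50;
  48; 49]; [:: 51; 52; 50; 48]; [:: 53; 51; 52]; [:: 54; 55; 53; 51]; [:: 56;
  54; 55]; [:: 57; 58; 54; 56]; [:: 57; 59; 58]; [:: 60; 61; 57; 59]; [:: 62;
  60; 61]; [:: 63; 64; 60; 62]; [:: 63; 65; 64]; [:: 66; 67; 63; 65]; [:: 68;
  67; 63; 62; 69; 70; 71]; [:: 70; 72; 73; 71]; [:: 71; 73; 74]; [:: 73; 74;
  75; 76]; [:: 72; 52; 50; 65; 66; 76; 73]; [:: 65; 64; 49; 50]; [:: 64; 49;
  47; 38; 40; 59; 60]; [:: 47; 46; 37; 38]; [:: 46; 44; 25; 21; 20; 35; 37];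
  [:: 35; 34; 19; 20]; [:: 34; 32; 8; 10; 2; 17; 19]; [:: 11; 10; 2; 1];
  [:: 31; 29; 13; 11; 1; 3; 7]; [:: 29; 28; 14; 13]; [:: 28; 24; 23; 4; 0; 16;
  14]; [:: 17; 16; 0; 2]; [:: 23; 22; 5; 4]; [:: 22; 5; 6; 9; 12; 15; 18];
  [:: 32; 31; 7; 8]; [:: 44; 43; 26; 25]; [:: 43; 39; 36; 33; 30; 27; 26];
  [:: 59; 58; 41; 40]; [:: 58; 41; 42; 45; 48; 51; 54]; [:: 77; 72; 52; 53];
  [:: 70; 77; 72]; [:: 78; 69; 70; 77]; [:: 79; 78; 69]; [:: 80; 81; 79; 78];
  [:: 68; 80; 81]; [:: 68; 81; 82; 67]; [:: 82; 66; 67]; [:: 76; 83; 82; 66];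
  [:: 75; 76; 83]; [:: 75; 83; 56; 55]; [:: 81; 79; 61; 57; 56; 83; 82];
  [:: 79; 69; 62; 61]; [:: 80; 78; 77; 53; 55; 75; 74]; [:: 68; 80; 74;
  71]])%num [:: [:: 0; 1; 58; 59]; [:: 0; 55; 56; 1]; [:: 0; 59; 54; 55];
  [:: 2; 1; 56; 3]; [:: 2; 60; 58; 1]; [:: 2; 3; 61; 60]; [:: 4; 3; 61; 5];
  [:: 4; 62; 56; 3]; [:: 4; 5; 54; 62]; [:: 6; 5; 61; 7]; [:: 6; 55; 54; 5];
  [:: 6; 7; 56; 55]; [:: 8; 7; 61; 9]; [:: 8; 57; 56; 7]; [:: 8; 9; 58; 57];
  [:: 10; 9; 61; 11]; [:: 10; 59; 58; 9]; [:: 10; 11; 54; 59]; [:: 12; 11; 61;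
  13]; [:: 12; 53; 54; 11]; [:: 12; 13; 52; 53]; [:: 14; 15; 52; 13]; [:: 14;
  13; 61; 60]; [:: 14; 60; 58; 15]; [:: 16; 15; 58; 17]; [:: 16; 63; 52; 15];
  [:: 16; 17; 64; 63]; [:: 18; 17; 64; 19]; [:: 18; 57; 58; 17]; [:: 18; 19;
  56; 57]; [:: 20; 19; 64; 21]; [:: 20; 62; 56; 19]; [:: 20; 21; 54; 62];
  [:: 22; 21; 64; 23]; [:: 22; 53; 54; 21]; [:: 22; 23; 52; 53]; [:: 24; 23;
  64; 25]; [:: 24; 51; 52; 23]; [:: 24; 25; 50; 51]; [:: 26; 25; 64; 27];
  [:: 26; 65; 50; 25]; [:: 26; 27; 66; 65]; [:: 28; 27; 66; 29]; [:: 28; 63;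
  64; 27]; [:: 28; 29; 52; 63]; [:: 30; 29; 66; 31]; [:: 30; 51; 52; 29];
  [:: 30; 31; 50; 51]; [:: 32; 31; 66; 33]; [:: 32; 49; 50; 31]; [:: 32; 33;
  48; 49]; [:: 34; 33; 66; 35]; [:: 34; 67; 48; 33]; [:: 34; 35; 80; 67];
  [:: 36; 35; 66; 37]; [:: 36; 77; 80; 35]; [:: 36; 37; 78; 77]; [:: 38; 39;
  78; 37]; [:: 38; 37; 66; 65]; [:: 38; 65; 50; 39]; [:: 40; 39; 50; 41];
  [:: 40; 79; 78; 39]; [:: 40; 41; 44; 79]; [:: 42; 43; 44; 41]; [:: 42; 41;
  50; 49]; [:: 42; 49; 48; 43]; [:: 74; 43; 48; 75]; [:: 74; 73; 44; 43];
  [:: 72; 81; 44; 73]; [:: 70; 79; 44; 69]; [:: 68; 69; 44; 45]; [:: 46; 45;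
  44; 81]; [:: 68; 45; 48; 67]; [:: 46; 47; 48; 45]; [:: 46; 81; 80; 47];
  [:: 76; 47; 80; 77]; [:: 76; 75; 48; 47]; [:: 68; 67; 80; 69]; [:: 70; 69;
  80; 71]; [:: 70; 71; 78; 79]; [:: 72; 71; 80; 81]; [:: 72; 73; 78; 71];
  [:: 74; 75; 78; 73]; [:: 76; 77; 78; 75]] [:: (80%num, ([:: 81], [:: 72; 71;
  80])); (68%num, ([:: 81; 44], [:: 73; 72])); (67%num, ([:: 44; 43], [:: 74;
  73])); (66%num, ([:: 43; 48], [:: 75; 74])); (76%num, ([:: 48; 47], [:: 76;
  75])); (75%num, ([:: 47], [:: 80; 77; 76])); (74%num, ([:: 47; 46; 81],
  [:: 80]))] [:: [:: 0; 1; 2; 1; 0; 1; 2; 1; 0; 1; 0; 2; 1; 0; 1; 2; 1; 0; 1];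
  [:: 1; 2; 1; 0; 1; 2; 1; 0; 1; 0; 1; 2; 1; 0; 1; 2; 1; 0; 1; 0]]
  (1%num, 11%num, 56) [::].

Definition data_3_4_8_4 :=
  MapData 47 ([:: [:: 0; 1; 2; 3; 4; 5; 6; 7]; [:: 8; 9; 1; 0]; [:: 10; 11; 12;
  13; 14; 15; 9; 8]; [:: 16; 17; 11; 10]; [:: 18; 19; 20; 21; 17; 16; 22; 23];
  [:: 24; 25; 19; 18]; [:: 26; 27; 28; 29; 30; 25; 24; 31]; [:: 32; 33; 30;
  29]; [:: 34; 35; 33; 32; 36; 37; 38; 39]; [:: 34; 15; 9; 35]; [:: 9; 1; 35];
  [:: 1; 2; 33; 35]; [:: 33; 2; 30]; [:: 2; 3; 25; 30]; [:: 25; 3; 19]; [:: 3;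
  4; 20; 19]; [:: 4; 12; 20]; [:: 4; 5; 11; 12]; [:: 5; 17; 11]; [:: 6; 5; 17;
  21]; [:: 13; 21; 6]; [:: 20; 21; 13; 12]; [:: 7; 6; 13; 14]; [:: 40; 14; 7];
  [:: 40; 41; 15; 14]; [:: 40; 42; 43; 44; 45; 46; 47; 41]; [:: 40; 42; 0; 7];
  [:: 42; 8; 0]; [:: 42; 43; 10; 8]; [:: 43; 16; 10]; [:: 43; 44; 22; 16];
  [:: 44; 28; 22]; [:: 44; 45; 29; 28]; [:: 28; 27; 23; 22]; [:: 27; 23; 38];
  [:: 38; 37; 18; 23]; [:: 37; 18; 24]; [:: 31; 24; 37; 36]; [:: 46; 31; 36];
  [:: 45; 46; 36; 32]; [:: 45; 32; 29]; [:: 39; 38; 27; 26]; [:: 47; 39; 26];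
  [:: 47; 41; 34; 39]; [:: 41; 34; 15]; [:: 46; 47; 26; 31]])%num [:: [:: 27;
  26; 0; 1]; [:: 10; 1; 0; 11]; [:: 12; 11; 0; 13]; [:: 14; 13; 0; 15]; [:: 16;
  15; 0; 17]; [:: 18; 17; 0; 19]; [:: 20; 19; 0; 22]; [:: 23; 22; 0; 26];
  [:: 27; 1; 2; 28]; [:: 10; 9; 2; 1]; [:: 29; 28; 2; 3]; [:: 18; 3; 2; 17];
  [:: 16; 17; 2; 21]; [:: 20; 21; 2; 22]; [:: 23; 22; 2; 24]; [:: 44; 24; 2;
  9]; [:: 29; 3; 4; 30]; [:: 18; 19; 4; 3]; [:: 36; 35; 4; 5]; [:: 14; 5; 4;
  15]; [:: 16; 15; 4; 21]; [:: 20; 21; 4; 19]; [:: 31; 30; 4; 33]; [:: 34; 33;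
  4; 35]; [:: 36; 5; 6; 37]; [:: 14; 13; 6; 5]; [:: 42; 45; 6; 41]; [:: 34; 41;
  6; 33]; [:: 31; 33; 6; 32]; [:: 40; 32; 6; 7]; [:: 12; 7; 6; 13]; [:: 38; 37;
  6; 45]; [:: 40; 7; 8; 39]; [:: 12; 11; 8; 7]; [:: 44; 43; 8; 9]; [:: 10; 9;
  8; 11]; [:: 38; 39; 8; 37]; [:: 36; 37; 8; 35]; [:: 34; 35; 8; 41]; [:: 42;
  41; 8; 43]; [:: 23; 24; 25; 26]; [:: 44; 43; 25; 24]; [:: 27; 26; 25; 28];
  [:: 29; 28; 25; 30]; [:: 31; 30; 25; 32]; [:: 40; 32; 25; 39]; [:: 38; 39;
  25; 45]; [:: 42; 45; 25; 43]] [:: (46%num, ([:: 38; 39], [:: 25; 45]));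
  (45%num, ([:: 39; 40], [:: 32; 25])); (29%num, ([:: 40; 7; 6], [:: 32]));
  (28%num, ([:: 6], [:: 33; 31; 32])); (27%num, ([:: 6], [:: 41; 34; 33]));
  (26%num, ([:: 6], [:: 45; 42; 41])); (31%num, ([:: 6; 37; 38], [:: 45]))]
  [:: [:: 1; 0; 1; 0; 1; 2; 1; 0; 1; 0; 2; 1; 0; 1; 0; 1; 2; 1; 0; 1; 2; 0; 1];
  [:: 0; 1; 2; 1; 0; 1; 2; 0; 1; 0; 1; 2; 1; 0; 1; 2; 1]] (6%num, 5%num, 0)
  [::].

Definition data_4e3_5 :=
  MapData 39 ([:: [:: 0; 1; 2; 3]; [:: 4; 5; 1; 0]; [:: 6; 7; 5; 4]; [:: 6; 3;
  2; 7]; [:: 8; 9; 6; 3]; [:: 10; 8; 9; 11]; [:: 12; 13; 8; 10]; [:: 14; 15;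
  13; 12]; [:: 15; 13; 16; 17]; [:: 17; 16; 18; 19]; [:: 16; 18; 4; 0]; [:: 18;
  4; 6; 9; 20]; [:: 20; 21; 11; 9]; [:: 21; 11; 5; 7]; [:: 22; 1; 5; 11; 10];
  [:: 23; 22; 1; 2]; [:: 24; 23; 22; 25]; [:: 25; 22; 10; 12]; [:: 26; 14; 12;
  25; 27]; [:: 27; 28; 24; 25]; [:: 29; 27; 28; 30]; [:: 28; 30; 31; 32];
  [:: 30; 31; 33; 34]; [:: 33; 34; 35; 36]; [:: 34; 35; 37; 38]; [:: 38; 20;
  21; 37]; [:: 19; 18; 20; 38]; [:: 29; 19; 38; 34; 30]; [:: 39; 29; 19; 17];
  [:: 26; 39; 29; 27]; [:: 26; 36; 33; 39]; [:: 26; 14; 32; 36]; [:: 31; 32;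
  14; 15]; [:: 39; 17; 15; 31; 33]; [:: 37; 21; 7; 2; 23]; [:: 35; 37; 23; 24];
  [:: 28; 24; 35; 36; 32]; [:: 13; 8; 3; 0; 16]])%num [:: [:: 0; 1; 10; 37];
  [:: 1; 0; 15; 14]; [:: 15; 0; 3; 34]; [:: 4; 3; 0; 37]; [:: 10; 1; 2; 11];
  [:: 13; 2; 1; 14]; [:: 2; 3; 4; 11]; [:: 3; 2; 13; 34]; [:: 4; 5; 6; 37];
  [:: 12; 5; 4; 11]; [:: 5; 6; 17; 14]; [:: 13; 12; 5; 14]; [:: 17; 6; 7; 18];
  [:: 8; 7; 6; 37]; [:: 7; 32; 31; 18]; [:: 8; 7; 32; 33]; [:: 10; 9; 8; 37];
  [:: 28; 9; 8; 33]; [:: 26; 9; 10; 11]; [:: 26; 9; 28; 27]; [:: 12; 25; 26;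
  11]; [:: 13; 12; 25; 34]; [:: 17; 16; 15; 14]; [:: 15; 16; 35; 34]; [:: 19;
  16; 35; 36]; [:: 17; 16; 19; 18]; [:: 29; 30; 31; 18]; [:: 19; 20; 29; 18];
  [:: 21; 20; 19; 36]; [:: 20; 29; 28; 27]; [:: 22; 21; 20; 27]; [:: 32; 21;
  22; 33]; [:: 21; 32; 31; 36]; [:: 30; 23; 22; 33]; [:: 24; 23; 22; 27];
  [:: 35; 24; 23; 36]; [:: 23; 30; 31; 36]; [:: 25; 24; 35; 34]; [:: 24; 25;
  26; 27]; [:: 28; 29; 30; 33]] [:: (36%num, ([:: 36; 23], [:: 30; 31]));
  (33%num, ([:: 23; 22], [:: 33; 30])); (31%num, ([:: 22; 21], [:: 32; 33]));
  (32%num, ([:: 21; 36], [:: 31; 32]))] [:: [:: 1; 2; 1; 0; 1; 2; 1; 0; 2; 1;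
  2; 0; 1; 2; 0; 1; 2; 1; 0; 1; 0]] (10%num, 22%num, 14) [::].

Definition data_3_4_9_4 :=
  MapData 35 ([:: [:: 0; 1; 2; 3; 4; 5; 6; 7; 8]; [:: 9; 10; 1; 0]; [:: 11; 12;
  13; 14; 9; 10; 15; 16; 17]; [:: 11; 7; 8; 12]; [:: 18; 11; 7]; [:: 19; 18;
  11; 17]; [:: 20; 21; 22; 23; 24; 25; 26; 19; 18]; [:: 20; 15; 10; 21];
  [:: 21; 1; 10]; [:: 21; 22; 2; 1]; [:: 22; 27; 2]; [:: 22; 23; 28; 27];
  [:: 29; 30; 28; 27; 31; 32; 33; 34; 35]; [:: 17; 16; 30; 29]; [:: 5; 30; 16];
  [:: 4; 5; 30; 28]; [:: 23; 4; 28]; [:: 23; 24; 3; 4]; [:: 24; 31; 3]; [:: 24;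
  25; 32; 31]; [:: 25; 13; 32]; [:: 25; 26; 14; 13]; [:: 26; 35; 14]; [:: 26;
  19; 29; 35]; [:: 19; 17; 29]; [:: 35; 34; 9; 14]; [:: 34; 0; 9]; [:: 33; 34;
  0; 8]; [:: 12; 33; 8]; [:: 13; 12; 33; 32]; [:: 31; 27; 2; 3]; [:: 6; 5; 16;
  15]; [:: 20; 6; 15]; [:: 20; 6; 7; 18]])%num [:: [:: 26; 27; 0; 1]; [:: 8; 1;
  0; 9]; [:: 10; 9; 0; 30]; [:: 18; 30; 0; 17]; [:: 16; 17; 0; 15]; [:: 14; 15;
  0; 31]; [:: 32; 31; 0; 33]; [:: 4; 33; 0; 3]; [:: 28; 3; 0; 27]; [:: 26; 25;
  2; 1]; [:: 8; 1; 2; 7]; [:: 4; 5; 2; 3]; [:: 28; 3; 2; 29]; [:: 20; 29; 2;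
  21]; [:: 22; 21; 2; 25]; [:: 32; 7; 2; 31]; [:: 14; 31; 2; 13]; [:: 24; 13;
  2; 5]; [:: 4; 5; 6; 33]; [:: 24; 23; 6; 5]; [:: 32; 33; 6; 7]; [:: 8; 7; 6;
  9]; [:: 10; 9; 6; 11]; [:: 16; 11; 6; 17]; [:: 18; 17; 6; 19]; [:: 20; 19; 6;
  21]; [:: 22; 21; 6; 23]; [:: 10; 11; 12; 30]; [:: 16; 15; 12; 11]; [:: 24;
  23; 12; 13]; [:: 14; 13; 12; 15]; [:: 18; 30; 12; 19]; [:: 20; 19; 12; 29];
  [:: 28; 29; 12; 27]; [:: 26; 27; 12; 25]; [:: 22; 25; 12; 23]]
  [:: (13%num, ([:: 21; 20; 29], [:: 2])); (12%num, ([:: 29; 28], [:: 3; 2]));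
  (8%num, ([:: 28; 27], [:: 0; 3])); (0%num, ([:: 27; 26], [:: 1; 0]));
  (9%num, ([:: 26; 25], [:: 2; 1])); (14%num, ([:: 25; 22; 21], [:: 2]))]
  [:: [:: 1; 0; 1; 2; 1; 0; 1; 0; 1; 0; 1; 2; 1; 0; 1; 2; 1; 0; 1; 0; 1; 2; 0]]
  (35%num, 29%num, 23) [::].

Definition data_3_4_10_4 :=
  MapData 29 ([:: [:: 0; 1; 2; 3; 4; 5; 6; 7; 8; 9]; [:: 10; 11; 1; 0]; [:: 12;
  13; 14; 15; 16; 17; 18; 19; 11; 10]; [:: 12; 8; 9; 13]; [:: 20; 12; 8];
  [:: 21; 20; 12; 10]; [:: 22; 23; 24; 25; 26; 27; 28; 29; 21; 20]; [:: 22; 23;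
  16; 15]; [:: 23; 3; 16]; [:: 23; 24; 4; 3]; [:: 24; 18; 4]; [:: 24; 25; 17;
  18]; [:: 5; 4; 18; 19]; [:: 27; 5; 19]; [:: 27; 28; 6; 5]; [:: 28; 14; 6];
  [:: 28; 29; 13; 14]; [:: 29; 9; 13]; [:: 29; 21; 0; 9]; [:: 21; 10; 0];
  [:: 7; 6; 14; 15]; [:: 22; 7; 15]; [:: 22; 20; 8; 7]; [:: 26; 27; 19; 11];
  [:: 16; 17; 2; 3]; [:: 25; 2; 17]; [:: 25; 26; 1; 2]; [:: 26; 11; 1]])%num
  [:: [:: 19; 18; 0; 1]; [:: 27; 1; 0; 26]; [:: 25; 26; 0; 24]; [:: 8; 24; 0;
  9]; [:: 10; 9; 0; 12]; [:: 13; 12; 0; 14]; [:: 15; 14; 0; 20]; [:: 21; 20; 0;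
  22]; [:: 4; 22; 0; 3]; [:: 17; 3; 0; 18]; [:: 19; 1; 2; 5]; [:: 27; 23; 2;
  1]; [:: 4; 5; 2; 3]; [:: 17; 3; 2; 16]; [:: 15; 16; 2; 20]; [:: 21; 20; 2;
  7]; [:: 8; 7; 2; 24]; [:: 25; 24; 2; 11]; [:: 10; 11; 2; 12]; [:: 13; 12; 2;
  23]; [:: 4; 5; 6; 22]; [:: 19; 18; 6; 5]; [:: 21; 22; 6; 7]; [:: 8; 7; 6; 9];
  [:: 10; 9; 6; 11]; [:: 25; 11; 6; 26]; [:: 27; 26; 6; 23]; [:: 13; 23; 6;
  14]; [:: 15; 14; 6; 16]; [:: 17; 16; 6; 18]] [:: (26%num, ([:: 27; 26],
  [:: 6; 23])); (25%num, ([:: 26; 25], [:: 11; 6])); (17%num, ([:: 25; 24; 2],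
  [:: 11])); (18%num, ([:: 2], [:: 12; 10; 11])); (19%num, ([:: 2], [:: 23; 13;
  12])); (11%num, ([:: 2; 1; 27], [:: 23]))] [:: [:: 1; 0; 1; 2; 1; 0; 1; 0; 2;
  1; 0; 1; 2; 1; 0; 1; 2]; [:: 2; 0; 1; 0; 1; 2; 1; 0; 1; 2; 1; 0; 1; 2; 1; 0;
  1; 0; 1; 0; 1; 0]] (10%num, 11%num, 2) [::].

Definition data_3_5e3 :=
  MapData 29 ([:: [:: 0; 1; 2]; [:: 3; 4; 5; 0; 1]; [:: 6; 4; 3]; [:: 7; 8; 6;
  4; 9]; [:: 4; 5; 10; 11; 9]; [:: 10; 5; 8]; [:: 12; 7; 8; 5; 0]; [:: 13; 12;
  7]; [:: 14; 10; 11; 12; 13]; [:: 12; 0; 2; 15; 11]; [:: 9; 11; 15]; [:: 16;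
  13; 7; 9; 15]; [:: 17; 16; 13; 14; 18]; [:: 18; 14; 19]; [:: 19; 14; 10; 8;
  6]; [:: 20; 21; 19; 6; 3]; [:: 22; 21; 20]; [:: 23; 24; 22; 21; 25]; [:: 21;
  19; 18; 26; 25]; [:: 24; 22; 17; 18; 26]; [:: 27; 28; 17; 22; 20]; [:: 28;
  16; 17]; [:: 29; 2; 15; 16; 28]; [:: 23; 25; 29; 2; 1]; [:: 25; 26; 29];
  [:: 27; 24; 26; 29; 28]; [:: 27; 23; 24]; [:: 27; 23; 1; 3; 20]])%num
  [:: [:: 0; 1; 6; 9]; [:: 0; 23; 27; 1]; [:: 0; 9; 22; 23]; [:: 2; 15; 27; 1];
  [:: 2; 1; 4; 3]; [:: 5; 6; 1; 4]; [:: 2; 3; 14; 15]; [:: 7; 11; 3; 6]; [:: 5;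
  14; 3; 6]; [:: 10; 4; 3; 11]; [:: 5; 4; 8; 14]; [:: 10; 9; 8; 4]; [:: 7; 6;
  9; 8]; [:: 7; 8; 12; 11]; [:: 13; 14; 8; 12]; [:: 10; 11; 22; 9]; [:: 21; 12;
  11; 22]; [:: 21; 20; 19; 12]; [:: 13; 12; 19; 18]; [:: 13; 18; 15; 14];
  [:: 16; 20; 27; 15]; [:: 16; 15; 18; 17]; [:: 16; 17; 19; 20]; [:: 26; 17;
  23; 27]; [:: 26; 25; 19; 17]; [:: 24; 18; 17; 23]; [:: 24; 25; 19; 18];
  [:: 26; 27; 20; 25]; [:: 21; 22; 25; 20]; [:: 24; 23; 22; 25]]
  [:: (24%num, ([:: 19; 17], [:: 26; 25])); (23%num, ([:: 17], [:: 23; 27;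
  26])); (25%num, ([:: 17; 18], [:: 24; 23])); (26%num, ([:: 18; 19], [:: 25;
  24]))] [:: [:: 2; 0; 1; 0; 2; 1; 0; 1; 2; 1; 0; 1; 2; 0; 1]; [:: 0; 1; 0; 1;
  0; 1]] (10%num, 8%num, 5) [::].

Definition data_3_6_4_6 :=
  MapData 23 ([:: [:: 0; 1; 2]; [:: 3; 4; 5; 6; 0; 1]; [:: 5; 6; 7]; [:: 8; 9;
  6; 7; 10; 11]; [:: 11; 12; 10]; [:: 13; 14; 15; 4; 12; 11]; [:: 15; 4; 3];
  [:: 8; 16; 3; 15; 17; 18]; [:: 8; 16; 9]; [:: 16; 9; 19; 14; 20; 21]; [:: 20;
  22; 21]; [:: 23; 17; 20; 22; 5; 7]; [:: 18; 23; 17]; [:: 19; 0; 2; 23; 18;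
  13]; [:: 19; 13; 14]; [:: 23; 7; 10; 2]; [:: 21; 22; 12; 10; 2; 1]; [:: 22;
  12; 4; 5]; [:: 16; 21; 1; 3]; [:: 9; 19; 0; 6]; [:: 14; 15; 17; 20]; [:: 8;
  11; 13; 18]])%num [:: [:: 0; 1; 19; 13]; [:: 0; 16; 18; 1]; [:: 0; 13; 15;
  16]; [:: 6; 7; 18; 1]; [:: 6; 1; 17; 5]; [:: 2; 1; 17; 11]; [:: 2; 3; 19; 1];
  [:: 2; 11; 15; 3]; [:: 8; 7; 21; 3]; [:: 8; 3; 19; 9]; [:: 4; 3; 15; 16];
  [:: 4; 5; 21; 3]; [:: 4; 16; 17; 5]; [:: 14; 5; 21; 13]; [:: 14; 9; 20; 5];
  [:: 6; 5; 20; 7]; [:: 8; 9; 18; 7]; [:: 12; 7; 20; 11]; [:: 12; 13; 21; 7];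
  [:: 14; 13; 19; 9]; [:: 10; 11; 20; 9]; [:: 10; 9; 18; 16]; [:: 10; 16; 17;
  11]; [:: 12; 11; 15; 13]] [:: (20%num, ([:: 9; 10; 11], [:: 20]));
  (17%num, ([:: 11; 12], [:: 7; 20])); (18%num, ([:: 12; 13], [:: 21; 7]));
  (13%num, ([:: 13; 14], [:: 5; 21])); (14%num, ([:: 14; 9], [:: 20; 5]))]
  [:: [:: 1; 2; 0; 1; 0; 1; 2; 1; 0; 1; 2; 1; 0; 1; 2; 0]; [:: 0; 1; 0; 2; 1;
  0; 1; 2; 0; 1; 0; 2; 1; 0; 1; 2; 1]] (22%num, 5%num, 17) [::].

Definition data_4_6_18 :=
  MapData 71 ([:: [:: 0; 1; 2; 3; 4; 5; 6; 7; 8; 9; 10; 11; 12; 13; 14; 15; 16;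
  17]; [:: 18; 19; 0; 1]; [:: 20; 21; 22; 23; 24; 25; 26; 27; 28; 29; 18; 19;
  30; 31; 32; 33; 34; 35]; [:: 36; 37; 20; 21]; [:: 38; 39; 40; 41; 42; 43; 44;
  45; 46; 47; 48; 49; 50; 51; 52; 53; 36; 37]; [:: 54; 55; 38; 39]; [:: 56; 57;
  58; 59; 60; 61; 62; 63; 64; 65; 66; 67; 68; 69; 70; 71; 54; 55]; [:: 56; 57;
  34; 35]; [:: 57; 58; 42; 41; 33; 34]; [:: 40; 41; 33; 32]; [:: 71; 54; 39;
  40; 32; 31]; [:: 70; 71; 31; 30]; [:: 69; 70; 30; 19; 0; 17]; [:: 68; 69; 17;
  16]; [:: 67; 68; 16; 15; 45; 46]; [:: 44; 45; 15; 14]; [:: 59; 60; 13; 14;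
  44; 43]; [:: 60; 61; 12; 13]; [:: 61; 62; 24; 23; 11; 12]; [:: 62; 63; 25;
  24]; [:: 63; 64; 5; 6; 26; 25]; [:: 26; 27; 7; 6]; [:: 64; 65; 4; 5]; [:: 65;
  66; 47; 48; 3; 4]; [:: 48; 49; 2; 3]; [:: 49; 50; 29; 18; 1; 2]; [:: 50; 51;
  28; 29]; [:: 51; 52; 8; 7; 27; 28]; [:: 52; 53; 9; 8]; [:: 53; 36; 21; 22;
  10; 9]; [:: 22; 23; 11; 10]; [:: 66; 67; 46; 47]; [:: 58; 59; 43; 42];
  [:: 56; 55; 38; 37; 20; 35]])%num [:: [:: 1; 12; 0]; [:: 1; 25; 0]; [:: 24;
  25; 0]; [:: 24; 23; 0]; [:: 22; 23; 0]; [:: 22; 20; 0]; [:: 21; 20; 0];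
  [:: 21; 27; 0]; [:: 28; 27; 0]; [:: 28; 29; 0]; [:: 30; 29; 0]; [:: 30; 18;
  0]; [:: 17; 18; 0]; [:: 17; 16; 0]; [:: 15; 16; 0]; [:: 15; 14; 0]; [:: 13;
  14; 0]; [:: 13; 12; 0]; [:: 1; 25; 2]; [:: 1; 12; 2]; [:: 3; 33; 2]; [:: 3;
  29; 2]; [:: 30; 29; 2]; [:: 30; 18; 2]; [:: 19; 18; 2]; [:: 19; 20; 2];
  [:: 21; 20; 2]; [:: 21; 27; 2]; [:: 26; 27; 2]; [:: 26; 25; 2]; [:: 11; 12;
  2]; [:: 11; 10; 2]; [:: 9; 10; 2]; [:: 9; 8; 2]; [:: 7; 8; 2]; [:: 7; 33; 2];
  [:: 3; 29; 4]; [:: 3; 33; 4]; [:: 5; 33; 4]; [:: 5; 10; 4]; [:: 9; 10; 4];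
  [:: 9; 8; 4]; [:: 32; 8; 4]; [:: 32; 16; 4]; [:: 15; 16; 4]; [:: 15; 14; 4];
  [:: 31; 14; 4]; [:: 31; 23; 4]; [:: 24; 23; 4]; [:: 24; 25; 4]; [:: 26; 25;
  4]; [:: 26; 27; 4]; [:: 28; 27; 4]; [:: 28; 29; 4]; [:: 5; 10; 6]; [:: 5; 33;
  6]; [:: 7; 33; 6]; [:: 7; 8; 6]; [:: 32; 8; 6]; [:: 32; 16; 6]; [:: 17; 16;
  6]; [:: 17; 18; 6]; [:: 19; 18; 6]; [:: 19; 20; 6]; [:: 22; 20; 6]; [:: 22;
  23; 6]; [:: 31; 23; 6]; [:: 31; 14; 6]; [:: 13; 14; 6]; [:: 13; 12; 6];
  [:: 11; 12; 6]; [:: 11; 10; 6]] [:: (26%num, ([:: 21; 20], [:: 2]));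
  (25%num, ([:: 20; 19], [:: 2])); (24%num, ([:: 19; 18], [:: 2]));
  (23%num, ([:: 18], [:: 30; 2])); (11%num, ([:: 18; 0], [:: 30]));
  (10%num, ([:: 0], [:: 29; 30])); (9%num, ([:: 0], [:: 28; 29]));
  (8%num, ([:: 0], [:: 27; 28])); (7%num, ([:: 0; 21], [:: 27]));
  (27%num, ([:: 21], [:: 2; 27]))] [:: [:: 2; 1; 0; 1; 0; 1; 0; 1; 0; 1; 0; 1;
  0; 2; 1; 0; 1; 2; 1; 0; 1; 0; 1; 0; 1; 0; 1; 0; 1; 2; 0; 1; 0; 1; 0]]
  (39%num, 40%num, 10) [::].

Definition data_4e3_6 :=
  MapData 23 ([:: [:: 0; 1; 2; 3]; [:: 4; 5; 1; 0]; [:: 6; 7; 5; 4]; [:: 6; 3;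
  2; 7]; [:: 8; 9; 6; 3]; [:: 10; 8; 9; 11]; [:: 12; 13; 10; 8]; [:: 14; 12;
  13; 15]; [:: 16; 17; 14; 12]; [:: 18; 16; 17; 19]; [:: 17; 19; 20; 21];
  [:: 13; 10; 19; 20]; [:: 18; 1; 5; 11; 10; 19]; [:: 21; 11; 5; 7]; [:: 22; 2;
  7; 21; 17; 14]; [:: 22; 18; 1; 2]; [:: 23; 22; 18; 16]; [:: 23; 15; 14; 22];
  [:: 23; 0; 4; 15]; [:: 23; 0; 3; 8; 12; 16]; [:: 15; 13; 20; 9; 6; 4];
  [:: 20; 21; 11; 9]])%num [:: [:: 0; 1; 18; 19]; [:: 1; 0; 15; 12]; [:: 15; 0;
  3; 14]; [:: 4; 3; 0; 19]; [:: 18; 1; 2; 20]; [:: 13; 2; 1; 12]; [:: 2; 3; 4;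
  20]; [:: 3; 2; 13; 14]; [:: 4; 5; 6; 19]; [:: 21; 5; 4; 20]; [:: 5; 6; 11;
  12]; [:: 13; 21; 5; 12]; [:: 6; 7; 8; 19]; [:: 11; 6; 7; 20]; [:: 17; 7; 8;
  14]; [:: 7; 17; 18; 20]; [:: 8; 9; 16; 19]; [:: 10; 9; 8; 14]; [:: 9; 16; 15;
  12]; [:: 9; 10; 11; 12]; [:: 21; 10; 11; 20]; [:: 13; 21; 10; 14]; [:: 15;
  16; 17; 14]; [:: 16; 17; 18; 19]] [:: (13%num, ([:: 6; 7; 20], [:: 11]));
  (20%num, ([:: 20; 21], [:: 10; 11])); (21%num, ([:: 21], [:: 13; 14; 10]));
  (11%num, ([:: 21; 5], [:: 12; 13])); (10%num, ([:: 5; 6], [:: 11; 12]))]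
  [:: [:: 1; 2; 1; 2; 0; 1; 0; 1; 2; 0; 1; 2; 1; 0; 1; 2; 0; 1; 0; 1; 2; 1; 0]]
  (14%num, 15%num, 7) [::].

Definition data_5_4_5_4 :=
  MapData 19 ([:: [:: 0; 1; 2; 3]; [:: 4; 5; 6; 1; 0]; [:: 5; 2; 7; 6]; [:: 8;
  5; 2; 3; 9]; [:: 10; 4; 5; 8]; [:: 11; 12; 13; 10; 4]; [:: 14; 10; 13; 15];
  [:: 16; 17; 8; 10; 14]; [:: 17; 7; 9; 8]; [:: 18; 1; 2; 7; 17]; [:: 15; 6; 1;
  18]; [:: 13; 15; 6; 7; 9]; [:: 12; 13; 9; 3]; [:: 19; 0; 3; 12; 16]; [:: 19;
  11; 4; 0]; [:: 19; 11; 14; 15; 18]; [:: 16; 14; 11; 12]; [:: 19; 16; 17;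
  18]])%num [:: [:: 1; 14; 13; 0]; [:: 9; 10; 1; 0]; [:: 3; 2; 9; 0]; [:: 13;
  12; 3; 0]; [:: 1; 14; 5; 4]; [:: 3; 4; 1; 2]; [:: 1; 10; 11; 2]; [:: 11; 8;
  9; 2]; [:: 7; 8; 3; 4]; [:: 3; 12; 11; 8]; [:: 5; 6; 7; 4]; [:: 5; 14; 15;
  16]; [:: 5; 16; 13; 12]; [:: 11; 12; 5; 6]; [:: 7; 16; 15; 6]; [:: 11; 6; 15;
  10]; [:: 7; 17; 13; 16]; [:: 9; 17; 7; 8]; [:: 15; 17; 9; 10]; [:: 13; 14;
  15; 17]] [:: (12%num, ([:: 13; 12; 5], [:: 16])); (11%num, ([:: 5; 14],
  [:: 15; 16])); (19%num, ([:: 14; 13], [:: 17; 15])); (16%num, ([:: 13],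
  [:: 16; 7; 17]))] [:: [:: 2; 0; 1; 0; 1; 2; 1; 0; 1; 2; 1; 0; 1; 2; 1];
  [:: 2; 1; 0; 2; 1; 2; 0; 1; 0; 1; 2; 1; 0; 1]] (2%num, 3%num, 0) [::].

Definition data_4_6_14 :=
  MapData 167 ([:: [:: 0; 1; 2; 3; 4; 5]; [:: 0; 1; 6; 7]; [:: 8; 9; 10; 11; 6;
  7]; [:: 8; 9; 12; 13]; [:: 14; 15; 16; 17; 12; 13]; [:: 14; 15; 18; 19];
  [:: 20; 21; 19; 18; 22; 23]; [:: 20; 21; 24; 25]; [:: 26; 27; 28; 29; 24;
  25]; [:: 26; 27; 30; 31]; [:: 32; 33; 30; 31; 34; 35]; [:: 32; 33; 36; 37];
  [:: 38; 39; 37; 36; 40; 41]; [:: 39; 38; 42; 43]; [:: 41; 38; 42; 44; 45; 46;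
  47; 48; 49; 50; 51; 52; 53; 54]; [:: 46; 55; 56; 57; 58; 45]; [:: 55; 46; 47;
  59]; [:: 48; 60; 61; 62; 59; 47]; [:: 48; 60; 63; 49]; [:: 50; 64; 65; 66;
  63; 49]; [:: 64; 50; 51; 67]; [:: 52; 68; 69; 70; 67; 51]; [:: 52; 68; 71;
  53]; [:: 53; 71; 72; 73; 74; 54]; [:: 75; 76; 77; 78; 79; 80; 81; 82; 83; 84;
  72; 71; 68; 69]; [:: 76; 85; 86; 87; 88; 75]; [:: 85; 76; 77; 89]; [:: 78;
  90; 91; 92; 89; 77]; [:: 90; 78; 79; 93]; [:: 80; 94; 95; 96; 93; 79];
  [:: 94; 80; 81; 97]; [:: 98; 82; 81; 97; 99; 100]; [:: 82; 98; 101; 83];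
  [:: 102; 103; 101; 83; 84; 104]; [:: 103; 102; 105; 106]; [:: 107; 108; 106;
  105; 109; 110]; [:: 107; 108; 111; 112]; [:: 113; 114; 111; 112; 115; 116];
  [:: 113; 114; 117; 118]; [:: 119; 120; 121; 122; 117; 118]; [:: 119; 120;
  123; 124]; [:: 125; 126; 127; 128; 123; 124]; [:: 125; 126; 129; 130];
  [:: 131; 132; 133; 134; 129; 130]; [:: 132; 131; 35; 34]; [:: 116; 113; 118;
  119; 124; 125; 130; 131; 35; 32; 37; 39; 43; 135]; [:: 44; 136; 137; 135; 43;
  42]; [:: 138; 139; 140; 141; 142; 143; 110; 107; 112; 115; 137; 136; 58; 57];
  [:: 139; 144; 145; 146; 147; 138]; [:: 139; 144; 148; 140]; [:: 141; 149;
  150; 151; 148; 140]; [:: 149; 141; 142; 152]; [:: 143; 153; 154; 155; 152;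
  142]; [:: 143; 153; 109; 110]; [:: 104; 102; 105; 109; 153; 154; 28; 27; 30;
  33; 36; 40; 74; 73]; [:: 84; 104; 73; 72]; [:: 29; 28; 154; 155]; [:: 5; 0;
  7; 8; 13; 14; 19; 21; 24; 29; 155; 152; 149; 150]; [:: 5; 4; 151; 150];
  [:: 3; 4; 151; 148; 144; 145; 134; 129; 126; 127; 92; 89; 85; 86]; [:: 2; 3;
  86; 87]; [:: 1; 2; 87; 88; 70; 67; 64; 65; 156; 157; 158; 159; 11; 6];
  [:: 160; 158; 159; 161; 162; 163]; [:: 158; 160; 164; 157]; [:: 165; 166;
  167; 156; 157; 164]; [:: 166; 165; 100; 99]; [:: 163; 160; 164; 165; 100; 98;
  101; 103; 106; 108; 111; 114; 117; 122]; [:: 162; 163; 122; 121]; [:: 9; 10;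
  161; 162; 121; 120; 123; 128; 91; 90; 93; 96; 17; 12]; [:: 11; 10; 161; 159];
  [:: 17; 16; 95; 96]; [:: 15; 16; 95; 94; 97; 99; 166; 167; 66; 63; 60; 61;
  22; 18]; [:: 156; 167; 66; 65]; [:: 23; 22; 61; 62]; [:: 23; 20; 25; 26; 31;
  34; 132; 133; 146; 147; 56; 55; 59; 62]; [:: 92; 91; 128; 127]; [:: 88; 75;
  69; 70]; [:: 146; 145; 134; 133]; [:: 41; 40; 74; 54]; [:: 147; 138; 57; 56];
  [:: 115; 116; 135; 137]; [:: 136; 44; 45; 58]])%num [:: [:: 1; 0; 57]; [:: 1;
  0; 61]; [:: 60; 0; 61]; [:: 60; 0; 59]; [:: 58; 0; 59]; [:: 58; 0; 57];
  [:: 1; 2; 61]; [:: 1; 2; 57]; [:: 3; 2; 57]; [:: 3; 2; 68]; [:: 69; 2; 68];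
  [:: 69; 2; 61]; [:: 3; 4; 68]; [:: 3; 4; 57]; [:: 5; 4; 57]; [:: 5; 4; 71];
  [:: 70; 4; 71]; [:: 70; 4; 68]; [:: 5; 6; 71]; [:: 5; 6; 57]; [:: 7; 6; 74];
  [:: 7; 6; 57]; [:: 73; 6; 71]; [:: 73; 6; 74]; [:: 7; 8; 57]; [:: 7; 8; 74];
  [:: 9; 8; 74]; [:: 9; 8; 54]; [:: 56; 8; 54]; [:: 56; 8; 57]; [:: 9; 10; 54];
  [:: 9; 10; 74]; [:: 11; 10; 45]; [:: 11; 10; 54]; [:: 44; 10; 74]; [:: 44;
  10; 45]; [:: 11; 12; 54]; [:: 11; 12; 45]; [:: 13; 12; 14]; [:: 13; 12; 45];
  [:: 78; 12; 54]; [:: 78; 12; 14]; [:: 13; 46; 14]; [:: 13; 46; 45]; [:: 81;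
  46; 14]; [:: 81; 15; 14]; [:: 16; 15; 14]; [:: 16; 17; 14]; [:: 18; 17; 14];
  [:: 18; 19; 14]; [:: 20; 19; 14]; [:: 20; 21; 14]; [:: 22; 21; 14]; [:: 22;
  23; 14]; [:: 78; 23; 14]; [:: 16; 15; 74]; [:: 79; 15; 74]; [:: 79; 15; 47];
  [:: 81; 15; 47]; [:: 16; 17; 74]; [:: 18; 17; 71]; [:: 73; 17; 71]; [:: 73;
  17; 74]; [:: 18; 19; 71]; [:: 20; 19; 61]; [:: 72; 19; 61]; [:: 72; 19; 71];
  [:: 20; 21; 61]; [:: 22; 21; 24]; [:: 76; 21; 24]; [:: 76; 21; 61]; [:: 22;
  23; 24]; [:: 55; 23; 24]; [:: 55; 23; 54]; [:: 78; 23; 54]; [:: 76; 25; 24];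
  [:: 26; 25; 24]; [:: 26; 27; 24]; [:: 28; 27; 24]; [:: 28; 29; 24]; [:: 30;
  29; 24]; [:: 30; 31; 24]; [:: 32; 31; 24]; [:: 32; 33; 24]; [:: 55; 33; 24];
  [:: 26; 25; 59]; [:: 60; 25; 59]; [:: 60; 25; 61]; [:: 76; 25; 61]; [:: 26;
  27; 59]; [:: 28; 27; 68]; [:: 75; 27; 68]; [:: 75; 27; 59]; [:: 28; 29; 68];
  [:: 30; 29; 71]; [:: 70; 29; 71]; [:: 70; 29; 68]; [:: 30; 31; 71]; [:: 32;
  31; 66]; [:: 65; 31; 71]; [:: 65; 31; 66]; [:: 32; 33; 66]; [:: 34; 33; 54];
  [:: 34; 33; 66]; [:: 55; 33; 54]; [:: 34; 35; 54]; [:: 34; 35; 66]; [:: 36;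
  35; 47]; [:: 36; 35; 66]; [:: 53; 35; 54]; [:: 53; 35; 47]; [:: 36; 37; 66];
  [:: 36; 37; 47]; [:: 38; 37; 45]; [:: 38; 37; 66]; [:: 80; 37; 47]; [:: 80;
  37; 45]; [:: 38; 39; 66]; [:: 38; 39; 45]; [:: 40; 39; 45]; [:: 40; 39; 68];
  [:: 67; 39; 68]; [:: 67; 39; 66]; [:: 40; 41; 68]; [:: 40; 41; 45]; [:: 42;
  41; 45]; [:: 42; 41; 59]; [:: 75; 41; 59]; [:: 75; 41; 68]; [:: 42; 43; 59];
  [:: 42; 43; 45]; [:: 44; 43; 45]; [:: 44; 43; 74]; [:: 77; 43; 74]; [:: 77;
  43; 59]; [:: 80; 46; 45]; [:: 81; 46; 47]; [:: 80; 46; 47]; [:: 79; 48; 47];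
  [:: 49; 48; 47]; [:: 49; 50; 47]; [:: 51; 50; 47]; [:: 51; 52; 47]; [:: 53;
  52; 47]; [:: 49; 48; 59]; [:: 77; 48; 59]; [:: 77; 48; 74]; [:: 79; 48; 74];
  [:: 49; 50; 59]; [:: 51; 50; 57]; [:: 58; 50; 57]; [:: 58; 50; 59]; [:: 51;
  52; 57]; [:: 53; 52; 54]; [:: 56; 52; 54]; [:: 56; 52; 57]; [:: 72; 64; 61];
  [:: 63; 64; 61]; [:: 63; 62; 61]; [:: 69; 62; 61]; [:: 63; 62; 66]; [:: 69;
  62; 68]; [:: 67; 62; 68]; [:: 67; 62; 66]; [:: 63; 64; 66]; [:: 65; 64; 66];
  [:: 65; 64; 71]; [:: 72; 64; 71]] [:: (34%num, ([:: 44], [:: 74; 10]));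
  (132%num, ([:: 44; 43], [:: 74])); (133%num, ([:: 43; 77], [:: 74]));
  (146%num, ([:: 77; 48], [:: 74])); (147%num, ([:: 48; 79], [:: 74]));
  (56%num, ([:: 79], [:: 15; 74])); (57%num, ([:: 79; 47], [:: 15]));
  (58%num, ([:: 47], [:: 81; 15])); (136%num, ([:: 47; 46], [:: 81]));
  (44%num, ([:: 46], [:: 14; 81])); (42%num, ([:: 46], [:: 13; 14]));
  (43%num, ([:: 46; 45], [:: 13])); (39%num, ([:: 45], [:: 12; 13]));
  (37%num, ([:: 45], [:: 11; 12])); (32%num, ([:: 45], [:: 10; 11]));
  (35%num, ([:: 45; 44], [:: 10]))] [:: [:: 0; 2; 1; 0; 1; 0; 1; 0; 1; 2; 1; 0;
  1; 0; 2; 1; 0; 1; 0; 2; 1; 0; 1; 2; 0; 1; 0; 1; 0; 1; 0; 1; 0; 1; 0; 1; 2; 1;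
  0; 1]; [:: 2; 1; 0; 1; 0; 1; 0; 1; 0; 2; 1; 0; 1; 0; 2; 1; 0; 1; 0; 1; 0; 1;
  2; 0; 1; 0; 1; 2; 0; 1; 0; 1; 0; 1; 0; 1; 2; 1; 0; 1; 0]] (17%num, 12%num, 4)
  [::].

Definition data_4_6_16 :=
  MapData 95 ([:: [:: 0; 1; 2; 3; 4; 5; 6; 7; 8; 9; 10; 11; 12; 13; 14; 15];
  [:: 16; 17; 0; 1]; [:: 18; 19; 20; 21; 22; 23; 24; 25; 26; 27; 16; 17; 28;
  29; 30; 31]; [:: 32; 33; 18; 19]; [:: 34; 35; 36; 37; 38; 39; 40; 41; 32; 33;
  42; 43; 44; 45; 46; 47]; [:: 48; 49; 34; 35]; [:: 50; 51; 52; 53; 54; 55; 56;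
  57; 48; 49; 58; 59; 60; 61; 62; 63]; [:: 64; 65; 50; 51]; [:: 66; 67; 68; 69;
  70; 71; 72; 73; 74; 75; 76; 77; 78; 79; 64; 65]; [:: 80; 81; 66; 67]; [:: 82;
  83; 84; 85; 86; 87; 88; 89; 90; 91; 92; 93; 94; 80; 81; 95]; [:: 82; 83; 71;
  72; 61; 62]; [:: 72; 73; 60; 61]; [:: 90; 91; 59; 60; 73; 74]; [:: 91; 92;
  58; 59]; [:: 92; 93; 47; 34; 49; 58]; [:: 93; 94; 46; 47]; [:: 94; 80; 67;
  68; 45; 46]; [:: 68; 69; 44; 45]; [:: 84; 85; 43; 44; 69; 70]; [:: 85; 86;
  42; 43]; [:: 86; 87; 31; 18; 33; 42]; [:: 87; 88; 30; 31]; [:: 88; 89; 75;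
  76; 29; 30]; [:: 76; 77; 28; 29]; [:: 77; 78; 15; 0; 17; 28]; [:: 78; 79; 14;
  15]; [:: 79; 64; 51; 52; 13; 14]; [:: 52; 53; 12; 13]; [:: 53; 54; 22; 21;
  11; 12]; [:: 54; 55; 23; 22]; [:: 55; 56; 5; 6; 24; 23]; [:: 56; 57; 4; 5];
  [:: 57; 48; 35; 36; 3; 4]; [:: 36; 37; 2; 3]; [:: 37; 38; 27; 16; 1; 2];
  [:: 38; 39; 26; 27]; [:: 39; 40; 8; 7; 25; 26]; [:: 24; 25; 7; 6]; [:: 40;
  41; 9; 8]; [:: 41; 32; 19; 20; 10; 9]; [:: 20; 21; 11; 10]; [:: 89; 90; 74;
  75]; [:: 83; 84; 70; 71]; [:: 82; 95; 63; 62]; [:: 81; 95; 63; 50; 65;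
  66]])%num [:: [:: 1; 25; 0]; [:: 1; 35; 0]; [:: 34; 35; 0]; [:: 34; 33; 0];
  [:: 32; 33; 0]; [:: 32; 31; 0]; [:: 38; 31; 0]; [:: 38; 37; 0]; [:: 39; 37;
  0]; [:: 39; 40; 0]; [:: 41; 40; 0]; [:: 41; 29; 0]; [:: 28; 29; 0]; [:: 28;
  27; 0]; [:: 26; 27; 0]; [:: 26; 25; 0]; [:: 1; 35; 2]; [:: 1; 25; 2]; [:: 3;
  21; 2]; [:: 3; 40; 2]; [:: 41; 40; 2]; [:: 41; 29; 2]; [:: 30; 29; 2];
  [:: 30; 31; 2]; [:: 38; 31; 2]; [:: 38; 37; 2]; [:: 36; 37; 2]; [:: 36; 35;
  2]; [:: 24; 25; 2]; [:: 24; 23; 2]; [:: 22; 23; 2]; [:: 22; 21; 2]; [:: 3;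
  40; 4]; [:: 3; 21; 4]; [:: 5; 15; 4]; [:: 5; 33; 4]; [:: 34; 33; 4]; [:: 34;
  35; 4]; [:: 36; 35; 4]; [:: 36; 37; 4]; [:: 39; 37; 4]; [:: 39; 40; 4];
  [:: 20; 21; 4]; [:: 20; 19; 4]; [:: 18; 19; 4]; [:: 18; 17; 4]; [:: 16; 17;
  4]; [:: 16; 15; 4]; [:: 5; 33; 6]; [:: 5; 15; 6]; [:: 7; 45; 6]; [:: 7; 27;
  6]; [:: 28; 27; 6]; [:: 28; 29; 6]; [:: 30; 29; 6]; [:: 30; 31; 6]; [:: 32;
  31; 6]; [:: 32; 33; 6]; [:: 14; 15; 6]; [:: 14; 13; 6]; [:: 12; 13; 6];
  [:: 12; 11; 6]; [:: 44; 11; 6]; [:: 44; 45; 6]; [:: 7; 27; 8]; [:: 7; 45; 8];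
  [:: 9; 45; 8]; [:: 9; 17; 8]; [:: 18; 17; 8]; [:: 18; 19; 8]; [:: 43; 19; 8];
  [:: 43; 11; 8]; [:: 12; 11; 8]; [:: 12; 13; 8]; [:: 42; 13; 8]; [:: 42; 23;
  8]; [:: 24; 23; 8]; [:: 24; 25; 8]; [:: 26; 25; 8]; [:: 26; 27; 8]; [:: 9;
  17; 10]; [:: 9; 45; 10]; [:: 44; 11; 10]; [:: 43; 11; 10]; [:: 43; 19; 10];
  [:: 20; 19; 10]; [:: 20; 21; 10]; [:: 22; 21; 10]; [:: 22; 23; 10]; [:: 42;
  23; 10]; [:: 42; 13; 10]; [:: 14; 13; 10]; [:: 14; 15; 10]; [:: 16; 15; 10];
  [:: 16; 17; 10]; [:: 44; 45; 10]] [:: (23%num, ([:: 31; 30], [:: 2]));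
  (22%num, ([:: 30; 29], [:: 2])); (21%num, ([:: 29], [:: 41; 2]));
  (11%num, ([:: 29; 0], [:: 41])); (10%num, ([:: 0], [:: 40; 41]));
  (9%num, ([:: 0], [:: 39; 40])); (8%num, ([:: 0], [:: 37; 39]));
  (7%num, ([:: 0], [:: 38; 37])); (6%num, ([:: 0; 31], [:: 38]));
  (24%num, ([:: 31], [:: 2; 38]))] [:: [:: 0; 1; 2; 1; 0; 1; 0; 1; 0; 1; 0; 1;
  2; 0; 1; 0; 1; 2; 1; 0; 1; 0; 1; 2; 0; 1]; [:: 0; 1; 0; 2; 1; 0; 1; 0; 1; 0;
  1; 0; 2; 1; 0; 1; 2; 1; 0; 1; 0; 1; 0; 1; 0; 1; 0; 1; 2; 1]]
  (70%num, 84%num, 19) [::].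

Definition data_4_6_20 :=
  MapData 59 ([:: [:: 0; 1; 2; 3]; [:: 4; 5; 6; 7; 8; 9; 10; 11; 12; 13; 14;
  15; 16; 17; 18; 19; 0; 1; 20; 21]; [:: 16; 17; 22; 23]; [:: 24; 18; 17; 22;
  25; 26]; [:: 26; 27; 28; 25]; [:: 29; 30; 31; 32; 33; 34; 35; 36; 37; 38; 39;
  40; 41; 42; 43; 44; 45; 24; 26; 27]; [:: 45; 24; 18; 19]; [:: 44; 46; 3; 0;
  19; 45]; [:: 39; 40; 47; 48]; [:: 38; 20; 1; 2; 48; 39]; [:: 37; 38; 20; 21];
  [:: 49; 4; 21; 37; 36; 50]; [:: 35; 36; 50; 51]; [:: 49; 52; 53; 54; 55; 56;
  28; 25; 22; 23; 57; 46; 3; 2; 48; 47; 58; 59; 51; 50]; [:: 12; 13; 58; 59];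
  [:: 40; 47; 58; 13; 14; 41]; [:: 41; 42; 15; 14]; [:: 42; 15; 16; 23; 57;
  43]; [:: 43; 44; 46; 57]; [:: 34; 11; 12; 59; 51; 35]; [:: 33; 34; 11; 10];
  [:: 32; 54; 55; 9; 10; 33]; [:: 8; 9; 55; 56]; [:: 7; 29; 27; 28; 56; 8];
  [:: 6; 7; 29; 30]; [:: 5; 52; 53; 31; 30; 6]; [:: 31; 32; 54; 53]; [:: 49; 4;
  5; 52]])%num [:: [:: 0; 7; 1]; [:: 0; 9; 1]; [:: 0; 9; 13]; [:: 0; 7; 13];
  [:: 27; 11; 1]; [:: 27; 25; 1]; [:: 24; 25; 1]; [:: 24; 23; 1]; [:: 22; 23;
  1]; [:: 22; 21; 1]; [:: 20; 21; 1]; [:: 20; 19; 1]; [:: 14; 19; 1]; [:: 14;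
  15; 1]; [:: 16; 15; 1]; [:: 16; 17; 1]; [:: 2; 17; 1]; [:: 2; 3; 1]; [:: 6;
  3; 1]; [:: 6; 7; 1]; [:: 10; 9; 1]; [:: 10; 11; 1]; [:: 2; 3; 13]; [:: 2; 17;
  13]; [:: 6; 3; 5]; [:: 4; 3; 13]; [:: 4; 3; 5]; [:: 4; 23; 5]; [:: 4; 23;
  13]; [:: 24; 23; 5]; [:: 24; 25; 5]; [:: 26; 25; 5]; [:: 26; 21; 5]; [:: 20;
  21; 5]; [:: 20; 19; 5]; [:: 12; 19; 5]; [:: 12; 11; 5]; [:: 10; 11; 5];
  [:: 10; 9; 5]; [:: 8; 9; 5]; [:: 8; 15; 5]; [:: 16; 15; 5]; [:: 16; 17; 5];
  [:: 18; 17; 5]; [:: 18; 7; 5]; [:: 6; 7; 5]; [:: 18; 7; 13]; [:: 8; 15; 13];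
  [:: 8; 9; 13]; [:: 27; 11; 13]; [:: 12; 11; 13]; [:: 12; 19; 13]; [:: 27; 25;
  13]; [:: 26; 25; 13]; [:: 26; 21; 13]; [:: 22; 21; 13]; [:: 22; 23; 13];
  [:: 18; 17; 13]; [:: 14; 15; 13]; [:: 14; 19; 13]] [:: (44%num, ([:: 7; 5],
  [:: 18])); (43%num, ([:: 5], [:: 17; 18])); (42%num, ([:: 5], [:: 16; 17]));
  (41%num, ([:: 5], [:: 15; 16])); (40%num, ([:: 5; 8], [:: 15]));
  (47%num, ([:: 8], [:: 13; 15])); (48%num, ([:: 8; 9], [:: 13]));
  (2%num, ([:: 9; 0], [:: 13])); (3%num, ([:: 0; 7], [:: 13]));
  (46%num, ([:: 7], [:: 18; 13]))] [:: [:: 1; 0; 2; 1; 0; 1; 0; 1; 0; 2; 1; 0;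
  1; 0; 2; 1; 0; 1; 0; 1; 0; 1; 0; 1; 0; 1; 0; 1; 2; 1; 0]]
  (33%num, 10%num, 20) [:: (15%num, 1); (14%num, 1); (41%num, 2); (42%num, 2);
  (11%num, 1); (10%num, 1); (9%num, 1); (8%num, 1); (7%num, 1); (6%num, 1);
  (5%num, 1); (4%num, 1); (21%num, 1); (20%num, 1); (1%num, 1); (0%num, 1);
  (19%num, 1); (18%num, 1); (17%num, 1); (16%num, 1); (13%num, 1); (12%num, 1);
  (24%num, 1); (45%num, 1); (22%num, 1); (26%num, 1); (25%num, 1); (28%num, 1);
  (27%num, 1); (56%num, 1); (55%num, 1); (54%num, 1); (53%num, 1); (52%num, 1);
  (49%num, 1); (50%num, 1); (51%num, 1); (59%num, 1); (58%num, 1); (47%num, 2);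
  (48%num, 2); (2%num, 2); (3%num, 2); (46%num, 2); (57%num, 1); (23%num, 1);
  (43%num, 2); (39%num, 2); (40%num, 2); (34%num, 1); (35%num, 1); (36%num, 1);
  (33%num, 1); (32%num, 1); (31%num, 1); (30%num, 1); (29%num, 1); (44%num, 1);
  (38%num, 1); (37%num, 1)].

Definition data_4_8_10 :=
  MapData 79 ([:: [:: 0; 1; 2; 3; 4; 5; 6; 7]; [:: 8; 9; 10; 11; 12; 13; 14;
  15; 0; 1]; [:: 14; 15; 16; 17; 18; 19; 20; 21]; [:: 15; 16; 7; 0]; [:: 22;
  23; 24; 25; 17; 16; 7; 6; 26; 27]; [:: 10; 11; 28; 29; 26; 27; 30; 31];
  [:: 11; 28; 32; 12]; [:: 12; 13; 33; 34; 35; 36; 37; 32]; [:: 13; 33; 21;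
  14]; [:: 38; 39; 40; 41; 42; 43; 34; 33; 21; 20]; [:: 42; 43; 44; 45; 46; 47;
  48; 49]; [:: 43; 44; 35; 34]; [:: 44; 45; 50; 51; 3; 2; 52; 53; 36; 35];
  [:: 54; 55; 53; 52; 8; 9; 56; 57]; [:: 58; 59; 54; 55; 37; 32; 28; 29; 5; 4];
  [:: 50; 51; 58; 59; 60; 61; 62; 63]; [:: 51; 58; 4; 3]; [:: 59; 60; 57; 54];
  [:: 64; 65; 30; 31; 56; 57; 60; 61; 66; 67]; [:: 68; 69; 38; 39; 70; 71; 66;
  67]; [:: 72; 73; 68; 69; 19; 18; 74; 75; 49; 48]; [:: 40; 41; 75; 74; 25; 24;
  76; 77]; [:: 41; 75; 49; 42]; [:: 74; 25; 17; 18]; [:: 23; 78; 76; 24];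
  [:: 64; 65; 22; 23; 78; 79; 72; 73]; [:: 65; 22; 27; 30]; [:: 79; 72; 48;
  47]; [:: 64; 73; 68; 67]; [:: 69; 38; 20; 19]; [:: 39; 70; 77; 40]; [:: 78;
  79; 47; 46; 63; 62; 71; 70; 77; 76]; [:: 45; 46; 63; 50]; [:: 71; 66; 61;
  62]; [:: 9; 56; 31; 10]; [:: 55; 53; 36; 37]; [:: 29; 26; 6; 5]; [:: 52; 8;
  1; 2]])%num [:: [:: 3; 0; 1]; [:: 37; 0; 1]; [:: 37; 0; 12]; [:: 16; 0; 12];
  [:: 16; 0; 14]; [:: 36; 0; 14]; [:: 36; 0; 4]; [:: 3; 0; 4]; [:: 37; 13; 1];
  [:: 34; 13; 1]; [:: 34; 5; 1]; [:: 6; 5; 1]; [:: 6; 7; 1]; [:: 8; 7; 1];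
  [:: 8; 2; 1]; [:: 3; 2; 1]; [:: 3; 2; 4]; [:: 23; 2; 4]; [:: 23; 2; 20];
  [:: 29; 2; 20]; [:: 29; 2; 9]; [:: 8; 2; 9]; [:: 26; 25; 4]; [:: 24; 25; 4];
  [:: 24; 21; 4]; [:: 23; 21; 4]; [:: 36; 5; 4]; [:: 26; 5; 4]; [:: 6; 5; 14];
  [:: 36; 5; 14]; [:: 26; 5; 18]; [:: 34; 5; 18]; [:: 6; 7; 14]; [:: 8; 7; 9];
  [:: 11; 7; 9]; [:: 11; 7; 12]; [:: 35; 7; 12]; [:: 35; 7; 14]; [:: 29; 19;
  9]; [:: 30; 19; 9]; [:: 30; 21; 9]; [:: 22; 21; 9]; [:: 22; 10; 9]; [:: 11;
  10; 9]; [:: 11; 10; 12]; [:: 32; 10; 12]; [:: 32; 10; 31]; [:: 27; 10; 31];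
  [:: 27; 10; 20]; [:: 22; 10; 20]; [:: 32; 15; 12]; [:: 16; 15; 12]; [:: 37;
  13; 12]; [:: 35; 13; 12]; [:: 17; 13; 14]; [:: 35; 13; 14]; [:: 34; 13; 18];
  [:: 17; 13; 18]; [:: 16; 15; 14]; [:: 17; 15; 14]; [:: 17; 15; 18]; [:: 33;
  15; 18]; [:: 33; 15; 31]; [:: 32; 15; 31]; [:: 28; 25; 18]; [:: 26; 25; 18];
  [:: 33; 19; 18]; [:: 28; 19; 18]; [:: 28; 19; 20]; [:: 29; 19; 20]; [:: 30;
  19; 31]; [:: 33; 19; 31]; [:: 27; 25; 20]; [:: 28; 25; 20]; [:: 23; 21; 20];
  [:: 22; 21; 20]; [:: 24; 21; 31]; [:: 30; 21; 31]; [:: 24; 25; 31]; [:: 27;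
  25; 31]] [:: (42%num, ([:: 10; 9], [:: 22])); (41%num, ([:: 9], [:: 21;
  22])); (40%num, ([:: 9; 30], [:: 21])); (77%num, ([:: 30; 31], [:: 21]));
  (76%num, ([:: 31], [:: 24; 21])); (78%num, ([:: 31], [:: 25; 24]));
  (79%num, ([:: 31], [:: 27; 25])); (47%num, ([:: 31; 10], [:: 27]));
  (48%num, ([:: 10], [:: 20; 27])); (49%num, ([:: 10], [:: 22; 20]))]
  [:: [:: 1; 0; 2; 1; 0; 1; 0; 2; 1; 0; 1; 2; 0; 1; 0; 1; 0; 1; 0; 1; 2; 1; 0];
  [:: 1; 0; 1; 0; 1; 2; 1; 0; 1; 0; 1; 0; 1; 2; 0; 1; 0; 1; 2; 0; 1; 0; 1; 2;
  0; 1; 0]] (3%num, 4%num, 0) [::].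

Definition data_4_8_12 :=
  MapData 47 ([:: [:: 0; 1; 2; 3; 4; 5; 6; 7]; [:: 8; 9; 0; 1]; [:: 10; 11; 12;
  13; 14; 15; 8; 9]; [:: 16; 17; 10; 11]; [:: 18; 19; 20; 21; 22; 23; 16; 17];
  [:: 24; 25; 18; 19]; [:: 26; 27; 28; 29; 30; 31; 24; 25]; [:: 32; 33; 26;
  27]; [:: 34; 35; 36; 37; 38; 39; 32; 33]; [:: 40; 41; 34; 35]; [:: 42; 43;
  44; 45; 46; 40; 41; 47]; [:: 42; 43; 28; 27; 32; 39; 12; 11; 16; 23; 5; 6];
  [:: 22; 23; 5; 4]; [:: 44; 45; 14; 13; 38; 37; 21; 22; 4; 3; 30; 29]; [:: 30;
  31; 2; 3]; [:: 38; 39; 12; 13]; [:: 36; 37; 21; 20]; [:: 46; 40; 35; 36; 20;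
  19; 24; 31; 2; 1; 8; 15]; [:: 45; 46; 15; 14]; [:: 43; 44; 29; 28]; [:: 42;
  47; 7; 6]; [:: 41; 47; 7; 0; 9; 10; 17; 18; 25; 26; 33; 34]])%num [:: [:: 1;
  0; 21]; [:: 1; 0; 17]; [:: 14; 0; 17]; [:: 14; 0; 13]; [:: 12; 0; 13];
  [:: 12; 0; 11]; [:: 20; 0; 11]; [:: 20; 0; 21]; [:: 1; 2; 17]; [:: 1; 2; 21];
  [:: 3; 2; 21]; [:: 3; 2; 11]; [:: 15; 2; 11]; [:: 15; 2; 13]; [:: 18; 2; 13];
  [:: 18; 2; 17]; [:: 3; 4; 11]; [:: 3; 4; 21]; [:: 5; 4; 21]; [:: 5; 4; 17];
  [:: 16; 4; 17]; [:: 16; 4; 13]; [:: 12; 4; 13]; [:: 12; 4; 11]; [:: 5; 6;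
  17]; [:: 5; 6; 21]; [:: 7; 6; 21]; [:: 7; 6; 11]; [:: 19; 6; 11]; [:: 19; 6;
  13]; [:: 14; 6; 13]; [:: 14; 6; 17]; [:: 7; 8; 11]; [:: 7; 8; 21]; [:: 9; 8;
  21]; [:: 9; 8; 17]; [:: 16; 8; 17]; [:: 16; 8; 13]; [:: 15; 8; 13]; [:: 15;
  8; 11]; [:: 9; 10; 17]; [:: 9; 10; 21]; [:: 20; 10; 11]; [:: 19; 10; 11];
  [:: 19; 10; 13]; [:: 18; 10; 13]; [:: 18; 10; 17]; [:: 20; 10; 21]]
  [:: (29%num, ([:: 13], [:: 19; 6])); (44%num, ([:: 13], [:: 10; 19]));
  (45%num, ([:: 13; 18], [:: 10])); (46%num, ([:: 18], [:: 17; 10]));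
  (15%num, ([:: 18; 2], [:: 17])); (8%num, ([:: 2; 1], [:: 17]));
  (1%num, ([:: 1; 0], [:: 17])); (2%num, ([:: 0; 14], [:: 17]));
  (31%num, ([:: 14], [:: 6; 17])); (30%num, ([:: 14; 13], [:: 6]))] [:: [:: 0;
  2; 1; 0; 2; 1; 2; 0; 1; 0; 1; 0; 1; 2; 0; 1; 0; 1; 2; 0; 1; 0; 1]; [:: 0; 1;
  0; 1; 2; 0; 1; 2; 0; 1; 0; 2; 1; 0; 1; 0; 1; 2; 0; 1; 0; 1; 2]]
  (23%num, 16%num, 11) [:: (43%num, 0); (44%num, 1); (45%num, 1); (46%num, 1);
  (40%num, 0); (41%num, 0); (47%num, 0); (42%num, 0); (29%num, 1); (28%num, 0);
  (27%num, 0); (26%num, 0); (25%num, 0); (24%num, 0); (31%num, 1); (30%num, 1);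
  (33%num, 0); (32%num, 0); (39%num, 0); (38%num, 0); (37%num, 0); (36%num, 0);
  (35%num, 0); (34%num, 0); (13%num, 0); (12%num, 0); (11%num, 0); (10%num, 0);
  (9%num, 0); (8%num, 1); (15%num, 1); (14%num, 1); (17%num, 0); (16%num, 0);
  (23%num, 0); (22%num, 0); (21%num, 0); (20%num, 0); (19%num, 0); (18%num, 0);
  (4%num, 0); (5%num, 0); (7%num, 0); (0%num, 0); (1%num, 1); (2%num, 1);
  (3%num, 1); (6%num, 0)].

Definition data_6e2_7 :=
  MapData 83 ([:: [:: 0; 1; 2; 3; 4; 5]; [:: 6; 7; 8; 9; 0; 1]; [:: 10; 11; 6;
  7; 12; 13]; [:: 14; 15; 10; 11; 16; 17]; [:: 18; 19; 20; 21; 14; 15]; [:: 22;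
  23; 18; 19; 24; 25]; [:: 26; 27; 28; 29; 22; 23]; [:: 30; 31; 26; 27; 21;
  20]; [:: 32; 33; 30; 31; 13; 12]; [:: 34; 35; 36; 37; 32; 33]; [:: 38; 39;
  34; 35; 29; 28]; [:: 39; 34; 33; 30; 20; 19; 24]; [:: 40; 41; 25; 22; 29; 35;
  36]; [:: 41; 42; 38; 39; 24; 25]; [:: 43; 40; 41; 42; 17; 16]; [:: 44; 45;
  43; 40; 36; 37]; [:: 46; 47; 44; 45; 2; 3]; [:: 48; 49; 46; 47; 8; 9];
  [:: 50; 51; 48; 49; 52; 53]; [:: 54; 55; 56; 57; 50; 51]; [:: 58; 59; 54; 55;
  60; 61]; [:: 62; 63; 58; 59; 5; 4]; [:: 64; 65; 62; 63; 66; 67]; [:: 68; 69;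
  64; 65; 52; 53]; [:: 70; 71; 72; 73; 68; 69]; [:: 74; 75; 70; 71; 61; 60];
  [:: 76; 77; 78; 79; 74; 75]; [:: 80; 81; 76; 77; 57; 56]; [:: 82; 83; 80; 81;
  67; 66]; [:: 82; 83; 79; 78; 73; 72]; [:: 83; 80; 56; 55; 60; 74; 79];
  [:: 77; 78; 73; 68; 53; 50; 57]; [:: 82; 66; 63; 58; 61; 71; 72]; [:: 81; 76;
  75; 70; 69; 64; 67]; [:: 65; 62; 4; 3; 46; 49; 52]; [:: 59; 54; 51; 48; 9; 0;
  5]; [:: 47; 44; 37; 32; 12; 7; 8]; [:: 45; 43; 16; 11; 6; 1; 2]; [:: 42; 38;
  28; 27; 21; 14; 17]; [:: 31; 26; 23; 18; 15; 10; 13]])%num [:: [:: 0; 1; 35];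
  [:: 1; 0; 37]; [:: 0; 16; 37]; [:: 16; 0; 34]; [:: 0; 21; 34]; [:: 21; 0;
  35]; [:: 1; 2; 37]; [:: 2; 1; 36]; [:: 1; 17; 36]; [:: 17; 1; 35]; [:: 2; 3;
  39]; [:: 3; 2; 37]; [:: 2; 8; 36]; [:: 8; 2; 39]; [:: 3; 4; 38]; [:: 4; 3;
  39]; [:: 3; 14; 37]; [:: 14; 3; 38]; [:: 4; 5; 39]; [:: 5; 4; 11]; [:: 4; 7;
  11]; [:: 7; 4; 38]; [:: 5; 6; 12]; [:: 6; 5; 39]; [:: 5; 13; 11]; [:: 13; 5;
  12]; [:: 6; 7; 39]; [:: 7; 6; 38]; [:: 6; 10; 38]; [:: 10; 6; 12]; [:: 7; 8;
  11]; [:: 8; 7; 39]; [:: 8; 9; 36]; [:: 9; 8; 11]; [:: 9; 10; 11]; [:: 10; 9;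
  12]; [:: 9; 15; 12]; [:: 15; 9; 36]; [:: 10; 13; 38]; [:: 13; 10; 11];
  [:: 15; 14; 12]; [:: 13; 14; 12]; [:: 14; 13; 38]; [:: 14; 15; 37]; [:: 15;
  16; 36]; [:: 16; 15; 37]; [:: 16; 17; 34]; [:: 17; 16; 36]; [:: 17; 18; 35];
  [:: 18; 17; 34]; [:: 18; 19; 31]; [:: 19; 18; 35]; [:: 18; 23; 34]; [:: 23;
  18; 31]; [:: 19; 20; 35]; [:: 20; 19; 30]; [:: 19; 27; 30]; [:: 27; 19; 31];
  [:: 20; 21; 32]; [:: 21; 20; 35]; [:: 20; 25; 30]; [:: 25; 20; 32]; [:: 21;
  22; 34]; [:: 22; 21; 32]; [:: 22; 23; 33]; [:: 23; 22; 34]; [:: 22; 28; 32];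
  [:: 28; 22; 33]; [:: 23; 24; 31]; [:: 24; 23; 33]; [:: 24; 25; 33]; [:: 25;
  24; 32]; [:: 24; 29; 32]; [:: 29; 24; 31]; [:: 25; 26; 30]; [:: 26; 25; 33];
  [:: 26; 27; 33]; [:: 27; 26; 31]; [:: 26; 29; 31]; [:: 29; 26; 30]; [:: 27;
  28; 30]; [:: 28; 27; 33]; [:: 28; 29; 32]; [:: 29; 28; 30]]
  [:: (24%num, ([:: 11], [:: 5; 13])); (19%num, ([:: 11], [:: 4; 5]));
  (20%num, ([:: 11; 7], [:: 4])); (21%num, ([:: 7], [:: 38; 4]));
  (27%num, ([:: 7; 6], [:: 38])); (28%num, ([:: 6; 10], [:: 38]));
  (38%num, ([:: 10], [:: 13; 38])); (39%num, ([:: 10; 11], [:: 13]))]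
  [:: [:: 2; 1; 0; 1; 0; 2; 1; 0; 1; 2; 0; 1; 0; 1; 0; 1; 2; 0; 1; 0; 1];
  [:: 0; 1; 0; 2; 1; 0; 1; 2; 0; 1; 0; 1; 2; 0; 1; 0; 1; 2; 0; 1]]
  (75%num, 70%num, 25) [::].

Definition data_8_6e2 :=
  MapData 47 ([:: [:: 0; 1; 2; 3; 4; 5; 6; 7]; [:: 8; 9; 10; 11; 0; 1]; [:: 10;
  11; 12; 13; 14; 15; 16; 17]; [:: 18; 19; 12; 11; 0; 7]; [:: 19; 20; 5; 4; 13;
  12]; [:: 21; 22; 3; 4; 13; 14]; [:: 23; 24; 25; 26; 27; 21; 22; 28]; [:: 29;
  30; 23; 24; 31; 32]; [:: 33; 34; 35; 8; 9; 32; 31; 36]; [:: 20; 37; 33; 34;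
  6; 5]; [:: 38; 39; 40; 18; 19; 20; 37; 41]; [:: 22; 28; 38; 39; 2; 3];
  [:: 39; 40; 35; 8; 1; 2]; [:: 40; 18; 7; 6; 34; 35]; [:: 42; 41; 38; 28; 23;
  30]; [:: 42; 43; 44; 45; 46; 47; 29; 30]; [:: 42; 41; 37; 33; 36; 43];
  [:: 43; 44; 25; 24; 31; 36]; [:: 44; 45; 15; 16; 26; 25]; [:: 46; 47; 17; 16;
  26; 27]; [:: 47; 29; 32; 9; 10; 17]; [:: 45; 46; 27; 21; 14; 15]])%num
  [:: [:: 0; 1; 3]; [:: 0; 12; 1]; [:: 0; 11; 12]; [:: 0; 5; 11]; [:: 0; 4; 5];
  [:: 0; 9; 4]; [:: 0; 13; 9]; [:: 0; 3; 13]; [:: 8; 1; 12]; [:: 8; 20; 1];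
  [:: 2; 1; 20]; [:: 2; 3; 1]; [:: 2; 4; 3]; [:: 2; 5; 4]; [:: 2; 21; 5];
  [:: 2; 18; 21]; [:: 2; 19; 18]; [:: 2; 20; 19]; [:: 10; 3; 13]; [:: 10; 4;
  3]; [:: 10; 9; 4]; [:: 6; 5; 21]; [:: 6; 11; 5]; [:: 6; 7; 14]; [:: 6; 17;
  7]; [:: 6; 18; 17]; [:: 6; 19; 18]; [:: 6; 21; 19]; [:: 6; 14; 11]; [:: 15;
  7; 20]; [:: 15; 14; 7]; [:: 8; 17; 7]; [:: 8; 7; 20]; [:: 8; 9; 16]; [:: 8;
  13; 9]; [:: 8; 12; 13]; [:: 8; 16; 17]; [:: 10; 16; 9]; [:: 10; 11; 14];
  [:: 10; 12; 11]; [:: 10; 13; 12]; [:: 10; 14; 16]; [:: 15; 16; 14]; [:: 15;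
  17; 16]; [:: 15; 18; 17]; [:: 15; 21; 18]; [:: 15; 19; 21]; [:: 15; 20; 19]]
  [:: (19%num, ([:: 4; 3], [:: 10])); (18%num, ([:: 3], [:: 13; 10]));
  (7%num, ([:: 3; 0], [:: 13])); (6%num, ([:: 0], [:: 9; 13])); (5%num, ([:: 0;
  4], [:: 9])); (20%num, ([:: 4], [:: 10; 9]))] [:: [:: 1; 0; 1; 2; 0; 1; 2; 0;
  1; 2; 0; 1; 2; 0; 1; 0; 1; 2; 0]; [:: 2; 1; 0; 1; 0; 2; 1; 0; 1; 2; 1; 0; 1;
  0; 1; 2; 1; 0; 1]] (44%num, 43%num, 17) [::].

Definition data_9_6e2 :=
  MapData 35 ([:: [:: 0; 1; 2; 3; 4; 5; 6; 7; 8]; [:: 9; 10; 11; 12; 0; 1];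
  [:: 11; 12; 13; 14; 15; 16; 17; 18; 19]; [:: 20; 21; 8; 0; 12; 13]; [:: 22;
  23; 24; 20; 21; 25; 26; 27; 28]; [:: 23; 24; 5; 4; 29; 30]; [:: 27; 28; 31;
  29; 4; 3]; [:: 26; 27; 3; 2; 16; 17]; [:: 32; 9; 1; 2; 16; 15]; [:: 31; 29;
  30; 33; 34; 35; 32; 9; 10]; [:: 22; 23; 30; 33; 18; 19]; [:: 25; 26; 17; 18;
  33; 34]; [:: 21; 25; 34; 35; 7; 8]; [:: 35; 32; 15; 14; 6; 7]; [:: 24; 20;
  13; 14; 6; 5]; [:: 22; 28; 31; 10; 11; 19]])%num [:: [:: 0; 1; 3]; [:: 0; 8;
  1]; [:: 0; 7; 8]; [:: 0; 6; 7]; [:: 0; 5; 6]; [:: 0; 14; 5]; [:: 0; 13; 14];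
  [:: 0; 12; 13]; [:: 0; 3; 12]; [:: 9; 1; 8]; [:: 9; 15; 1]; [:: 2; 1; 15];
  [:: 2; 3; 1]; [:: 2; 14; 3]; [:: 2; 13; 14]; [:: 2; 8; 13]; [:: 2; 7; 8];
  [:: 2; 11; 7]; [:: 2; 10; 11]; [:: 2; 15; 10]; [:: 4; 3; 14]; [:: 4; 12; 3];
  [:: 4; 10; 15]; [:: 4; 5; 10]; [:: 4; 14; 5]; [:: 4; 11; 12]; [:: 4; 7; 11];
  [:: 4; 6; 7]; [:: 4; 15; 6]; [:: 9; 5; 6]; [:: 9; 10; 5]; [:: 9; 6; 15];
  [:: 9; 8; 13]; [:: 9; 11; 10]; [:: 9; 12; 11]; [:: 9; 13; 12]]
  [:: (31%num, ([:: 15; 9], [:: 6])); (29%num, ([:: 9], [:: 5; 6]));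
  (30%num, ([:: 9; 10], [:: 5])); (23%num, ([:: 10], [:: 4; 5]));
  (22%num, ([:: 10; 15], [:: 4])); (28%num, ([:: 15], [:: 6; 4]))] [:: [:: 1;
  2; 1; 0; 1; 0; 2; 1; 0; 1; 0; 2; 1; 0; 1; 2; 0; 1; 0; 1; 0; 1; 0; 1; 0]]
  (3%num, 4%num, 0) [::].

Definition data_10_6e2 :=
  MapData 29 ([:: [:: 0; 1; 2; 3; 4; 5; 6; 7; 8; 9]; [:: 10; 11; 12; 13; 0; 1];
  [:: 12; 13; 14; 15; 16; 17; 18; 19; 20; 21]; [:: 22; 23; 14; 13; 0; 9];
  [:: 24; 22; 9; 8; 17; 16]; [:: 25; 26; 7; 8; 17; 18]; [:: 27; 25; 26; 28; 29;
  24; 22; 23; 10; 11]; [:: 27; 25; 18; 19; 6; 5]; [:: 26; 28; 20; 19; 6; 7];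
  [:: 28; 29; 3; 4; 21; 20]; [:: 29; 24; 16; 15; 2; 3]; [:: 23; 10; 1; 2; 15;
  14]; [:: 27; 11; 12; 21; 4; 5]])%num [:: [:: 0; 1; 3]; [:: 0; 11; 1]; [:: 0;
  10; 11]; [:: 0; 9; 10]; [:: 0; 12; 9]; [:: 0; 7; 12]; [:: 0; 8; 7]; [:: 0; 5;
  8]; [:: 0; 4; 5]; [:: 0; 3; 4]; [:: 6; 1; 11]; [:: 6; 12; 1]; [:: 2; 1; 12];
  [:: 2; 3; 1]; [:: 2; 11; 3]; [:: 2; 10; 11]; [:: 2; 4; 10]; [:: 2; 5; 4];
  [:: 2; 7; 5]; [:: 2; 8; 7]; [:: 2; 9; 8]; [:: 2; 12; 9]; [:: 6; 3; 4]; [:: 6;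
  11; 3]; [:: 6; 4; 10]; [:: 6; 5; 7]; [:: 6; 8; 5]; [:: 6; 7; 12]; [:: 6; 9;
  8]; [:: 6; 10; 9]] [:: (23%num, ([:: 3], [:: 6; 11])); (22%num, ([:: 3; 4],
  [:: 6])); (24%num, ([:: 4], [:: 10; 6])); (16%num, ([:: 4; 2], [:: 10]));
  (15%num, ([:: 2], [:: 11; 10])); (14%num, ([:: 2; 3], [:: 11]))] [:: [:: 1;
  0; 1; 0; 2; 1; 0; 1; 0; 1; 2; 0; 1; 0; 1; 2; 0; 1; 0; 1; 2]; [:: 0; 2; 1; 0;
  2; 1; 0; 2; 1; 0; 2; 1; 0; 1; 2; 1; 0; 1]] (21%num, 20%num, 9) [::].

Definition data_5_8e2 :=
  MapData 39 ([:: [:: 0; 1; 2; 3; 4; 5; 6; 7]; [:: 8; 9; 0; 1; 10; 11; 12; 13];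
  [:: 14; 15; 16; 17; 18; 19; 8; 9]; [:: 20; 21; 14; 15; 22; 23; 12; 13];
  [:: 21; 14; 9; 0; 7]; [:: 24; 25; 16; 15; 22]; [:: 26; 24; 25; 27; 28; 29;
  30; 31]; [:: 32; 33; 34; 35; 19; 18; 30; 31]; [:: 34; 35; 20; 21; 7; 6; 11;
  10]; [:: 35; 20; 13; 8; 19]; [:: 33; 34; 10; 1; 2]; [:: 28; 29; 36; 37; 32;
  33; 2; 3]; [:: 29; 36; 17; 18; 30]; [:: 38; 27; 25; 16; 17; 36; 37; 39];
  [:: 38; 39; 26; 24; 22; 23; 5; 4]; [:: 39; 26; 31; 32; 37]; [:: 5; 6; 11; 12;
  23]; [:: 38; 27; 28; 3; 4]])%num [:: [:: 4; 0; 1]; [:: 10; 1; 0]; [:: 10; 0;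
  11]; [:: 17; 11; 0]; [:: 17; 0; 14]; [:: 16; 14; 0]; [:: 16; 0; 8]; [:: 4; 8;
  0]; [:: 9; 1; 2]; [:: 4; 2; 1]; [:: 10; 1; 8]; [:: 16; 8; 1]; [:: 16; 1; 3];
  [:: 9; 3; 1]; [:: 4; 2; 3]; [:: 5; 3; 2]; [:: 5; 2; 13]; [:: 12; 13; 2];
  [:: 12; 2; 7]; [:: 9; 7; 2]; [:: 9; 3; 8]; [:: 4; 8; 3]; [:: 5; 3; 14];
  [:: 16; 14; 3]; [:: 5; 14; 6]; [:: 5; 6; 13]; [:: 15; 6; 14]; [:: 17; 13; 6];
  [:: 17; 11; 6]; [:: 12; 6; 11]; [:: 12; 7; 6]; [:: 15; 6; 7]; [:: 15; 7; 11];
  [:: 10; 11; 7]; [:: 10; 8; 7]; [:: 9; 7; 8]; [:: 12; 11; 13]; [:: 15; 13;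
  11]; [:: 17; 14; 13]; [:: 15; 13; 14]] [:: (20%num, ([:: 8; 9], [:: 3]));
  (13%num, ([:: 9; 1], [:: 3])); (12%num, ([:: 1], [:: 16; 3]));
  (11%num, ([:: 1; 8], [:: 16])); (6%num, ([:: 8], [:: 0; 16]));
  (7%num, ([:: 8], [:: 4; 0])); (21%num, ([:: 8], [:: 3; 4]))] [:: [:: 1; 0; 1;
  0; 2; 1; 0; 1; 2; 0; 1; 0; 1; 2; 0]; [:: 0; 1; 0; 1; 0; 1; 0; 2; 1; 0; 1; 2;
  1; 0; 1; 0; 1; 2]] (27%num, 25%num, 13) [::].

Definition data_6_8e2 :=
  MapData 23 ([:: [:: 0; 1; 2; 3; 4; 5; 6; 7]; [:: 8; 9; 10; 11; 12; 13; 0; 1];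
  [:: 14; 15; 6; 5; 9; 10]; [:: 15; 16; 17; 18; 19; 20; 7; 6]; [:: 19; 20; 21;
  22; 8; 9; 5; 4]; [:: 23; 21; 20; 7; 0; 13]; [:: 23; 14; 15; 16; 2; 3; 12;
  13]; [:: 23; 21; 22; 17; 18; 11; 10; 14]; [:: 16; 17; 22; 8; 1; 2]; [:: 18;
  19; 4; 3; 12; 11]])%num [:: [:: 5; 0; 1]; [:: 8; 1; 0]; [:: 8; 0; 6]; [:: 9;
  6; 0]; [:: 9; 0; 4]; [:: 2; 4; 0]; [:: 2; 0; 3]; [:: 5; 3; 0]; [:: 8; 1; 4];
  [:: 2; 4; 1]; [:: 2; 1; 7]; [:: 9; 7; 1]; [:: 9; 1; 6]; [:: 5; 6; 1]; [:: 2;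
  7; 6]; [:: 2; 3; 6]; [:: 8; 6; 3]; [:: 8; 3; 7]; [:: 9; 7; 3]; [:: 9; 4; 3];
  [:: 5; 3; 4]; [:: 5; 4; 7]; [:: 8; 7; 4]; [:: 5; 6; 7]] [:: (9%num, ([:: 4],
  [:: 1; 2])); (8%num, ([:: 4; 8], [:: 1])); (1%num, ([:: 8], [:: 0; 1]));
  (2%num, ([:: 8; 6], [:: 0])); (3%num, ([:: 6; 9], [:: 0])); (4%num, ([:: 9;
  4], [:: 0])); (5%num, ([:: 4], [:: 2; 0]))] [:: [:: 2; 1; 0; 1; 0; 2; 1; 0;
  1; 2; 0; 1; 0; 1; 0]; [:: 0; 2; 1; 0; 1; 0; 1; 0; 2; 1; 0; 1; 2; 1; 0; 1; 0;
  1]] (17%num, 18%num, 3) [:: (4%num, 1); (5%num, 2); (6%num, 1); (7%num, 1);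
  (0%num, 1); (1%num, 2); (2%num, 1); (3%num, 1); (9%num, 2); (8%num, 2);
  (22%num, 1); (21%num, 1); (20%num, 1); (19%num, 1); (17%num, 1); (16%num, 1);
  (15%num, 1); (14%num, 1); (23%num, 1); (13%num, 1); (12%num, 1); (11%num, 1);
  (10%num, 1); (18%num, 1)].

Definition data_4_10e2 :=
  MapData 39 ([:: [:: 0; 1; 2; 3; 4; 5; 6; 7; 8; 9]; [:: 10; 11; 1; 2]; [:: 12;
  13; 14; 10; 2; 3; 15; 16; 17; 18]; [:: 11; 19; 17; 18; 20; 21; 22; 23; 0; 1];
  [:: 14; 10; 11; 19; 24; 25; 26; 27; 9; 8]; [:: 19; 17; 16; 24]; [:: 28; 29;
  30; 31; 32; 33; 25; 24; 16; 15]; [:: 34; 35; 33; 32; 36; 37; 12; 13; 7; 6];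
  [:: 30; 31; 38; 39; 34; 35; 26; 27; 23; 22]; [:: 31; 38; 36; 32]; [:: 28; 4;
  5; 39; 38; 36; 37; 20; 21; 29]; [:: 28; 4; 3; 15]; [:: 39; 34; 6; 5]; [:: 37;
  12; 18; 20]; [:: 29; 30; 22; 21]; [:: 35; 33; 25; 26]; [:: 23; 0; 9; 27];
  [:: 13; 14; 8; 7]])%num [:: [:: 16; 0; 3]; [:: 1; 3; 0]; [:: 1; 0; 2];
  [:: 11; 2; 0]; [:: 11; 0; 10]; [:: 12; 10; 0]; [:: 12; 0; 7]; [:: 17; 7; 0];
  [:: 17; 0; 4]; [:: 16; 4; 0]; [:: 1; 2; 4]; [:: 1; 3; 4]; [:: 13; 2; 7];
  [:: 17; 7; 2]; [:: 17; 4; 2]; [:: 11; 2; 6]; [:: 5; 6; 2]; [:: 5; 3; 2];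
  [:: 13; 2; 3]; [:: 5; 4; 3]; [:: 13; 3; 10]; [:: 14; 10; 3]; [:: 14; 3; 8];
  [:: 16; 8; 3]; [:: 5; 4; 6]; [:: 15; 6; 4]; [:: 15; 4; 8]; [:: 16; 8; 4];
  [:: 11; 6; 10]; [:: 14; 10; 6]; [:: 14; 8; 6]; [:: 9; 6; 8]; [:: 9; 6; 7];
  [:: 15; 7; 6]; [:: 12; 7; 8]; [:: 15; 8; 7]; [:: 9; 7; 10]; [:: 13; 10; 7];
  [:: 9; 8; 10]; [:: 12; 10; 8]] [:: (11%num, ([:: 1], [:: 3; 4]));
  (1%num, ([:: 1; 0], [:: 3])); (0%num, ([:: 0], [:: 16; 3])); (9%num, ([:: 0],
  [:: 4; 16])); (8%num, ([:: 0; 17], [:: 4])); (14%num, ([:: 17; 2], [:: 4]));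
  (10%num, ([:: 2; 1], [:: 4]))] [:: [:: 0; 1; 0; 1; 0; 2; 1; 0; 1; 2; 0; 1; 0;
  1; 2; 1; 0; 1]; [:: 2; 1; 0; 1; 0; 1; 0; 1; 2; 1; 0; 1; 0; 1; 0; 1; 2; 0; 1;
  0; 1]] (32%num, 33%num, 7) [::].

Definition data_3_14e2 :=
  MapData 83 ([:: [:: 0; 1; 2; 3; 4; 5; 6; 7; 8; 9; 10; 11; 12; 13]; [:: 14;
  15; 16; 17; 18; 19; 20; 21; 22; 23; 24; 25; 1; 0]; [:: 20; 26; 19]; [:: 20;
  21; 27; 28; 29; 30; 31; 32; 33; 34; 8; 9; 35; 26]; [:: 13; 12; 36; 37; 38;
  39; 30; 29; 40; 41; 42; 43; 15; 14]; [:: 12; 36; 11]; [:: 26; 35; 10; 11; 36;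
  37; 44; 45; 46; 47; 48; 49; 18; 19]; [:: 38; 44; 37]; [:: 38; 39; 31; 32; 50;
  51; 52; 53; 54; 55; 56; 57; 45; 44]; [:: 30; 31; 39]; [:: 33; 50; 32];
  [:: 51; 50; 33; 34; 7; 6; 58; 59; 60; 61; 62; 63; 64; 65]; [:: 2; 3; 66; 67;
  53; 52; 65; 64; 68; 69; 70; 71; 24; 25]; [:: 4; 66; 3]; [:: 59; 58; 5; 4; 66;
  67; 54; 55; 72; 73; 74; 75; 76; 77]; [:: 16; 17; 49; 48; 78; 79; 61; 60; 77;
  76; 80; 81; 42; 43]; [:: 18; 49; 17]; [:: 48; 78; 47]; [:: 56; 57; 46; 47;
  78; 79; 62; 63; 68; 69; 82; 83; 73; 72]; [:: 46; 57; 45]; [:: 62; 79; 61];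
  [:: 68; 63; 64]; [:: 70; 82; 69]; [:: 82; 83; 74; 75; 80; 81; 41; 40; 28; 27;
  22; 23; 71; 70]; [:: 74; 83; 73]; [:: 80; 75; 76]; [:: 42; 81; 41]; [:: 40;
  28; 29]; [:: 22; 27; 21]; [:: 24; 71; 23]; [:: 56; 72; 55]; [:: 60; 77; 59];
  [:: 16; 43; 15]; [:: 6; 58; 5]; [:: 54; 67; 53]; [:: 52; 65; 51]; [:: 2; 25;
  1]; [:: 8; 34; 7]; [:: 10; 35; 9]; [:: 0; 14; 13]])%num [:: [:: 39; 0; 1];
  [:: 36; 1; 0]; [:: 36; 0; 12]; [:: 13; 12; 0]; [:: 13; 0; 14]; [:: 33; 14;
  0]; [:: 33; 0; 11]; [:: 37; 11; 0]; [:: 37; 0; 3]; [:: 38; 3; 0]; [:: 38; 0;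
  6]; [:: 5; 6; 0]; [:: 5; 0; 4]; [:: 39; 4; 0]; [:: 39; 1; 4]; [:: 32; 4; 1];
  [:: 32; 1; 15]; [:: 16; 15; 1]; [:: 16; 1; 6]; [:: 2; 6; 1]; [:: 2; 1; 3];
  [:: 28; 3; 1]; [:: 28; 1; 23]; [:: 29; 23; 1]; [:: 29; 1; 12]; [:: 36; 12;
  1]; [:: 2; 6; 3]; [:: 28; 3; 23]; [:: 27; 23; 3]; [:: 27; 3; 4]; [:: 9; 4;
  3]; [:: 9; 3; 8]; [:: 10; 8; 3]; [:: 10; 3; 11]; [:: 37; 11; 3]; [:: 38; 3;
  6]; [:: 5; 4; 6]; [:: 7; 6; 4]; [:: 7; 4; 8]; [:: 9; 8; 4]; [:: 27; 4; 23];
  [:: 26; 23; 4]; [:: 26; 4; 15]; [:: 32; 15; 4]; [:: 7; 6; 8]; [:: 19; 8; 6];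
  [:: 19; 6; 18]; [:: 17; 18; 6]; [:: 17; 6; 15]; [:: 16; 15; 6]; [:: 10; 8;
  11]; [:: 35; 11; 8]; [:: 35; 8; 12]; [:: 34; 12; 8]; [:: 34; 8; 14]; [:: 30;
  14; 8]; [:: 30; 8; 18]; [:: 19; 18; 8]; [:: 33; 11; 14]; [:: 31; 14; 11];
  [:: 31; 11; 15]; [:: 20; 15; 11]; [:: 20; 11; 18]; [:: 21; 18; 11]; [:: 21;
  11; 12]; [:: 35; 12; 11]; [:: 13; 12; 14]; [:: 34; 14; 12]; [:: 21; 12; 18];
  [:: 22; 18; 12]; [:: 22; 12; 23]; [:: 29; 23; 12]; [:: 30; 14; 18]; [:: 24;
  18; 14]; [:: 24; 14; 23]; [:: 25; 23; 14]; [:: 25; 14; 15]; [:: 31; 15; 14];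
  [:: 17; 15; 18]; [:: 20; 18; 15]; [:: 25; 15; 23]; [:: 26; 23; 15]; [:: 22;
  18; 23]; [:: 24; 23; 18]] [:: (18%num, ([:: 6; 16], [:: 1]));
  (17%num, ([:: 16; 15], [:: 1])); (16%num, ([:: 15; 32], [:: 1]));
  (15%num, ([:: 32; 4], [:: 1])); (14%num, ([:: 4], [:: 39; 1]));
  (13%num, ([:: 4], [:: 0; 39])); (12%num, ([:: 4; 5], [:: 0]));
  (11%num, ([:: 5; 6], [:: 0])); (10%num, ([:: 6], [:: 38; 0]));
  (35%num, ([:: 6], [:: 3; 38])); (26%num, ([:: 6], [:: 2; 3]));
  (19%num, ([:: 6], [:: 1; 2]))] [:: [:: 0; 1; 0; 1; 0; 2; 1; 0; 1; 0; 1; 0; 1;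
  2; 0; 1; 0; 1; 2; 0; 1; 0; 1; 2; 0; 1; 0; 1]; [:: 2; 1; 0; 1; 0; 2; 1; 0; 1;
  0; 2; 1; 0; 1; 2; 0; 1; 0; 1; 2; 0; 1; 0; 1; 0; 1; 0; 1; 0]]
  (83%num, 82%num, 18) [::].

Definition data_7e3 :=
  MapData 27 ([:: [:: 0; 1; 2; 3; 4; 5; 6]; [:: 7; 0; 1; 8; 9; 10; 11]; [:: 12;
  13; 14; 15; 8; 1; 2]; [:: 14; 7; 0; 6; 16; 17; 15]; [:: 18; 19; 12; 13; 5; 6;
  16]; [:: 20; 21; 18; 19; 22; 10; 9]; [:: 23; 20; 21; 24; 3; 4; 25]; [:: 13;
  14; 7; 11; 25; 4; 5]; [:: 26; 27; 23; 25; 11; 10; 22]; [:: 27; 23; 20; 9; 8;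
  15; 17]; [:: 26; 24; 21; 18; 16; 17; 27]; [:: 26; 24; 3; 2; 12; 19; 22]])%num
  [:: [:: 0; 1; 3]; [:: 0; 2; 1]; [:: 0; 11; 2]; [:: 0; 6; 11]; [:: 0; 7; 6];
  [:: 0; 4; 7]; [:: 0; 3; 4]; [:: 1; 3; 7]; [:: 1; 9; 2]; [:: 1; 5; 9]; [:: 1;
  8; 5]; [:: 1; 7; 8]; [:: 2; 4; 11]; [:: 7; 2; 4]; [:: 3; 7; 2]; [:: 3; 2; 9];
  [:: 3; 10; 4]; [:: 3; 9; 10]; [:: 4; 5; 10]; [:: 4; 11; 5]; [:: 5; 6; 9];
  [:: 5; 10; 6]; [:: 5; 8; 11]; [:: 6; 9; 8]; [:: 6; 11; 10]; [:: 7; 6; 8];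
  [:: 8; 10; 11]; [:: 9; 8; 10]] [:: (0%num, ([:: 3], [:: 0; 1]));
  (6%num, ([:: 3; 4], [:: 0])); (5%num, ([:: 4], [:: 7; 0])); (13%num, ([:: 4;
  2], [:: 7])); (14%num, ([:: 2; 3], [:: 7])); (7%num, ([:: 3], [:: 1; 7]))]
  [:: [:: 1; 0; 2; 1; 0; 1; 2; 0; 1; 0; 1; 2; 0; 1; 0]; [:: 0; 2; 1; 0; 1; 0;
  2; 1; 0; 1; 2; 1; 0; 1; 0; 1]] (24%num, 21%num, 10) [::].

(** The order is that of [types], since [all2] runs through both lists in parallel. *)
Definition all_data := [:: data_3e7; data_3e5_4; data_3e4_4e2; data_3e3_4_3_4;
  data_3e5_5; data_3e4_7; data_3e4_8; data_3e4_9; data_3e4_10; data_3e2_5_3_5;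
  data_3e3_4_6; data_3e2_4_3_6; data_3_4_3_4e2; data_3_4e4; data_3_7_3_7;
  data_3_4_7_4; data_3_4_8_4; data_4e3_5; data_3_4_9_4; data_3_4_10_4;
  data_3_5e3; data_3_6_4_6; data_4_6_18; data_4e3_6; data_5_4_5_4; data_4_6_14;
  data_4_6_16; data_4_6_20; data_4_8_10; data_4_8_12; data_6e2_7; data_8_6e2;
  data_9_6e2; data_10_6e2; data_5_8e2; data_6_8e2; data_4_10e2; data_3_14e2;
  data_7e3].

Lemma all2_exists (S : eqType) (T : Type) (r : S -> T -> bool) s t :
  all2 r s t -> forall x, x \in s -> exists y, r x y.
Proof.
elim: s t => [|x s IHs] [|y t] //= /andP[rxy /IHs IH] z.
by rewrite inE => /orP[/eqP->|/IH//]; exists y.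
Qed.

(** A single evaluation, free of [m], verifies the thirty-nine certificates; no covering is ever
    computed. *)
Lemma all_data_ok : all2 check types all_data.
Proof. by vm_compute. Qed.

Theorem corollary1p1 (X : seq (nat * nat)) (hX : X \in types)
    (m : nat) (hm : 2 <= m) :
  exists K Km : cell_complex,
    [/\ semi_equivelar K X /\ euler_char K = (- 2%:Z)%R,
        covering_map m K Km,
        semi_equivelar Km X,
        euler_char Km = (- (2 * m)%:Z)%R
      & (Aut_map Km \isog 'D_((2 * m)%N)) \/ (Aut_map Km \isog Zp m)].
Proof.
have [d dX] := all2_exists all_data_ok hX.
exact: (data_realizes dX hm).
Qed.
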